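(* For the special trivector $\sigma_0$, the singular locus of the Peskine variety $X_1^{\sigma_0}$ consists of $55$ distinct points $(p_{i,j})_{0\le i\le4,\,0\le j\le10}$, where the rank of $\sigma_0$ is equal to $4$ instead of $6$ (that is, $\mathrm{rk}\,\sigma_0(V_1,-,-)=4$ for $[V_1]=p_{i,j}$). The group $\mathbf G=\mathrm{PSL}(2,\mathbf F_{11})$ acts transitively on these $55$ points.
   Context: We work over $\mathbf C$. Let $\zeta=e^{2\pi i/11}$, $P=\begin{pmatrix}1&1\\0&1\end{pmatrix}$, $R=\begin{pmatrix}4&0\\0&3\end{pmatrix}$ in $\mathbf G$. Let $V_5^\vee$ be the $5$-dimensional irreducible representation $\rho$ of $\mathbf G$ admitting a basis $(y_0,\dots,y_4)$ with $\rho(P)=\mathrm{diag}(\zeta,\zeta^9,\zeta^4,\zeta^3,\zeta^5)$ and $\rho(R)y_i=y_{i+1}$ (indices mod $5$). Let $V_{10}=\bigwedge^2V_5$, so $V_{10}^\vee=\bigwedge^2V_5^\vee$; with $y_{ij}=y_i\wedge y_j$, let $(x_0,\dots,x_9)=(y_{01},y_{12},y_{23},y_{34},y_{40},y_{02},y_{13},y_{24},y_{30},y_{41})$. Writing $[ijk]=x_i\wedge x_j\wedge x_k$, $$\sigma_0=[025]+[136]+[247]+[308]+[419]+[097]+[158]+[269]+[375]+[486]\in\bigwedge^3V_{10}^\vee,$$ which is $\mathbf G$-invariant. The Peskine variety is $X_1^{\sigma_0}=\{[V_1]\in\mathbf P(V_{10})\mid\mathrm{rk}\,\sigma_0(V_1,-,-)\le6\}$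 ($\mathbf P$ parametrizes lines), with scheme structure given by the $8\times8$ Pfaffians of the $10\times10$ skew-symmetric matrix of linear forms $\sigma_0(e_i,e_j,-)$, $(e_i)$ a basis of $V_{10}$; it has dimension $6$. The group $\mathbf G$ acts on $X_1^{\sigma_0}$ through its action on $V_{10}$. *)

(* Defs.v *)
From mathcomp Require Import all_boot all_order all_algebra all_fingroup.
From mathcomp Require Import all_solvable mxrepresentation complex reals.
From mathcomp Require Import mpoly.
(* Not imported: the notations of mathcomp-analysis clash with those of mpoly. *)
From mathcomp Require trigo.

Set Implicit Arguments.
Unset Strict Implicit.
Unset Printing Implicit Defensive.

Import Order.TTheory GRing.Theory Num.Theory.
Local Open Scope ring_scope.

(* Expansion along the first row. *)
Fixpoint pfaffian (K : comNzRingType) (n : nat) : 'M[K]_(n.*2) -> K :=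
  match n with
  | 0 => fun _ => 1
  | m.+1 => fun A : 'M[K]_(m.*2.+2) =>
      \sum_(j < m.*2.+1) (-1) ^+ j * A ord0 (lift ord0 j) *
        pfaffian (\matrix_(k < m.*2, l < m.*2)
                    A (lift ord0 (lift j k)) (lift ord0 (lift j l)))
  end.

(* Points of P^n are nonzero row vectors v : 'rV_n.+1; v and w define the same
   point iff they span the same line, written (v == w)%MS.  A closed subscheme
   of P^n is given by a finite family F of homogeneous polynomials. *)
Section ProjectiveScheme.
Variables (K : fieldType) (n : nat).
Implicit Types (F : seq {mpoly K[n.+1]}) (v : 'rV[K]_n.+1).

Definition jacobian F v : 'M[K]_(size F, n.+1) :=
  \matrix_(k, i) ((F`_k)^`M(i)).@[fun j => v 0 j].

(* The row space is { w | dF_k(v)(w) = 0 for all k }, the tangent space at v of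
   the affine cone. *)
Definition cone_tangent_space F v : 'M[K]_n.+1 := kermx (jacobian F v)^T.

(* The Zariski tangent space at a point [v] of the projective scheme is the
   quotient of the cone tangent space by the line spanned by v. *)
Definition tangent_dim F v : nat := (\rank (cone_tangent_space F v)).-1.

(* Singularity at a point [v] of a projective scheme all of whose irreducible
   components have dimension d. *)
Definition singular_pt (d : nat) F v : bool := (d < tangent_dim F v)%N.
End ProjectiveScheme.

Section Trivector.
Variable K : fieldType.
Implicit Types u v w : 'rV[K]_10.

(* x_i /\ x_j /\ x_k as an alternating form, x_i being the i-th coordinate. *)
Definition wedge3 (i j k : nat) u v w : K :=
  \det (\matrix_(a < 3, b < 3)
          (([:: u; v; w]`_a : 'rV[K]_10) 0 (inord (nth 0%N [:: i; j; k] b)))).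

Definition sigma0 u v w : K :=
  wedge3 0 2 5 u v w + wedge3 1 3 6 u v w + wedge3 2 4 7 u v w +
  wedge3 3 0 8 u v w + wedge3 4 1 9 u v w + wedge3 0 9 7 u v w +
  wedge3 1 5 8 u v w + wedge3 2 6 9 u v w + wedge3 3 7 5 u v w +
  wedge3 4 8 6 u v w.

Definition contract v : 'M[K]_10 := \matrix_(i, j) sigma0 v 'e_i 'e_j.

Definition peskine v : bool := (v != 0) && (\rank (contract v) <= 6)%N.

Definition sigma0_mx : 'M[{mpoly K[10]}]_10 :=
  \matrix_(i, j) \sum_(k < 10) sigma0 'e_i 'e_j 'e_k *: 'X_k.

(* Rows and columns a and lift a b are deleted, so that each of the 45
   8 x 8 Pfaffians occurs twice. *)
Definition pfaffian8 (a : 'I_10) (b : 'I_9) : {mpoly K[10]} :=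
  @pfaffian _ 4 (\matrix_(k < 8, l < 8)
                   sigma0_mx (lift a (lift b k)) (lift a (lift b l))).

Definition peskine_eqs : seq {mpoly K[10]} :=
  [seq pfaffian8 a b | a <- enum 'I_10, b <- enum 'I_9].

(* The Peskine variety has dimension 6; being defined by the Pfaffians of a
   family of forms of rank <= 6 on the 9-dimensional quotients V_10 / V_1, all
   its components have codimension at most 3, hence it is equidimensional. *)
Definition peskine_singular v : bool :=
  peskine v && singular_pt 6 peskine_eqs v.
End Trivector.

Section PSL.

Definition SL2_11 : {set {'GL_2['F_11]}} := [set g | \det (GLval g) == 1].

Lemma SL2_11_group_set : group_set SL2_11.
Proof.
apply/group_setP; split=> [|g h]; rewrite !inE; first by rewrite GL_1E det1.
by move=> /eqP dg /eqP dh; rewrite GL_MxE det_mulmx dg dh mulr1.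
Qed.

Canonical SL2_11_group := Group SL2_11_group_set.

Definition PSL2_11 := (SL2_11 / 'Z(SL2_11))%G.

Definition mx22 (a b c d : 'F_11) : 'M['F_11]_2 :=
  \matrix_(i, j) nth 0 (nth [::] [:: [:: a; b]; [:: c; d]] i) j.

Lemma mx22_det a b c d : \det (mx22 a b c d) = a * d - b * c.
Proof.
rewrite (expand_det_row _ 0) !big_ord_recl big_ord0 /cofactor !det_mx11 !mxE /=.
by rewrite addr0 expr0 expr1 mul1r mulN1r mulrN.
Qed.

Lemma mxP_unit : mx22 1 1 0 1 \in unitmx.
Proof. by rewrite unitmxE mx22_det. Qed.

Lemma mxR_unit : mx22 4%:R 0 0 3%:R \in unitmx.
Proof. by rewrite unitmxE mx22_det. Qed.

Definition PSL_P : coset_of 'Z(SL2_11) :=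
  coset 'Z(SL2_11) (FinRing.unit _ mxP_unit : {'GL_2['F_11]}).

Definition PSL_R : coset_of 'Z(SL2_11) :=
  coset 'Z(SL2_11) (FinRing.unit _ mxR_unit : {'GL_2['F_11]}).
End PSL.

Section Representation.
Variable R : realType.

(* e^(2 i pi / 11) *)
Definition zeta : R[i] :=
  (trigo.cos (2 * trigo.pi / 11) +i* trigo.sin (2 * trigo.pi / 11))%C.

(* Matrices in the basis (y_0, ..., y_4) of V_5^dual.  The group acts on the
   left, on column vectors: column i of rho g is rho(g) y_i.  The module
   underlying mx_irreducible consists of row vectors, that is, of the dual;
   over the complex numbers one is irreducible iff the other is. *)
Definition is_V5dual (rho : mx_representation R[i] PSL2_11 5) : Prop :=
  [/\ mx_irreducible rho,
      rho PSL_P = diag_mx (\row_i zeta ^+ nth 0%N [:: 1; 9; 4; 3; 5]%N i)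
    & forall i : 'I_5, col i (rho PSL_R) = delta_mx (i + 1) 0].

(* x_k = y_a /\ y_b for (a, b) the k-th pair. *)
Definition xpair (k : 'I_10) : 'I_5 * 'I_5 :=
  let ab := nth (0, 0)%N [:: (0, 1); (1, 2); (2, 3); (3, 4); (4, 0);
                             (0, 2); (1, 3); (2, 4); (3, 0); (4, 1)]%N k in
  (inord ab.1, inord ab.2).

(* Second exterior power of A in the basis (x_0, ..., x_9). *)
Definition ext2 (A : 'M[R[i]]_5) : 'M[R[i]]_10 :=
  \matrix_(l, k)
    (A (xpair l).1 (xpair k).1 * A (xpair l).2 (xpair k).2
     - A (xpair l).1 (xpair k).2 * A (xpair l).2 (xpair k).1).

(* The left action on V_10, contragredient to the one on its dual:
   x_k (g v) = (g^-1 x_k) (v), where v is the row of its coordinates x_k (v). *)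
Definition actV10 (rho : mx_representation R[i] PSL2_11 5)
    (g : coset_of 'Z(SL2_11)) (v : 'rV[R[i]]_10) : 'rV[R[i]]_10 :=
  v *m ext2 (rho g^-1%g).
End Representation.

(* Main.v *)
(* At a point [v] where sigma0 (v, -, -) has rank 6, the Jacobian of the 8 x 8
   Pfaffians contains the forms sigma0 (u, u', -) for all u, u' in the
   4-dimensional kernel H of sigma0 (v, -, -).  If it had rank at most 2, some
   bivector of the 3-dimensional space H / v, necessarily of the form u /\ u',
   would map to 0, so that sigma0 (a, b, -) = 0 for all a, b in <v, u, u'>; but
   eliminating in the Plucker relations shows that no 3-space has this property.
   At a point of rank at most 4 the Jacobian is zero.  Hence the singular points
   are the zeros of the 6 x 6 Pfaffians.

   At such a zero, the vector n of the five monomials x4 x5, x0 x6, x1 x7, x2 x8,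
   x3 x9 of weight 0 for P satisfies 2 x7 x9 n = x2 x5 T n, where T is a constant
   matrix with five distinct eigenvalues.  So n is known up to five choices and
   a scalar, and then the point is known up to the action of P, of order 11.

   P and R permute the 55 points transitively.  By the Bruhat decomposition it
   remains to treat S = (0, -1; 1, 0).  As R S R = S, the matrix of S is Hankel,
   and the relations S P^n S = P^m S R^k P^m, summed against the characters of
   <P> which do not occur in V_5^dual, are linear equations which determine it. *)
From HB Require Import structures.
From Stdlib Require Import BinInt Znat.
Require Import Defs.
From mathcomp Require Import all_boot all_order all_algebra all_fingroup.
From mathcomp Require Import all_solvable mxrepresentation complex reals.
From mathcomp Require Import mpoly ring ssrZ.
From mathcomp Require trigo.

Set Implicit Arguments.
Unset Strict Implicit.
Unset Printing Implicit Defensive.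

Import Order.TTheory GRing.Theory Num.Theory.
Local Open Scope ring_scope.
Delimit Scope Z_scope with coqZ.

(** * Pfaffians of orders 4, 6 and 8 *)

Section SmallPfaffians.
Variables (K : comNzRingType) (T : Type).
Implicit Types N M : T -> T -> K.

Definition pf4 N a b c d := N a b * N c d - N a c * N b d + N a d * N b c.

Definition pf6 N a b c d e f :=
  N a b * pf4 N c d e f - N a c * pf4 N b d e f + N a d * pf4 N b c e f
  - N a e * pf4 N b c d f + N a f * pf4 N b c d e.

Definition pf8 N a b c d e f g h :=
  N a b * pf6 N c d e f g h - N a c * pf6 N b d e f g h
  + N a d * pf6 N b c e f g h - N a e * pf6 N b c d f g h
  + N a f * pf6 N b c d e g h - N a g * pf6 N b c d e f h
  + N a h * pf6 N b c d e f g.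

Definition dpf4 N M a b c d :=
  M a b * N c d - M a c * N b d + M a d * N b c
  + (N a b * M c d - N a c * M b d + N a d * M b c).

Definition dpf6 N M a b c d e f :=
  M a b * pf4 N c d e f - M a c * pf4 N b d e f + M a d * pf4 N b c e f
  - M a e * pf4 N b c d f + M a f * pf4 N b c d e
  + (N a b * dpf4 N M c d e f - N a c * dpf4 N M b d e f
     + N a d * dpf4 N M b c e f - N a e * dpf4 N M b c d f
     + N a f * dpf4 N M b c d e).

Definition dpf8 N M a b c d e f g h :=
  M a b * pf6 N c d e f g h - M a c * pf6 N b d e f g h
  + M a d * pf6 N b c e f g h - M a e * pf6 N b c d f g h
  + M a f * pf6 N b c d e g h - M a g * pf6 N b c d e f h
  + M a h * pf6 N b c d e f g
  + (N a b * dpf6 N M c d e f g h - N a c * dpf6 N M b d e f g h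
     + N a d * dpf6 N M b c e f g h - N a e * dpf6 N M b c d f g h
     + N a f * dpf6 N M b c d e g h - N a g * dpf6 N M b c d e f h
     + N a h * dpf6 N M b c d e f g).

Definition skew_fun N := forall i j, N j i = - N i j.

Lemma pf4_indep N x0 x1 x2 x3 (c0 c1 c2 c3 : K) :
    skew_fun N -> (forall i, N i i = 0) ->
    (forall t, c0 * N x0 t + c1 * N x1 t + c2 * N x2 t + c3 * N x3 t = 0) ->
  forall c, c \in [:: c0; c1; c2; c3] -> c * pf4 N x0 x1 x2 x3 = 0.
Proof.
move=> sN aN h0 c.
pose h t := c0 * N x0 t + c1 * N x1 t + c2 * N x2 t + c3 * N x3 t.
have hE t : h t = 0 by exact: h0.
rewrite !inE => /orP[/eqP->|/orP[/eqP->|/orP[/eqP->|/eqP->]]].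
- rewrite [LHS](_ : _ = h x1 * N x2 x3 - h x2 * N x1 x3 + h x3 * N x1 x2);
    first by rewrite !hE !(mul0r, subr0, addr0, oppr0).
  rewrite /h /pf4 ?aN ?(sN x0) ?(sN x1 x2) ?(sN x1 x3) ?(sN x2 x3); ring.
- rewrite [LHS](_ : _ = - h x0 * N x2 x3 + h x2 * N x0 x3 - h x3 * N x0 x2);
    first by rewrite !hE !(mul0r, subr0, addr0, oppr0).
  rewrite /h /pf4 ?aN ?(sN x0) ?(sN x1 x2) ?(sN x1 x3) ?(sN x2 x3); ring.
- rewrite [LHS](_ : _ = h x0 * N x1 x3 - h x1 * N x0 x3 + h x3 * N x0 x1);
    first by rewrite !hE !(mul0r, subr0, addr0, oppr0).
  rewrite /h /pf4 ?aN ?(sN x0) ?(sN x1 x2) ?(sN x1 x3) ?(sN x2 x3); ring.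
- rewrite [LHS](_ : _ = - h x0 * N x1 x2 + h x1 * N x0 x2 - h x2 * N x0 x1);
    first by rewrite !hE !(mul0r, subr0, addr0, oppr0).
  rewrite /h /pf4 ?aN ?(sN x0) ?(sN x1 x2) ?(sN x1 x3) ?(sN x2 x3); ring.
Qed.

Lemma pf6_indep N x0 x1 x2 x3 x4 x5 (c0 c1 c2 c3 c4 c5 : K) :
    skew_fun N -> (forall i, N i i = 0) ->
    (forall t, c0 * N x0 t + c1 * N x1 t + c2 * N x2 t + c3 * N x3 t
             + c4 * N x4 t + c5 * N x5 t = 0) ->
  forall c, c \in [:: c0; c1; c2; c3; c4; c5] ->
  c * pf6 N x0 x1 x2 x3 x4 x5 = 0.
Proof.
move=> sN aN h0 c.
pose h t := c0 * N x0 t + c1 * N x1 t + c2 * N x2 t + c3 * N x3 t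
             + c4 * N x4 t + c5 * N x5 t.
have hE t : h t = 0 by exact: h0.
rewrite !inE => /orP[/eqP->|/orP[/eqP->|/orP[/eqP->|/orP[/eqP->|/orP[/eqP->|/eqP->]]]]].
- rewrite [LHS](_ : _ = h x1 * pf4 N x2 x3 x4 x5 - h x2 * pf4 N x1 x3 x4 x5 + h x3 * pf4 N
  x1 x2 x4 x5 - h x4 * pf4 N x1 x2 x3 x5 + h x5 * pf4 N x1 x2 x3 x4);
    first by rewrite !hE !(mul0r, subr0, addr0, oppr0).
  rewrite /h /pf6 /pf4 ?aN ?(sN x0) ?(sN x1 x2) ?(sN x1 x3) ?(sN x1 x4) ?(sN x1 x5).
  by rewrite ?(sN x2 x3) ?(sN x2 x4) ?(sN x2 x5) ?(sN x3 x4) ?(sN x3 x5) ?(sN x4 x5); ring.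
- rewrite [LHS](_ : _ = - h x0 * pf4 N x2 x3 x4 x5 + h x2 * pf4 N x0 x3 x4 x5 - h x3 * pf4
  N x0 x2 x4 x5 + h x4 * pf4 N x0 x2 x3 x5 - h x5 * pf4 N x0 x2 x3 x4);
    first by rewrite !hE !(mul0r, subr0, addr0, oppr0).
  rewrite /h /pf6 /pf4 ?aN ?(sN x0) ?(sN x1 x2) ?(sN x1 x3) ?(sN x1 x4) ?(sN x1 x5).
  by rewrite ?(sN x2 x3) ?(sN x2 x4) ?(sN x2 x5) ?(sN x3 x4) ?(sN x3 x5) ?(sN x4 x5); ring.
- rewrite [LHS](_ : _ = h x0 * pf4 N x1 x3 x4 x5 - h x1 * pf4 N x0 x3 x4 x5 + h x3 * pf4 N
  x0 x1 x4 x5 - h x4 * pf4 N x0 x1 x3 x5 + h x5 * pf4 N x0 x1 x3 x4);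
    first by rewrite !hE !(mul0r, subr0, addr0, oppr0).
  rewrite /h /pf6 /pf4 ?aN ?(sN x0) ?(sN x1 x2) ?(sN x1 x3) ?(sN x1 x4) ?(sN x1 x5).
  by rewrite ?(sN x2 x3) ?(sN x2 x4) ?(sN x2 x5) ?(sN x3 x4) ?(sN x3 x5) ?(sN x4 x5); ring.
- rewrite [LHS](_ : _ = - h x0 * pf4 N x1 x2 x4 x5 + h x1 * pf4 N x0 x2 x4 x5 - h x2 * pf4
  N x0 x1 x4 x5 + h x4 * pf4 N x0 x1 x2 x5 - h x5 * pf4 N x0 x1 x2 x4);
    first by rewrite !hE !(mul0r, subr0, addr0, oppr0).
  rewrite /h /pf6 /pf4 ?aN ?(sN x0) ?(sN x1 x2) ?(sN x1 x3) ?(sN x1 x4) ?(sN x1 x5).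
  by rewrite ?(sN x2 x3) ?(sN x2 x4) ?(sN x2 x5) ?(sN x3 x4) ?(sN x3 x5) ?(sN x4 x5); ring.
- rewrite [LHS](_ : _ = h x0 * pf4 N x1 x2 x3 x5 - h x1 * pf4 N x0 x2 x3 x5 + h x2 * pf4 N
  x0 x1 x3 x5 - h x3 * pf4 N x0 x1 x2 x5 + h x5 * pf4 N x0 x1 x2 x3);
    first by rewrite !hE !(mul0r, subr0, addr0, oppr0).
  rewrite /h /pf6 /pf4 ?aN ?(sN x0) ?(sN x1 x2) ?(sN x1 x3) ?(sN x1 x4) ?(sN x1 x5).
  by rewrite ?(sN x2 x3) ?(sN x2 x4) ?(sN x2 x5) ?(sN x3 x4) ?(sN x3 x5) ?(sN x4 x5); ring.
- rewrite [LHS](_ : _ = - h x0 * pf4 N x1 x2 x3 x4 + h x1 * pf4 N x0 x2 x3 x4 - h x2 * pf4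
  N x0 x1 x3 x4 + h x3 * pf4 N x0 x1 x2 x4 - h x4 * pf4 N x0 x1 x2 x3);
    first by rewrite !hE !(mul0r, subr0, addr0, oppr0).
  rewrite /h /pf6 /pf4 ?aN ?(sN x0) ?(sN x1 x2) ?(sN x1 x3) ?(sN x1 x4) ?(sN x1 x5).
  by rewrite ?(sN x2 x3) ?(sN x2 x4) ?(sN x2 x5) ?(sN x3 x4) ?(sN x3 x5) ?(sN x4 x5); ring.
Qed.

Lemma dpf8_dep N M x0 x1 x2 x3 x4 x5 y z (c0 c1 c2 c3 c4 c5 d0 d1 d2 d3 d4 d5 : K) :
    skew_fun N -> (forall i, N i i = 0) -> skew_fun M -> (forall i, M i i = 0) ->
    (forall t, N y t = c0 * N x0 t + c1 * N x1 t + c2 * N x2 t + c3 * N x3 t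
             + c4 * N x4 t + c5 * N x5 t) ->
    (forall t, N z t = d0 * N x0 t + d1 * N x1 t + d2 * N x2 t + d3 * N x3 t
             + d4 * N x4 t + d5 * N x5 t) ->
  dpf8 N M x0 x1 x2 x3 x4 x5 y z = pf6 N x0 x1 x2 x3 x4 x5 *
   (M y z - (d0 * M y x0 + d1 * M y x1 + d2 * M y x2 + d3 * M y x3 + d4 * M y x4 + d5 * M y x5)
    - (c0 * (M x0 z - (d0 * M x0 x0 + d1 * M x0 x1 + d2 * M x0 x2 + d3 * M x0 x3 + d4 * M
      x0 x4 + d5 * M x0 x5))
     + c1 * (M x1 z - (d0 * M x1 x0 + d1 * M x1 x1 + d2 * M x1 x2 + d3 * M x1 x3 + d4 * M
       x1 x4 + d5 * M x1 x5))
     + c2 * (M x2 z - (d0 * M x2 x0 + d1 * M x2 x1 + d2 * M x2 x2 + d3 * M x2 x3 + d4 * M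
       x2 x4 + d5 * M x2 x5))
     + c3 * (M x3 z - (d0 * M x3 x0 + d1 * M x3 x1 + d2 * M x3 x2 + d3 * M x3 x3 + d4 * M
       x3 x4 + d5 * M x3 x5))
     + c4 * (M x4 z - (d0 * M x4 x0 + d1 * M x4 x1 + d2 * M x4 x2 + d3 * M x4 x3 + d4 * M
       x4 x4 + d5 * M x4 x5))
     + c5 * (M x5 z - (d0 * M x5 x0 + d1 * M x5 x1 + d2 * M x5 x2 + d3 * M x5 x3 + d4 * M
       x5 x4 + d5 * M x5 x5)))).
Proof.
move=> sN aN sM aM hy hz.
have Nyz : N y z = (d0 * (c0 * N x0 x0 + c1 * N x1 x0 + c2 * N x2 x0 + c3 * N x3 x0
             + c4 * N x4 x0 + c5 * N x5 x0) + d1 * (c0 * N x0 x1 + c1 * N x1 x1 + c2 * N x2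
               x1 + c3 * N x3 x1
             + c4 * N x4 x1 + c5 * N x5 x1) + d2 * (c0 * N x0 x2 + c1 * N x1 x2 + c2 * N x2
               x2 + c3 * N x3 x2
             + c4 * N x4 x2 + c5 * N x5 x2) + d3 * (c0 * N x0 x3 + c1 * N x1 x3 + c2 * N x2
               x3 + c3 * N x3 x3
             + c4 * N x4 x3 + c5 * N x5 x3) + d4 * (c0 * N x0 x4 + c1 * N x1 x4 + c2 * N x2
               x4 + c3 * N x3 x4
             + c4 * N x4 x4 + c5 * N x5 x4) + d5 * (c0 * N x0 x5 + c1 * N x1 x5 + c2 * N x2
               x5 + c3 * N x3 x5
             + c4 * N x4 x5 + c5 * N x5 x5)).
  by rewrite sN hz -!hy ?(fun j => sN y j); ring.
rewrite /dpf8 /dpf6 /dpf4 /pf6 /pf4 Nyz ?(fun i => sN z i) !hz ?(fun i => sN y i) !hy ?aN ?aM.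
rewrite ?(sM y x0) ?(sM y x1) ?(sM y x2) ?(sM y x3) ?(sM y x4) ?(sM y x5).
rewrite ?(sN x0) ?(sN x1 x2) ?(sN x1 x3) ?(sN x1 x4) ?(sN x1 x5).
rewrite ?(sN x2 x3) ?(sN x2 x4) ?(sN x2 x5) ?(sN x3 x4) ?(sN x3 x5) ?(sN x4 x5).
rewrite ?(sM x0 x1) ?(sM x0 x2) ?(sM x0 x3) ?(sM x0 x4) ?(sM x0 x5).
rewrite ?(sM x1 x2) ?(sM x1 x3) ?(sM x1 x4) ?(sM x1 x5).
rewrite ?(sM x2 x3) ?(sM x2 x4) ?(sM x2 x5) ?(sM x3 x4) ?(sM x3 x5) ?(sM x4 x5).
ring.
Qed.

Lemma dpf8E N M a b c d e f g h : dpf8 N M a b c d e f g h =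
    M a b * pf6 N c d e f g h
    - M a c * pf6 N b d e f g h
    + M a d * pf6 N b c e f g h
    - M a e * pf6 N b c d f g h
    + M a f * pf6 N b c d e g h
    - M a g * pf6 N b c d e f h
    + M a h * pf6 N b c d e f g
    + M b c * pf6 N a d e f g h
    - M b d * pf6 N a c e f g h
    + M b e * pf6 N a c d f g h
    - M b f * pf6 N a c d e g h
    + M b g * pf6 N a c d e f h
    - M b h * pf6 N a c d e f g
    + M c d * pf6 N a b e f g h
    - M c e * pf6 N a b d f g h
    + M c f * pf6 N a b d e g h
    - M c g * pf6 N a b d e f h
    + M c h * pf6 N a b d e f g
    + M d e * pf6 N a b c f g h
    - M d f * pf6 N a b c e g h
    + M d g * pf6 N a b c e f h
    - M d h * pf6 N a b c e f g
    + M e f * pf6 N a b c d g h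
    - M e g * pf6 N a b c d f h
    + M e h * pf6 N a b c d f g
    + M f g * pf6 N a b c d e h
    - M f h * pf6 N a b c d e g
    + M g h * pf6 N a b c d e f.
Proof. by rewrite /dpf8 /dpf6 /dpf4 /pf6 /pf4; ring. Qed.

Lemma pf8_swap1 N x0 x1 x2 x3 x4 x5 x6 x7 : skew_fun N ->
  pf8 N x1 x0 x2 x3 x4 x5 x6 x7 = - pf8 N x0 x1 x2 x3 x4 x5 x6 x7.
Proof.
move=> sN; rewrite /pf8 /pf6 /pf4.
rewrite ?(sN x0 x1) ?(sN x0 x2) ?(sN x0 x3) ?(sN x0 x4) ?(sN x0 x5) ?(sN x0 x6) ?(sN x0 x7)
  ?(sN x1 x2) ?(sN x1 x3) ?(sN x1 x4) ?(sN x1 x5) ?(sN x1 x6) ?(sN x1 x7).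
ring.
Qed.

Lemma pf8_swap2 N x0 x1 x2 x3 x4 x5 x6 x7 : skew_fun N ->
  pf8 N x2 x1 x0 x3 x4 x5 x6 x7 = - pf8 N x0 x1 x2 x3 x4 x5 x6 x7.
Proof.
move=> sN; rewrite /pf8 /pf6 /pf4.
rewrite ?(sN x0 x1) ?(sN x0 x2) ?(sN x0 x3) ?(sN x0 x4) ?(sN x0 x5) ?(sN x0 x6) ?(sN x0 x7)
  ?(sN x1 x2) ?(sN x2 x3) ?(sN x2 x4) ?(sN x2 x5) ?(sN x2 x6) ?(sN x2 x7).
ring.
Qed.

Lemma pf8_swap3 N x0 x1 x2 x3 x4 x5 x6 x7 : skew_fun N ->
  pf8 N x3 x1 x2 x0 x4 x5 x6 x7 = - pf8 N x0 x1 x2 x3 x4 x5 x6 x7.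
Proof.
move=> sN; rewrite /pf8 /pf6 /pf4.
rewrite ?(sN x0 x1) ?(sN x0 x2) ?(sN x0 x3) ?(sN x0 x4) ?(sN x0 x5) ?(sN x0 x6) ?(sN x0 x7)
  ?(sN x1 x3) ?(sN x2 x3) ?(sN x3 x4) ?(sN x3 x5) ?(sN x3 x6) ?(sN x3 x7).
ring.
Qed.

Lemma pf8_swap4 N x0 x1 x2 x3 x4 x5 x6 x7 : skew_fun N ->
  pf8 N x4 x1 x2 x3 x0 x5 x6 x7 = - pf8 N x0 x1 x2 x3 x4 x5 x6 x7.
Proof.
move=> sN; rewrite /pf8 /pf6 /pf4.
rewrite ?(sN x0 x1) ?(sN x0 x2) ?(sN x0 x3) ?(sN x0 x4) ?(sN x0 x5) ?(sN x0 x6) ?(sN x0 x7)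
  ?(sN x1 x4) ?(sN x2 x4) ?(sN x3 x4) ?(sN x4 x5) ?(sN x4 x6) ?(sN x4 x7).
ring.
Qed.

Lemma pf8_swap5 N x0 x1 x2 x3 x4 x5 x6 x7 : skew_fun N ->
  pf8 N x5 x1 x2 x3 x4 x0 x6 x7 = - pf8 N x0 x1 x2 x3 x4 x5 x6 x7.
Proof.
move=> sN; rewrite /pf8 /pf6 /pf4.
rewrite ?(sN x0 x1) ?(sN x0 x2) ?(sN x0 x3) ?(sN x0 x4) ?(sN x0 x5) ?(sN x0 x6) ?(sN x0 x7)
  ?(sN x1 x5) ?(sN x2 x5) ?(sN x3 x5) ?(sN x4 x5) ?(sN x5 x6) ?(sN x5 x7).
ring.
Qed.

Lemma pf8_swap6 N x0 x1 x2 x3 x4 x5 x6 x7 : skew_fun N ->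
  pf8 N x6 x1 x2 x3 x4 x5 x0 x7 = - pf8 N x0 x1 x2 x3 x4 x5 x6 x7.
Proof.
move=> sN; rewrite /pf8 /pf6 /pf4.
rewrite ?(sN x0 x1) ?(sN x0 x2) ?(sN x0 x3) ?(sN x0 x4) ?(sN x0 x5) ?(sN x0 x6) ?(sN x0 x7)
  ?(sN x1 x6) ?(sN x2 x6) ?(sN x3 x6) ?(sN x4 x6) ?(sN x5 x6) ?(sN x6 x7).
ring.
Qed.

Lemma pf8_swap7 N x0 x1 x2 x3 x4 x5 x6 x7 : skew_fun N ->
  pf8 N x7 x1 x2 x3 x4 x5 x6 x0 = - pf8 N x0 x1 x2 x3 x4 x5 x6 x7.
Proof.
move=> sN; rewrite /pf8 /pf6 /pf4.
rewrite ?(sN x0 x1) ?(sN x0 x2) ?(sN x0 x3) ?(sN x0 x4) ?(sN x0 x5) ?(sN x0 x6) ?(sN x0 x7)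
  ?(sN x1 x7) ?(sN x2 x7) ?(sN x3 x7) ?(sN x4 x7) ?(sN x5 x7) ?(sN x6 x7).
ring.
Qed.
End SmallPfaffians.

(** * The trivector *)

Lemma sum10 (V : nmodType) (F : nat -> V) : \sum_(k < 10) F k =
  F 0 + F 1 + F 2 + F 3 + F 4 + F 5 + F 6 + F 7 + F 8 + F 9.
Proof. by rewrite !big_ord_recr big_ord0 /= add0r. Qed.

Lemma inord10_eq a b : (a < 10)%N -> (b < 10)%N ->
  (inord a == inord b :> 'I_10) = (a == b).
Proof. by move=> ha hb; rewrite -val_eqE /= !inordK. Qed.

Section Sigma0.
Variable K : fieldType.
Implicit Types u v w : 'rV[K]_10.

Lemma wedge3E i j k u v w : wedge3 i j k u v w =
  u 0 (inord i) * (v 0 (inord j) * w 0 (inord k) - v 0 (inord k) * w 0 (inord j))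
  - u 0 (inord j) * (v 0 (inord i) * w 0 (inord k) - v 0 (inord k) * w 0 (inord i))
  + u 0 (inord k) * (v 0 (inord i) * w 0 (inord j) - v 0 (inord j) * w 0 (inord i)).
Proof.
rewrite /wedge3 (expand_det_row _ 0) !big_ord_recl big_ord0 /cofactor.
rewrite !(expand_det_row _ 0) !big_ord_recl !big_ord0 /cofactor !det_mx11 !mxE /=.
by rewrite /bump /=; ring.
Qed.

Definition sigma0_coef u v (k : nat) : K :=
  let m i j := u 0 (inord i) * v 0 (inord j) - u 0 (inord j) * v 0 (inord i) in
  nth 0
   [:: m 2%N 5%N + m 8%N 3%N + m 9%N 7%N;
      m 3%N 6%N + m 9%N 4%N + m 5%N 8%N;
      m 4%N 7%N + m 5%N 0%N + m 6%N 9%N;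
      m 0%N 8%N + m 6%N 1%N + m 7%N 5%N;
      m 1%N 9%N + m 7%N 2%N + m 8%N 6%N;
      m 0%N 2%N + m 8%N 1%N + m 3%N 7%N;
      m 1%N 3%N + m 9%N 2%N + m 4%N 8%N;
      m 2%N 4%N + m 5%N 3%N + m 0%N 9%N;
      m 3%N 0%N + m 6%N 4%N + m 1%N 5%N;
      m 4%N 1%N + m 7%N 0%N + m 2%N 6%N] k.

Lemma sigma0E u v w : sigma0 u v w = \sum_(k < 10) sigma0_coef u v k * w 0 k.
Proof.
transitivity (\sum_(k < 10) sigma0_coef u v k * w 0 (inord k)); last first.
  by apply: eq_bigr => k _; rewrite inord_val.
rewrite (sum10 (fun k => sigma0_coef u v k * w 0 (inord k))) /sigma0_coef /=.
by rewrite /sigma0 !wedge3E; ring.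
Qed.

Lemma sigma0_delta u v k : (k < 10)%N ->
  sigma0 u v 'e_(inord k) = sigma0_coef u v k.
Proof.
move=> k10; rewrite sigma0E (bigD1 (inord k)) //= mxE !eqxx mulr1 inordK //.
by rewrite big1 ?addr0 // => l /negPf lk; rewrite mxE lk andbF mulr0.
Qed.

Lemma sigma0_rot u v w : sigma0 u v w = sigma0 v w u.
Proof. by rewrite /sigma0 !wedge3E; ring. Qed.

Lemma sigma0C u v w : sigma0 u v w = - sigma0 v u w.
Proof. by rewrite /sigma0 !wedge3E; ring. Qed.

Lemma sigma0_alt u w : sigma0 u u w = 0.
Proof. by rewrite /sigma0 !wedge3E; ring. Qed.

Lemma sigma0_linear u v : linear_for *%R (sigma0 u v).
Proof.
move=> a w w'; rewrite !sigma0E mulr_sumr -big_split; apply: eq_bigr => k _.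
by rewrite !mxE mulrDr mulrCA.
Qed.

HB.instance Definition _ u v :=
  GRing.isLinear.Build K 'rV[K]_10 K *%R (sigma0 u v) (sigma0_linear u v).

Lemma sigma0_sumr u v w : sigma0 u v w = \sum_i w 0 i * sigma0 u v 'e_i.
Proof.
by rewrite {1}(row_sum_delta w) linear_sum; apply: eq_bigr => i _; rewrite linearZ.
Qed.

Lemma sigma0_suml u v w : sigma0 u v w = \sum_i u 0 i * sigma0 'e_i v w.
Proof. by rewrite sigma0_rot sigma0_sumr; apply: eq_bigr => i _; rewrite -sigma0_rot. Qed.

Lemma contract_skew v : skew_fun (contract v).
Proof. by move=> i j; rewrite !mxE sigma0_rot -sigma0_rot sigma0_rot sigma0C -sigma0_rot. Qed.
End Sigma0.

(** * The Jacobian of the 8 x 8 Pfaffians *)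

Section PfaffianSmall.
Variables (K : comNzRingType) (T : Type) (N : T -> T -> K).
Implicit Types (g : nat -> T).

Lemma pfaffianS m g :
  @pfaffian K m.+1 (\matrix_(k, l) N (g k) (g l)) =
  \sum_(j < m.*2.+1) (-1) ^+ j * N (g 0%N) (g j.+1) *
    @pfaffian K m (\matrix_(k, l) N (g (bump j k).+1) (g (bump j l).+1)).
Proof.
apply: eq_bigr => j _; rewrite mxE; congr (_ * pfaffian _).
by apply/matrixP => k l; rewrite !mxE.
Qed.

Lemma pfaffian2E g :
  @pfaffian K 1 (\matrix_(k, l) N (g k) (g l)) = N (g 0%N) (g 1%N).
Proof. by rewrite pfaffianS big_ord_recl big_ord0 /= addr0 mul1r mulr1. Qed.

Lemma pfaffian4E g : @pfaffian K 2 (\matrix_(k, l) N (g k) (g l)) =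
  pf4 N (g 0%N) (g 1%N) (g 2) (g 3).
Proof.
rewrite pfaffianS; under eq_bigr => j _.
  rewrite (pfaffian2E (fun n => g (bump j n).+1)); over.
by rewrite !big_ord_recl big_ord0 /pf4 /=; ring.
Qed.

Lemma pfaffian6E g : @pfaffian K 3 (\matrix_(k, l) N (g k) (g l)) =
  pf6 N (g 0%N) (g 1%N) (g 2) (g 3) (g 4) (g 5).
Proof.
rewrite pfaffianS; under eq_bigr => j _.
  rewrite (pfaffian4E (fun n => g (bump j n).+1)); over.
by rewrite !big_ord_recl big_ord0 /pf6 /=; ring.
Qed.

Lemma pfaffian8E g : @pfaffian K 4 (\matrix_(k, l) N (g k) (g l)) =
  pf8 N (g 0%N) (g 1%N) (g 2) (g 3) (g 4) (g 5) (g 6) (g 7).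
Proof.
rewrite pfaffianS; under eq_bigr => j _.
  rewrite (pfaffian6E (fun n => g (bump j n).+1)); over.
by rewrite !big_ord_recl big_ord0 /pf8 /=; ring.
Qed.
End PfaffianSmall.

Section PfaffianPerm.
Variables (K : comNzRingType) (T : Type) (N : T -> T -> K).
Hypothesis sN : skew_fun N.

Definition pf8f (f : 'I_8 -> T) :=
  pf8 N (f (inord 0)) (f (inord 1)) (f (inord 2)) (f (inord 3))
    (f (inord 4)) (f (inord 5)) (f (inord 6)) (f (inord 7)).

Lemma eq_pf8f f f' : f =1 f' -> pf8f f = pf8f f'.
Proof. by move=> e; rewrite /pf8f !e. Qed.

Lemma pf8f_tperm0 f (y : 'I_8) :
  pf8f (f \o tperm 0 y) = (-1) ^+ (y != 0) * pf8f f.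
Proof.
have [->|y0] := eqVneq y 0.
  rewrite tperm1 mul1r /pf8f /=; by rewrite !perm1.
have E k l : (k < 8)%N -> (l < 8)%N -> (inord k == inord l :> 'I_8) = (k == l).
  by move=> hk hl; rewrite -val_eqE /= !inordK.
have -> : 0 = inord 0 :> 'I_8 by apply/val_inj; rewrite /= inordK.
rewrite expr1 mulN1r -[y]inord_val.
case: y y0 => [[|[|[|[|[|[|[|[|//]]]]]]]] hy] //= _;
  rewrite /pf8f /= !permE /= !E //=.
- exact: pf8_swap1.
- exact: pf8_swap2.
- exact: pf8_swap3.
- exact: pf8_swap4.
- exact: pf8_swap5.
- exact: pf8_swap6.
- exact: pf8_swap7.
Qed.

Lemma pf8f_perm f (s : 'S_8) : pf8f (f \o s) = (-1) ^+ s * pf8f f.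
Proof.
have : s \in <<[set tperm (0 : 'I_8) y | y in 'I_8]>>%g.
  by rewrite gen_tperm inE.
case/gen_prodgP => n [c hc ->]; elim: n c hc f => [|n IHn] c hc f.
  by rewrite big_ord0 odd_perm1 mul1r; apply: eq_pf8f => k; rewrite /= perm1.
rewrite big_ord_recr /=.
have /imsetP[y _ ->] := hc ord_max.
set t := (\prod_(i < n) _)%g.
have -> : pf8f (f \o (t * tperm 0 y)%g) = pf8f ((f \o tperm 0 y) \o t).
  by apply: eq_pf8f => k; rewrite /= permM.
rewrite IHn // pf8f_tperm0 mulrA -signr_addb odd_permM odd_tperm.
by rewrite [0 == y]eq_sym.
Qed.
End PfaffianPerm.

Lemma mem_jacobian (K : fieldType) n (F : seq {mpoly K[n.+1]}) (v : 'rV[K]_n.+1) p :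
  p \in F -> (\row_i p^`M(i).@[fun k => v 0 k] <= jacobian F v)%MS.
Proof.
rewrite -index_mem => pF; apply: submx_trans (row_sub (Ordinal pF) _).
rewrite (_ : row _ _ = \row_i p^`M(i).@[fun k => v 0 k]) //.
by apply/rowP => i; rewrite !mxE nth_index // -index_mem.
Qed.

Section Jacobian.
Variable K : numFieldType.
Local Notation A := (sigma0_mx K).
Implicit Types v : 'rV[K]_10.

Lemma contract_diag v i : contract v i i = 0.
Proof. by rewrite mxE sigma0_rot sigma0_alt. Qed.

Lemma sigma0_mx_skew : skew_fun A.
Proof.
move=> i j; rewrite !mxE -sumrN; apply: eq_bigr => k _.
by rewrite -scaleNr sigma0C.
Qed.

Lemma meval_sigma0_mx v i j : (A i j).@[fun k => v 0 k] = contract v i j.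
Proof.
rewrite !mxE rmorph_sum sigma0_rot sigma0_sumr; apply: eq_bigr => k _ /=.
by rewrite mevalZ mevalXU mulrC.
Qed.

Lemma mderiv_sigma0_mx v i j k :
  (A i j)^`M(k).@[fun k => v 0 k] = contract 'e_k i j.
Proof.
rewrite !mxE (raddf_sum (mderiv k)) rmorph_sum /= (bigD1 k) //= big1 => [|l lk].
  rewrite addr0 mderivZ mderivX mnm1E eqxx -{1}[U_(k)%MM]add0m addmK scale1r mevalZ.
  by rewrite mpolyX0 meval1 mulr1 [RHS]sigma0_rot.
by rewrite mderivZ mderivX mnm1E (negPf lk) scale0r scaler0 meval0.
Qed.

Lemma mderiv_pf8 v (k : 'I_10) a b c d e f g h :
  (pf8 A a b c d e f g h)^`M(k).@[fun k => v 0 k] =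
  dpf8 (contract v) (contract 'e_k) a b c d e f g h.
Proof.
pose E (p : {mpoly K[10]}) := p.@[fun k => v 0 k].
pose D (p : {mpoly K[10]}) := p^`M(k).@[fun k => v 0 k].
rewrite -[LHS]/(D _).
have EB p q : E (p - q) = E p - E q by exact: mevalB.
have ED p q : E (p + q) = E p + E q by exact: mevalD.
have EM p q : E (p * q) = E p * E q by exact: mevalM.
have DB p q : D (p - q) = D p - D q by rewrite /D mderivB mevalB.
have DD p q : D (p + q) = D p + D q by rewrite /D mderivD mevalD.
have DM p q : D (p * q) = D p * E q + E p * D q.
  by rewrite /D mderivM mevalD !mevalM.
have EA i j : E (A i j) = contract v i j by exact: meval_sigma0_mx.
have DA i j : D (A i j) = contract 'e_k i j by exact: mderiv_sigma0_mx.
move: (contract v) (contract 'e_k) EA DA => N M EA DA; clearbody E D.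
have E4 i j l m : E (pf4 A i j l m) = pf4 N i j l m.
  by rewrite /pf4 ED EB !EM !EA.
have D4 i j l m : D (pf4 A i j l m) = dpf4 N M i j l m.
  by rewrite /pf4 DD DB !DM !EA !DA /dpf4; ring.
have E6 i j l m n o : E (pf6 A i j l m n o) = pf6 N i j l m n o.
  by rewrite /pf6 ED EB ED EB !EM !E4 !EA.
have D6 i j l m n o :
    D (pf6 A i j l m n o) = dpf6 N M i j l m n o.
  rewrite /pf6 DD DB DD DB !DM !D4 !E4 !EA !DA /dpf6.
  by move: (pf4 N) (dpf4 N M) => p q; ring.
rewrite /pf8; move: (pf6 A) E6 D6 => p6 E6 D6.
rewrite DD DB DD DB DD DB !DM !D6 !E6 !EA !DA /dpf8.
by move: (pf6 N) (dpf6 N M) => p q; ring.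
Qed.

Lemma pfaffian8_pf8f a b :
  pfaffian8 K a b = pf8f A (fun k => lift a (lift b k)).
Proof.
rewrite /pf8f -(pfaffian8E A (fun n => lift a (lift b (inord n)))).
by congr pfaffian; apply/matrixP => k l; rewrite 2!mxE !inord_val.
Qed.

Lemma jacobian_pf8 v (z : 'I_8 -> 'I_10) :
  (\row_i (pf8f A z)^`M(i).@[fun k => v 0 k] <= jacobian (peskine_eqs K) v)%MS.
Proof.
have [/injectiveP zI|/injectivePn[k [l kl zkl]]] := boolP (injectiveb z); last first.
  suff -> : pf8f A z = 0.
    by rewrite (_ : \row_i _ = 0) ?sub0mx //; apply/rowP => i; rewrite !mxE mderiv0 meval0.
  have E : pf8f A (z \o tperm k l) = pf8f A z.
    by apply: eq_pf8f => i /=; case: tpermP => [->|->|].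
  have := pf8f_perm sigma0_mx_skew z (tperm k l).
  rewrite E odd_tperm kl mulN1r => /eqP; rewrite -subr_eq0 opprK -mulr2n.
  by rewrite -mulr_natr mulf_eq0 -mpolyC_nat mpolyC_eq0 pnatr_eq0 orbF => /eqP.
have [a aP] : exists a, a \notin codom z.
  apply/existsP; rewrite -negb_forall; apply/negP => /forallP h.
  have := card_codom zI; rewrite card_ord.
  by rewrite (eq_card (B := {: 'I_10})) ?card_ord // => i; rewrite h.
have /fin_all_exists[z1 z1P] k : exists l, z k = lift a l.
  have /unlift_some[l -> _] : a != z k; last by exists l.
  by apply: contraNneq aP => ->; apply: codom_f.
have z1I : injective z1 by move=> k l e; apply: zI; rewrite !z1P e.
have [b bP] : exists b, b \notin codom z1.
  apply/existsP; rewrite -negb_forall; apply/negP => /forallP h.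
  have := card_codom z1I; rewrite card_ord.
  by rewrite (eq_card (B := {: 'I_9})) ?card_ord // => i; rewrite h.
have /fin_all_exists[s sP] k : exists l, z1 k = lift b l.
  have /unlift_some[l -> _] : b != z1 k; last by exists l.
  by apply: contraNneq bP => ->; apply: codom_f.
have sI : injective s by move=> k l e; apply: z1I; rewrite !sP e.
have -> : pf8f A z = (-1) ^+ perm sI * pfaffian8 K a b.
  rewrite pfaffian8_pf8f -pf8f_perm; last exact: sigma0_mx_skew.
  by apply: eq_pf8f => k /=; rewrite permE z1P sP.
have iP : pfaffian8 K a b \in peskine_eqs K.
  by apply/allpairsP; exists (a, b); rewrite !mem_enum.
apply: submx_trans (mem_jacobian v iP).
rewrite (_ : \row_i _ = (-1) ^+ perm sI *: \row_i (pfaffian8 K a b)^`M(i).@[fun k => v 0 k]).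
  exact: scalemx_sub.
apply/rowP => i; rewrite !mxE mulr_sign; case: (odd_perm _); last by rewrite mul1r.
by rewrite mderivN mevalN mulN1r.
Qed.
End Jacobian.

Section SkewRank.
Variables (K : fieldType) (N : 'M[K]_10).
Hypotheses (sN : skew_fun N) (aN : forall i, N i i = 0).

Definition pf6f (x : 'I_6 -> 'I_10) :=
  pf6 N (x 0) (x 1) (x 2) (x 3) (x 4) (x 5).

Lemma pf6_row_free (x : 'I_6 -> 'I_10) : pf6f x != 0 -> row_free (rowsub x N).
Proof.
move=> x0; apply: inj_row_free => c c0; apply/rowP => j; rewrite mxE.
apply: (mulIf x0); rewrite mul0r.
apply: (@pf6_indep _ _ N _ _ _ _ _ _ (c 0 0) (c 0 1) (c 0 2) (c 0 3) (c 0 4) (c 0 5)) => //.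
  move=> t; have /rowP/(_ t) := c0; rewrite !mxE !big_ord_recl big_ord0 !mxE.
  rewrite addr0 !addrA => <-.
  by do !congr (_ + _); congr (c _ _ * N (x _) _); apply/val_inj.
suff : c 0 j \in [seq c 0 i | i <- [:: 0; 1; 2; 3; 4; 5]] by [].
apply: map_f; case: j => [[|[|[|[|[|[|//]]]]]] hj]; rewrite !inE -?val_eqE //=.
Qed.

Lemma pf6_rank (a b c d e f : 'I_10) : (\rank N <= 4)%N -> pf6 N a b c d e f = 0.
Proof.
move=> rN; apply/eqP; apply: contraLR rN => p0; rewrite -ltnNge.
pose x (i : 'I_6) := nth a [:: a; b; c; d; e; f] i.
have /pf6_row_free : pf6f x != 0 by [].
by move/eqP=> rx; have := mxrankS (rowsub_sub x N); rewrite rx; apply: leq_trans.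
Qed.

Lemma rank_le_rows k (y : 'I_k -> 'I_10) :
  (forall e, exists c : 'rV_k, row e N = c *m rowsub y N) -> (\rank N <= k)%N.
Proof.
move=> h; apply: leq_trans (rank_leq_row (rowsub y N)); apply: mxrankS.
by apply/row_subP => e; have [c ->] := h e; apply: submxMl.
Qed.

Lemma rank_le4_at a b c d : pf4 N a b c d != 0 ->
  (forall e i, pf6 N i e a b c d = 0) -> (\rank N <= 4)%N.
Proof.
move=> p0 h; pose y (i : 'I_4) := nth a [:: a; b; c; d] i.
apply: (@rank_le_rows 4 y) => e.
exists ((pf4 N a b c d)^-1 *: \row_i nth 0
  [:: pf4 N e b c d; - pf4 N e a c d; pf4 N e a b d; - pf4 N e a b c] i).
apply/rowP => i; apply: (mulfI p0); rewrite -scalemxAl !mxE mulVKf //.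
rewrite !big_ord_recl big_ord0 !mxE /= [N e i]sN (sN i) (sN i) (sN i) (sN i).
apply/eqP; rewrite -subr_eq0 /y /=; apply/eqP.
by rewrite -[RHS]oppr0 -[in RHS](h e i) /pf6; ring.
Qed.

Lemma rank_le4P :
  (forall a b c d e f, pf6 N a b c d e f = 0) -> (\rank N <= 4)%N.
Proof.
move=> h6.
have [/existsP[a /existsP[b /existsP[c /existsP[d p0]]]]|] :=
    boolP [exists a, exists b, exists c, exists d, pf4 N a b c d != 0].
  exact: (rank_le4_at p0).
rewrite negb_exists => /forallP h4.
have {}h4 a b c d : pf4 N a b c d = 0.
  apply/eqP; move: (h4 a); rewrite negb_exists => /forallP/(_ b).
  by rewrite negb_exists => /forallP/(_ c); rewrite negb_exists => /forallP/(_ d)/negPn.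
have [/existsP[a /existsP[b p0]]|] := boolP [exists a, exists b, N a b != 0].
  pose y (i : 'I_2) := nth a [:: a; b] i.
  apply: (@leq_trans 2) => //; apply: (@rank_le_rows 2 y) => e.
  exists ((N a b)^-1 *: \row_i nth 0 [:: - N b e; N a e] i).
  apply/rowP => i; apply: (mulfI p0); rewrite -scalemxAl !mxE mulVKf //.
  rewrite !big_ord_recl big_ord0 !mxE /= [N e i]sN (sN i) (sN i).
  apply/eqP; rewrite -subr_eq0 /y /=; apply/eqP.
  by rewrite -[RHS]oppr0 -[in RHS](h4 a b i e) /pf4 (sN e b) (sN i a) (sN i b) (sN e a); ring.
rewrite negb_exists => /forallP h2.
suff -> : N = 0 by rewrite mxrank0.
apply/matrixP => i j; rewrite mxE; apply/eqP; move: (h2 i).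
by rewrite negb_exists => /forallP/(_ j)/negPn.
Qed.

Lemma pf4_rank a b c d : pf4 N a b c d != 0 -> (4 <= \rank N)%N.
Proof.
move=> p0; pose y (i : 'I_4) := nth a [:: a; b; c; d] i.
have : row_free (rowsub y N).
  apply: inj_row_free => w w0; apply/rowP => j; rewrite mxE.
  apply: (mulIf p0); rewrite mul0r.
  apply: (@pf4_indep _ _ N _ _ _ _ (w 0 0) (w 0 1) (w 0 2) (w 0 3)) => //.
    move=> t; have /rowP/(_ t) := w0; rewrite !mxE !big_ord_recl big_ord0 !mxE.
    rewrite addr0 !addrA => <-.
    by do !congr (_ + _); congr (w _ _ * N _ _); apply/val_inj.
  suff : w 0 j \in [seq w 0 i | i <- [:: 0; 1; 2; 3]] by [].
  apply: map_f; case: j => [[|[|[|[|//]]]] hj]; rewrite !inE -?val_eqE //=.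
by move/eqP=> rx; have := mxrankS (rowsub_sub y N); rewrite rx.
Qed.
End SkewRank.

Lemma sum6 (K : nmodType) (F : 'I_6 -> K) :
  \sum_i F i = F 0 + F 1 + F 2 + F 3 + F 4 + F 5.
Proof.
rewrite !big_ord_recl big_ord0 addr0 !addrA.
by do !congr (_ + _); congr F; apply/val_inj.
Qed.

Section KernelForm.
Variables (K : fieldType) (N M : 'M[K]_10) (x : 'I_6 -> 'I_10) (C : 'M[K]_(10, 6)).
Hypotheses (sN : skew_fun N) (aN : forall i, N i i = 0).
Hypotheses (sM : skew_fun M) (aM : forall i, M i i = 0).
Hypothesis NC : N = C *m rowsub x N.

Lemma kernel_form_pf8 y z :
  pf6f N x * ((1%:M - C *m rowsub x 1%:M) *m M *m (1%:M - C *m rowsub x 1%:M)^T) y z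
  = dpf8 N M (x 0) (x 1) (x 2) (x 3) (x 4) (x 5) y z.
Proof.
have rowC a t : N a t = C a 0 * N (x 0) t + C a 1 * N (x 1) t + C a 2 * N (x 2) t
     + C a 3 * N (x 3) t + C a 4 * N (x 4) t + C a 5 * N (x 5) t.
  by rewrite {1}NC mxE sum6 !mxE.
rewrite (dpf8_dep sN aN sM aM (rowC y) (rowC z)); congr (_ * _).
pose L := M - C *m rowsub x M.
have LE a b : L a b = M a b - \sum_j C a j * M (x j) b.
  by rewrite !mxE; congr (_ - _); apply: eq_bigr => j _; rewrite mxE.
have -> : (1%:M - C *m rowsub x 1%:M) *m M *m (1%:M - C *m rowsub x 1%:M)^T
          = L - colsub x L *m C^T.
  rewrite linearB /= trmx1 mulmxBr mulmx1 mulmxBl mul1mx -mulmxA -rowsubE -/L.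
  rewrite trmx_mul mulmxA; congr (_ - _ *m _).
  by apply: trmx_inj; rewrite trmx_mul trmxK trmx_mxsub -rowsubE.
have -> : (L - colsub x L *m C^T) y z = L y z - \sum_j L y (x j) * C z j.
  by rewrite !mxE; congr (_ - _); apply: eq_bigr => j _; rewrite !mxE.
by rewrite sum6 !LE !sum6; ring.
Qed.
End KernelForm.
Section TangentSpace.
Variable K : numFieldType.
Local Notation A := (sigma0_mx K).
Implicit Types u v w : 'rV[K]_10.

Lemma mulmx_contract u w i : (w *m contract u) 0 i = sigma0 u w 'e_i.
Proof.
rewrite mxE sigma0_rot sigma0_suml; apply: eq_bigr => a _.
by rewrite mxE sigma0_rot.
Qed.

Lemma mulmx_contract_tr v u w : (u *m contract v *m w^T) 0 0 = sigma0 v u w.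
Proof.
rewrite mxE sigma0_sumr; apply: eq_bigr => a _.
by rewrite mulmx_contract mxE mulrC.
Qed.

Lemma sub_jacobian_kernel v u w :
    \rank (contract v) = 6%N -> u *m contract v = 0 -> w *m contract v = 0 ->
  (w *m contract u <= jacobian (peskine_eqs K) v)%MS.
Proof.
set N := contract v => rN uN wN.
have sN : skew_fun N by exact: contract_skew.
have aN i : N i i = 0 by exact: contract_diag.
have [x x0] : exists x, pf6f N x != 0.
  have [/existsP[f f0]|/existsPn h] :=
    boolP [exists f : {ffun 'I_6 -> 'I_10}, pf6f N f != 0]; first by exists f.
  suff : (\rank N <= 4)%N by rewrite rN.
  apply: rank_le4P => // a b c d e f.
  have := h [ffun i => nth a [:: a; b; c; d; e; f] (nat_of_ord i)].
  by rewrite negbK /pf6f !ffunE => /eqP.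
have Xf := pf6_row_free sN aN x0.
pose X := rowsub x N; pose E : 'M[K]_(6, 10) := rowsub x 1%:M.
have NX : (N <= X)%MS.
  have [_ <-] := mxrank_leqif_sup (rowsub_sub x N).
  by move/eqP: Xf => ->; rewrite rN.
pose C := N *m pinvmx X.
have NC : N = C *m X by rewrite mulmxKpV.
clearbody C.
have kerC (t : 'rV_10) : t *m N = 0 -> t = t *m (1%:M - C *m E).
  move=> tN; suff tC : t *m C = 0 by rewrite mulmxBr mulmx1 mulmxA tC mul0mx subr0.
  by apply/eqP; rewrite -(mulmx_free_eq0 _ Xf) -mulmxA -/X -NC tN.
pose B (M : 'M[K]_10) := (1%:M - C *m E) *m M *m (1%:M - C *m E)^T.
pose z8 y z (i : 'I_8) := nth y [:: x 0; x 1; x 2; x 3; x 4; x 5; y; z] i.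
have BE (M : 'M[K]_10) y z : skew_fun M -> (forall i, M i i = 0) ->
    B M y z = (pf6f N x)^-1 * dpf8 N M (x 0) (x 1) (x 2) (x 3) (x 4) (x 5) y z.
  by move=> sM aM; rewrite -(kernel_form_pf8 sN aN sM aM NC) mulKf.
have Bsum (M : 'M[K]_10) : (u *m M *m w^T) 0 0 = \sum_y \sum_z u 0 y * w 0 z * B M y z.
  rewrite {1}(kerC _ uN) {1}(kerC _ wN) trmx_mul mulmxA -(mulmxA u) -(mulmxA u) -/(B M).
  rewrite mxE exchange_big /=; apply: eq_bigr => z _.
  rewrite mxE mulr_suml; apply: eq_bigr => y _.
  by rewrite [w^T _ _]mxE mulrAC.
suff -> : w *m contract u = \sum_y \sum_z (u 0 y * w 0 z / pf6f N x) *: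
    \row_i (pf8f A (z8 y z))^`M(i).@[fun k => v 0 k].
  apply: summx_sub => y _; apply: summx_sub => z _; apply: scalemx_sub.
  exact: jacobian_pf8.
apply/rowP => i.
have -> : (w *m contract u) 0 i = (u *m contract 'e_i *m w^T) 0 0.
  by rewrite mulmx_contract mulmx_contract_tr [RHS]sigma0_rot.
rewrite Bsum summxE; apply: eq_bigr => y _; rewrite summxE; apply: eq_bigr => z _.
rewrite 2![in RHS]mxE /pf8f mderiv_pf8 BE; first last.
- exact: contract_diag.
- exact: contract_skew.
by rewrite /z8 !inordK //= mulrA.
Qed.
End TangentSpace.

(** * Isotropic 3-spaces *)

Lemma eq_lin (K : zmodType) (a b x : K) : x = 0 -> a - b = x -> a = b.
Proof. by move=> -> /eqP; rewrite subr_eq0 => /eqP. Qed.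

Lemma eq_linN (K : zmodType) (a b x : K) : x = 0 -> b - a = x -> a = b.
Proof. by move=> e /(eq_lin e). Qed.

Section PluckerRelations.
Variable K : numFieldType.
Implicit Types p : nat -> nat -> nat -> K.

(* The relations between the Plucker coordinates of a 3-space U on which
   sigma0 (u, v, -) = 0 for all u and v in U. *)
Record plucker_sigma0 p : Prop := PluckerSigma0 {
  alt12 : forall i j k, p j i k = - p i j k;
  alt23 : forall i j k, p i k j = - p i j k;
  plucker : forall a b c d e f, p a b c * p d e f - p a b d * p c e f
                              + p a b e * p c d f - p a b f * p c d e = 0;
  sig0 : forall x, p x 2 5 + p x 8 3 + p x 9 7 = 0;
  sig1 : forall x, p x 3 6 + p x 9 4 + p x 5 8 = 0;
  sig2 : forall x, p x 4 7 + p x 5 0 + p x 6 9 = 0;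
  sig3 : forall x, p x 0 8 + p x 6 1 + p x 7 5 = 0;
  sig4 : forall x, p x 1 9 + p x 7 2 + p x 8 6 = 0;
  sig5 : forall x, p x 0 2 + p x 8 1 + p x 3 7 = 0;
  sig6 : forall x, p x 1 3 + p x 9 2 + p x 4 8 = 0;
  sig7 : forall x, p x 2 4 + p x 5 3 + p x 0 9 = 0;
  sig8 : forall x, p x 3 0 + p x 6 4 + p x 1 5 = 0;
  sig9 : forall x, p x 4 1 + p x 7 0 + p x 2 6 = 0
}.

Definition shift5 k := nth 0%N [:: 1; 2; 3; 4; 0; 6; 7; 8; 9; 5]%N k.

Lemma plucker_sigma0_shift p : plucker_sigma0 p ->
  plucker_sigma0 (fun i j k => p (shift5 i) (shift5 j) (shift5 k)).
Proof. by case=> a b P s0 s1 s2 s3 s4 s5 s6 s7 s8 s9; split. Qed.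

Lemma a213 p : plucker_sigma0 p -> forall i j k, p j i k = - p i j k.
Proof. exact: alt12. Qed.

Lemma a132 p : plucker_sigma0 p -> forall i j k, p i k j = - p i j k.
Proof. exact: alt23. Qed.

Lemma a231 p : plucker_sigma0 p -> forall i j k, p j k i = p i j k.
Proof. by move=> h i j k; rewrite (alt23 h) (alt12 h) opprK. Qed.

Lemma a312 p : plucker_sigma0 p -> forall i j k, p k i j = p i j k.
Proof. by move=> h i j k; rewrite (a231 h k i j). Qed.

Lemma a321 p : plucker_sigma0 p -> forall i j k, p k j i = - p i j k.
Proof. by move=> h i j k; rewrite (a231 h) (a132 h). Qed.

Lemma a112 p : plucker_sigma0 p -> forall i k, p i i k = 0.
Proof.
move=> h i k; apply/eqP; have /eqP := a213 h i i k.
by rewrite -subr_eq0 opprK -mulr2n mulrn_eq0.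
Qed.

Lemma a121 p : plucker_sigma0 p -> forall i k, p i k i = 0.
Proof. by move=> h i k; rewrite (a132 h) (a112 h) oppr0. Qed.

Lemma a122 p : plucker_sigma0 p -> forall i k, p k i i = 0.
Proof. by move=> h i k; rewrite -(a231 h) (a112 h). Qed.

Lemma plucker_sigma0_iter n p : plucker_sigma0 p ->
  plucker_sigma0 (fun i j k =>
    p (iter n shift5 i) (iter n shift5 j) (iter n shift5 k)).
Proof.
elim: n p => [|n IHn] p h; first by case: h; split.
by case: (IHn _ (plucker_sigma0_shift h)); split.
Qed.

Lemma eq0M (g x : K) : x = 0 -> g * x = 0. Proof. by move=> ->; rewrite mulr0. Qed.

Lemma eq0D (x y : K) : x = 0 -> y = 0 -> x + y = 0.
Proof. by move=> -> ->; rewrite addr0. Qed.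

Lemma natr_mul_eq0 n (x : K) : (0 < n)%N -> n%:R * x = 0 -> x = 0.
Proof. by case: n => // n _ /eqP; rewrite mulf_eq0 pnatr_eq0 => /eqP. Qed.

Lemma plucker025 p : plucker_sigma0 p -> p 0 2 5 = 0.
Proof.
move=> h.
have s0 := sig0 h 0; rewrite (a132 h 0 3 8) (a132 h 0 7 9) in s0.
have s1 := sig1 h 1; rewrite (a132 h 1 4 9) in s1.
have s2 := sig2 h 2; rewrite (a231 h 0 2 5) in s2.
have s3 := sig3 h 3; rewrite (a213 h 0 3 8) (a231 h 1 3 6) (a132 h 3 5 7) in s3.
have s4 := sig4 h 4; rewrite (a213 h 1 4 9) (a231 h 2 4 7) (a132 h 4 6 8) in s4.
have s5 := sig5 h 5; rewrite (a312 h 0 2 5) (a231 h 1 5 8) (a213 h 3 5 7) in s5.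
have s6 := sig6 h 6; rewrite (a312 h 1 3 6) (a231 h 2 6 9) (a213 h 4 6 8) in s6.
have s7 := sig7 h 7; rewrite (a312 h 2 4 7) (a321 h 3 5 7) (a213 h 0 7 9) in s7.
have s8 := sig8 h 8; rewrite (a321 h 0 3 8) (a321 h 4 6 8) (a312 h 1 5 8) in s8.
have s9 := sig9 h 9; rewrite (a321 h 1 4 9) (a321 h 0 7 9) (a312 h 2 6 9) in s9.
apply: (@natr_mul_eq0 33) => //.
apply: etrans (eq0D (eq0D (eq0D (eq0D (eq0D (eq0D (eq0D (eq0D (eq0D (eq0M 17%:R s0)
    (eq0M (- 1%:R) s1))
    (eq0M 2%:R s2))
    (eq0M (- 4%:R) s3))
    (eq0M 8%:R s4))
    (eq0M 14%:R s5))
    (eq0M 5%:R s6))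
    (eq0M (- 10%:R) s7))
    (eq0M (- 13%:R) s8))
    (eq0M (- 7%:R) s9)); ring.
Qed.

Lemma plucker079 p : plucker_sigma0 p -> p 0 7 9 = 0.
Proof.
move=> h.
have s0 := sig0 h 0; rewrite (a132 h 0 3 8) (a132 h 0 7 9) in s0.
have s1 := sig1 h 1; rewrite (a132 h 1 4 9) in s1.
have s2 := sig2 h 2; rewrite (a231 h 0 2 5) in s2.
have s3 := sig3 h 3; rewrite (a213 h 0 3 8) (a231 h 1 3 6) (a132 h 3 5 7) in s3.
have s4 := sig4 h 4; rewrite (a213 h 1 4 9) (a231 h 2 4 7) (a132 h 4 6 8) in s4.
have s5 := sig5 h 5; rewrite (a312 h 0 2 5) (a231 h 1 5 8) (a213 h 3 5 7) in s5.
have s6 := sig6 h 6; rewrite (a312 h 1 3 6) (a231 h 2 6 9) (a213 h 4 6 8) in s6.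
have s7 := sig7 h 7; rewrite (a312 h 2 4 7) (a321 h 3 5 7) (a213 h 0 7 9) in s7.
have s8 := sig8 h 8; rewrite (a321 h 0 3 8) (a321 h 4 6 8) (a312 h 1 5 8) in s8.
have s9 := sig9 h 9; rewrite (a321 h 1 4 9) (a321 h 0 7 9) (a312 h 2 6 9) in s9.
apply: (@natr_mul_eq0 33) => //.
apply: etrans (eq0D (eq0D (eq0D (eq0D (eq0D (eq0D (eq0D (eq0D (eq0D (eq0M (- 14%:R) s0)
    (eq0M (- 5%:R) s1))
    (eq0M 10%:R s2))
    (eq0M 13%:R s3))
    (eq0M 7%:R s4))
    (eq0M 4%:R s5))
    (eq0M (- 8%:R) s6))
    (eq0M (- 17%:R) s7))
    (eq0M 1%:R s8))
    (eq0M (- 2%:R) s9)); ring.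
Qed.

Lemma plucker568 p : plucker_sigma0 p -> p 5 6 8 = 0.
Proof.
move=> h.
have e025 : p 0 2 5 = 0 by have := plucker025 (plucker_sigma0_iter 0 h); rewrite /=.
have e136 : p 1 3 6 = 0 by have := plucker025 (plucker_sigma0_iter 1 h); rewrite /=.
have e158 : p 1 5 8 = 0 by have := plucker079 (plucker_sigma0_iter 1 h); rewrite /= (a132 h
  1 5 8); move/eqP; rewrite oppr_eq0 => /eqP.
have e269 : p 2 6 9 = 0 by have := plucker079 (plucker_sigma0_iter 2 h); rewrite /= (a132 h
  2 6 9); move/eqP; rewrite oppr_eq0 => /eqP.
have e357 : p 3 5 7 = 0 by have := plucker079 (plucker_sigma0_iter 3 h); rewrite /=.
have e035 : p 0 3 5 = p 4 5 6.
  by have := sig8 h 5; rewrite (a321 h 0 3 5) (a231 h 4 5 6) (a121 h 5 1) => e; apply: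
    (eq_linN e); ring.
have e024 : p 0 2 4 = p 4 5 6.
  by have := sig7 h 0; rewrite (a132 h 0 3 5) (a112 h 0 9) e035 => e; apply: (eq_lin e); ring.
have e028 : p 0 2 8 = - p 3 7 8.
  by have := sig5 h 8; rewrite (a312 h 0 2 8) (a112 h 8 1) (a312 h 3 7 8) => e; apply:
    (eq_lin e); ring.
have e469 : p 4 6 9 = p 5 6 8.
  by have := sig1 h 6; rewrite (a121 h 6 3) (a231 h 4 6 9) (a213 h 5 6 8) => e; apply:
    (eq_lin e); ring.
have e045 : p 0 4 5 = - p 5 6 8.
  by have := sig2 h 4; rewrite (a112 h 4 7) (a231 h 0 4 5) e469 => e; apply: (eq_lin e); ring.
have e146 : p 1 4 6 = p 0 6 7.
  by have := sig9 h 6; rewrite (a321 h 1 4 6) (a231 h 0 6 7) (a121 h 6 2) => e; apply: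
    (eq_linN e); ring.
have e457 : p 4 5 7 = p 5 6 9.
  by have := sig2 h 5; rewrite (a213 h 4 5 7) (a112 h 5 0) => e; apply: (eq_linN e); ring.
have e048 : p 0 4 8 = p 0 6 7 - p 5 6 9.
  by have := sig3 h 4; rewrite (a213 h 0 4 8) (a231 h 1 4 6) (a132 h 4 5 7) e146 e457 => e;
    apply: (eq_linN e); ring.
have e058 : p 0 5 8 = p 1 5 6.
  by have := sig3 h 5; rewrite (a213 h 0 5 8) (a231 h 1 5 6) (a121 h 5 7) => e; apply:
    (eq_linN e); ring.
have e257 : p 2 5 7 = - p 3 7 8.
  by have := sig0 h 7; rewrite (a312 h 2 5 7) (a231 h 3 7 8) (a121 h 7 9) => e; apply:
    (eq_lin e); ring.
have e126 : p 1 2 6 = - 2%:R * p 3 7 8.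
  by have := sig3 h 2; rewrite (a213 h 0 2 8) (a231 h 1 2 6) (a132 h 2 5 7) e028 e257 => e;
    apply: (eq_lin e); ring.
have e159 : p 1 5 9 = - p 3 7 8 - p 5 6 8.
  by have := sig4 h 5; rewrite (a213 h 1 5 9) (a231 h 2 5 7) (a132 h 5 6 8) e257 => e;
    apply: (eq_linN e); ring.
have e369 : p 3 6 9 = - p 5 8 9.
  by have := sig1 h 9; rewrite (a312 h 3 6 9) (a112 h 9 4) (a312 h 5 8 9) => e; apply:
    (eq_lin e); ring.
have e347 : p 3 4 7 = - p 4 5 6 + p 5 8 9.
  by have := sig2 h 3; rewrite (a231 h 0 3 5) e035 e369 => e; apply: (eq_lin e); ring.
have e148 : p 1 4 8 = - 2%:R * p 4 5 6 + p 5 8 9.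
  by have := sig5 h 4; rewrite (a312 h 0 2 4) (a231 h 1 4 8) (a213 h 3 4 7) e024 e347 => e;
    apply: (eq_lin e); ring.
have e129 : p 1 2 9 = - 2%:R * p 4 5 6 + p 5 8 9.
  by have := sig6 h 1; rewrite (a112 h 1 3) (a132 h 1 2 9) e148 => e; apply: (eq_linN e); ring.
have e268 : p 2 6 8 = 2%:R * p 4 5 6 - p 5 8 9.
  by have := sig4 h 2; rewrite (a213 h 1 2 9) (a121 h 2 7) (a132 h 2 6 8) e129 => e; apply:
    (eq_linN e); ring.
have e078 : p 0 7 8 = 4%:R * p 4 5 6 - 2%:R * p 5 8 9.
  by have := sig9 h 8; rewrite (a321 h 1 4 8) (a321 h 0 7 8) (a312 h 2 6 8) e148 e268 => e;
    apply: (eq_linN e); ring.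
have e167 : p 1 6 7 = - 4%:R * p 4 5 6 + 2%:R * p 5 8 9.
  by have := sig3 h 7; rewrite (a213 h 0 7 8) (a321 h 1 6 7) (a112 h 7 5) e078 => e; apply:
    (eq_linN e); ring.
have e169 : p 1 6 9 = p 2 6 7.
  by have := sig4 h 6; rewrite (a213 h 1 6 9) (a231 h 2 6 7) (a121 h 6 8) => e; apply:
    (eq_linN e); ring.
have e138 : p 1 3 8 = - p 2 8 9.
  by have := sig6 h 8; rewrite (a312 h 1 3 8) (a231 h 2 8 9) (a121 h 8 4) => e; apply:
    (eq_lin e); ring.
have e023 : p 0 2 3 = p 2 8 9.
  by have := sig5 h 3; rewrite (a312 h 0 2 3) (a231 h 1 3 8) (a112 h 3 7) e138 => e; apply:
    (eq_lin e); ring.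
have e179 : p 1 7 9 = p 6 7 8.
  by have := sig4 h 7; rewrite (a213 h 1 7 9) (a112 h 7 2) (a231 h 6 7 8) => e; apply:
    (eq_linN e); ring.
have e125 : p 1 2 5 = - p 2 8 9 + p 6 7 8.
  by have := sig0 h 1; rewrite (a132 h 1 3 8) (a132 h 1 7 9) e138 e179 => e; apply: (eq_lin
    e); ring.
have e246 : p 2 4 6 = 2%:R * p 2 8 9 - p 6 7 8.
  by have := sig8 h 2; rewrite (a231 h 0 2 3) (a132 h 2 4 6) (a213 h 1 2 5) e023 e125 => e;
    apply: (eq_linN e); ring.
have e036 : p 0 3 6 = p 1 5 6.
  by have := sig8 h 6; rewrite (a321 h 0 3 6) (a112 h 6 4) (a312 h 1 5 6) => e; apply:
    (eq_linN e); ring.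
have e049 : p 0 4 9 = 2%:R * p 1 5 6.
  by have := sig1 h 0; rewrite (a132 h 0 4 9) e036 e058 => e; apply: (eq_linN e); ring.
have e345 : p 3 4 5 = 2%:R * p 1 5 6.
  by have := sig7 h 4; rewrite (a121 h 4 2) (a231 h 3 4 5) (a213 h 0 4 9) e049 => e; apply:
    (eq_lin e); ring.
have e047 : p 0 4 7 = 2%:R * p 2 8 9 - p 6 7 8.
  by have := sig9 h 4; rewrite (a112 h 4 1) (a231 h 0 4 7) (a213 h 2 4 6) e246 => e; apply:
    (eq_lin e); ring.
have e069 : p 0 6 9 = - 2%:R * p 2 8 9 + p 6 7 8.
  by have := sig2 h 0; rewrite (a121 h 0 5) e047 => e; apply: (eq_lin e); ring.
have e356 : p 3 5 6 = 4%:R * p 2 8 9 - 2%:R * p 6 7 8.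
  by have := sig7 h 6; rewrite (a312 h 2 4 6) (a321 h 3 5 6) (a213 h 0 6 9) e246 e069 => e;
    apply: (eq_linN e); ring.
have q0 := plucker h 6 9 1 3 5 6.
rewrite (a231 h 1 6 9) (a231 h 3 6 9) (a231 h 5 6 9) (a121 h 6 9) e169 e356 e369 e136 in q0.
have q1 := plucker h 0 4 0 2 5 8.
rewrite (a121 h 0 4) (a132 h 0 2 4) e024 e058 e045 e028 e048 e025 in q1.
have q2 := plucker h 1 6 3 4 5 7.
rewrite (a132 h 1 3 6) (a132 h 1 4 6) (a132 h 1 5 6) e136 e457 e146 e357 e347 e167 e345 in q2.
have q3 := plucker h 2 6 1 4 6 9.
rewrite (a231 h 1 2 6) (a132 h 2 4 6) (a122 h 6 2) e126 e469 e246 e169 e269 e146 in q3.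
have q4 := plucker h 1 5 5 6 8 9.
rewrite (a122 h 5 1) e158 e159 in q4.
suff : p 5 6 8 ^+ 2 = 0 by move/eqP; rewrite expf_eq0 => /eqP.
apply: (@natr_mul_eq0 11) => //.
apply: etrans (eq0D (eq0D (eq0D (eq0D (eq0M (- 14%:R) q0)
    (eq0M 45%:R q1))
    (eq0M (- 5%:R) q2))
    (eq0M 28%:R q3))
    (eq0M 11%:R q4)); ring.
Qed.

Lemma plucker456 p : plucker_sigma0 p -> p 4 5 6 = 0.
Proof.
move=> h.
have e025 : p 0 2 5 = 0 by have := plucker025 (plucker_sigma0_iter 0 h); rewrite /=.
have e568 : p 5 6 8 = 0 by have := plucker568 (plucker_sigma0_iter 0 h); rewrite /=.
have e679 : p 6 7 9 = 0 by have := plucker568 (plucker_sigma0_iter 1 h); rewrite /=.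
have e138 : p 1 3 8 = - p 2 8 9.
  by have := sig6 h 8; rewrite (a312 h 1 3 8) (a231 h 2 8 9) (a121 h 8 4) => e; apply:
    (eq_lin e); ring.
have e023 : p 0 2 3 = p 2 8 9.
  by have := sig5 h 3; rewrite (a312 h 0 2 3) (a231 h 1 3 8) (a112 h 3 7) e138 => e; apply:
    (eq_lin e); ring.
have e035 : p 0 3 5 = p 4 5 6.
  by have := sig8 h 5; rewrite (a321 h 0 3 5) (a231 h 4 5 6) (a121 h 5 1) => e; apply:
    (eq_linN e); ring.
have e024 : p 0 2 4 = p 4 5 6.
  by have := sig7 h 0; rewrite (a132 h 0 3 5) (a112 h 0 9) e035 => e; apply: (eq_lin e); ring.
have e057 : p 0 5 7 = 0.
  by have := sig2 h 7; rewrite (a121 h 7 4) (a321 h 0 5 7) (a213 h 6 7 9) e679 => e; apply: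
    (eq_linN e); ring.
have e368 : p 3 6 8 = - p 4 8 9.
  by have := sig1 h 8; rewrite (a312 h 3 6 8) (a231 h 4 8 9) (a121 h 8 5) => e; apply:
    (eq_lin e); ring.
have e256 : p 2 5 6 = p 4 8 9.
  by have := sig0 h 6; rewrite (a312 h 2 5 6) (a231 h 3 6 8) (a132 h 6 7 9) e368 e679 => e;
    apply: (eq_lin e); ring.
have e145 : p 1 4 5 = - p 4 8 9.
  by have := sig9 h 5; rewrite (a321 h 1 4 5) (a231 h 0 5 7) (a213 h 2 5 6) e057 e256 => e;
    apply: (eq_linN e); ring.
have e034 : p 0 3 4 = p 4 8 9.
  by have := sig8 h 4; rewrite (a321 h 0 3 4) (a121 h 4 6) (a213 h 1 4 5) e145 => e; apply:
    (eq_linN e); ring.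
have e469 : p 4 6 9 = 0.
  by have := sig1 h 6; rewrite (a121 h 6 3) (a231 h 4 6 9) (a213 h 5 6 8) e568 => e; apply:
    (eq_lin e); ring.
have e045 : p 0 4 5 = 0.
  by have := sig2 h 4; rewrite (a112 h 4 7) (a231 h 0 4 5) e469 => e; apply: (eq_lin e); ring.
have q0 := plucker h 0 3 0 2 4 5.
rewrite (a121 h 0 3) (a132 h 0 2 3) e023 e045 e034 e025 e035 e024 in q0.
suff : p 4 5 6 ^+ 2 = 0 by move/eqP; rewrite expf_eq0 => /eqP.
apply: (@natr_mul_eq0 1) => //.
apply: etrans (eq0M (- 1%:R) q0); ring.
Qed.

Lemma plucker378 p : plucker_sigma0 p -> p 3 7 8 = 0.
Proof.
move=> h.
have e357 : p 3 5 7 = 0 by have := plucker079 (plucker_sigma0_iter 3 h); rewrite /=.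
have e067 : p 0 6 7 = 0 by have := plucker456 (plucker_sigma0_iter 1 h); rewrite /=.
have e578 : p 5 7 8 = 0 by have := plucker568 (plucker_sigma0_iter 2 h); rewrite /= (a231 h
  5 7 8).
have e139 : p 1 3 9 = - p 4 8 9.
  by have := sig6 h 9; rewrite (a312 h 1 3 9) (a112 h 9 2) (a312 h 4 8 9) => e; apply:
    (eq_lin e); ring.
have e368 : p 3 6 8 = - p 4 8 9.
  by have := sig1 h 8; rewrite (a312 h 3 6 8) (a231 h 4 8 9) (a121 h 8 5) => e; apply:
    (eq_lin e); ring.
have e237 : p 2 3 7 = - 2%:R * p 4 8 9.
  by have := sig4 h 3; rewrite (a213 h 1 3 9) (a231 h 2 3 7) (a132 h 3 6 8) e139 e368 => e;
    apply: (eq_lin e); ring.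
have e257 : p 2 5 7 = - p 3 7 8.
  by have := sig0 h 7; rewrite (a312 h 2 5 7) (a231 h 3 7 8) (a121 h 7 9) => e; apply:
    (eq_lin e); ring.
have e146 : p 1 4 6 = 0.
  by have := sig9 h 6; rewrite (a321 h 1 4 6) (a231 h 0 6 7) (a121 h 6 2) e067 => e; apply:
    (eq_linN e); ring.
have e013 : p 0 1 3 = 0.
  by have := sig8 h 1; rewrite (a231 h 0 1 3) (a132 h 1 4 6) (a112 h 1 5) e146 => e; apply:
    (eq_lin e); ring.
have e457 : p 4 5 7 = p 5 6 9.
  by have := sig2 h 5; rewrite (a213 h 4 5 7) (a112 h 5 0) => e; apply: (eq_linN e); ring.
have e048 : p 0 4 8 = - p 5 6 9.
  by have := sig3 h 4; rewrite (a213 h 0 4 8) (a231 h 1 4 6) (a132 h 4 5 7) e146 e457 => e;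
    apply: (eq_linN e); ring.
have e029 : p 0 2 9 = - p 5 6 9.
  by have := sig6 h 0; rewrite (a132 h 0 2 9) e013 e048 => e; apply: (eq_linN e); ring.
have e235 : p 2 3 5 = p 5 6 9.
  by have := sig7 h 2; rewrite (a112 h 2 4) (a132 h 2 3 5) (a213 h 0 2 9) e029 => e; apply:
    (eq_linN e); ring.
have e379 : p 3 7 9 = - p 5 6 9.
  by have := sig0 h 3; rewrite (a213 h 2 3 5) (a121 h 3 8) (a132 h 3 7 9) e235 => e; apply:
    (eq_linN e); ring.
have e189 : p 1 8 9 = - 2%:R * p 5 6 9.
  by have := sig5 h 9; rewrite (a312 h 0 2 9) (a321 h 1 8 9) (a312 h 3 7 9) e029 e379 => e;
    apply: (eq_linN e); ring.
have e278 : p 2 7 8 = 2%:R * p 5 6 9.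
  by have := sig4 h 8; rewrite (a213 h 1 8 9) (a321 h 2 7 8) (a112 h 8 6) e189 => e; apply:
    (eq_linN e); ring.
have q0 := plucker h 5 7 2 3 7 8.
rewrite (a231 h 2 5 7) (a231 h 3 5 7) (a122 h 7 5) e257 e357 e278 e578 e237 in q0.
suff : p 3 7 8 ^+ 2 = 0 by move/eqP; rewrite expf_eq0 => /eqP.
apply: (@natr_mul_eq0 1) => //.
apply: etrans (eq0M (- 1%:R) q0); ring.
Qed.

Lemma plucker589 p : plucker_sigma0 p -> p 5 8 9 = 0.
Proof.
move=> h.
have e247 : p 2 4 7 = 0 by have := plucker025 (plucker_sigma0_iter 2 h); rewrite /=.
have e468 : p 4 6 8 = 0 by have := plucker079 (plucker_sigma0_iter 4 h); rewrite /=.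
have e378 : p 3 7 8 = 0 by have := plucker378 (plucker_sigma0_iter 0 h); rewrite /=.
have e456 : p 4 5 6 = 0 by have := plucker456 (plucker_sigma0_iter 0 h); rewrite /=.
have e489 : p 4 8 9 = 0 by have := plucker378 (plucker_sigma0_iter 1 h); rewrite /=.
have e568 : p 5 6 8 = 0 by have := plucker568 (plucker_sigma0_iter 0 h); rewrite /=.
have e469 : p 4 6 9 = 0.
  by have := sig1 h 6; rewrite (a121 h 6 3) (a231 h 4 6 9) (a213 h 5 6 8) e568 => e; apply:
    (eq_lin e); ring.
have e257 : p 2 5 7 = 0.
  by have := sig0 h 7; rewrite (a312 h 2 5 7) (a231 h 3 7 8) (a121 h 7 9) e378 => e; apply:
    (eq_lin e); ring.
have e159 : p 1 5 9 = 0.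
  by have := sig4 h 5; rewrite (a213 h 1 5 9) (a231 h 2 5 7) (a132 h 5 6 8) e257 e568 => e;
    apply: (eq_linN e); ring.
have e039 : p 0 3 9 = 0.
  by have := sig8 h 9; rewrite (a321 h 0 3 9) (a321 h 4 6 9) (a312 h 1 5 9) e469 e159 => e;
    apply: (eq_linN e); ring.
have e234 : p 2 3 4 = 0.
  by have := sig7 h 3; rewrite (a213 h 2 3 4) (a121 h 3 5) (a213 h 0 3 9) e039 => e; apply:
    (eq_linN e); ring.
have e139 : p 1 3 9 = 0.
  by have := sig6 h 9; rewrite (a312 h 1 3 9) (a112 h 9 2) (a312 h 4 8 9) e489 => e; apply:
    (eq_lin e); ring.
have e368 : p 3 6 8 = 0.
  by have := sig1 h 8; rewrite (a312 h 3 6 8) (a231 h 4 8 9) (a121 h 8 5) e489 => e; apply: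
    (eq_lin e); ring.
have e237 : p 2 3 7 = 0.
  by have := sig4 h 3; rewrite (a213 h 1 3 9) (a231 h 2 3 7) (a132 h 3 6 8) e139 e368 => e;
    apply: (eq_lin e); ring.
have e035 : p 0 3 5 = 0.
  by have := sig8 h 5; rewrite (a321 h 0 3 5) (a231 h 4 5 6) (a121 h 5 1) e456 => e; apply:
    (eq_linN e); ring.
have e024 : p 0 2 4 = 0.
  by have := sig7 h 0; rewrite (a132 h 0 3 5) (a112 h 0 9) e035 => e; apply: (eq_lin e); ring.
have e369 : p 3 6 9 = - p 5 8 9.
  by have := sig1 h 9; rewrite (a312 h 3 6 9) (a112 h 9 4) (a312 h 5 8 9) => e; apply:
    (eq_lin e); ring.
have e347 : p 3 4 7 = p 5 8 9.
  by have := sig2 h 3; rewrite (a231 h 0 3 5) e035 e369 => e; apply: (eq_lin e); ring.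
have e148 : p 1 4 8 = p 5 8 9.
  by have := sig5 h 4; rewrite (a312 h 0 2 4) (a231 h 1 4 8) (a213 h 3 4 7) e024 e347 => e;
    apply: (eq_lin e); ring.
have e129 : p 1 2 9 = p 5 8 9.
  by have := sig6 h 1; rewrite (a112 h 1 3) (a132 h 1 2 9) e148 => e; apply: (eq_linN e); ring.
have e268 : p 2 6 8 = - p 5 8 9.
  by have := sig4 h 2; rewrite (a213 h 1 2 9) (a121 h 2 7) (a132 h 2 6 8) e129 => e; apply:
    (eq_linN e); ring.
have q0 := plucker h 6 8 2 3 4 7.
rewrite (a231 h 2 6 8) (a231 h 3 6 8) (a231 h 4 6 8) (a132 h 6 7 8) e268 e347 e368 e247
  e468 e237 e234 in q0.
suff : p 5 8 9 ^+ 2 = 0 by move/eqP; rewrite expf_eq0 => /eqP.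
apply: (@natr_mul_eq0 1) => //.
apply: etrans (eq0M (- 1%:R) q0); ring.
Qed.

Definition plucker_reps := [:: (0, 2, 5); (0, 7, 9); (0, 1, 7); (0, 2, 4); (0, 2, 8); (0,
  3, 5); (0, 3, 9); (0, 4, 5); (0, 7, 8); (1, 2, 6); (1, 2, 9); (1, 4, 8); (1, 5, 9); (1,
    6, 7); (2, 3, 4); (2, 5, 7); (2, 6, 8); (3, 4, 7); (3, 6, 9); (3, 7, 8); (4, 5, 6); (4,
    6, 9); (5, 6, 8); (5, 8, 9)]%N.

Lemma plucker_reps0 p t : plucker_sigma0 p -> t \in plucker_reps -> p t.1.1 t.1.2 t.2 = 0.
Proof.
move=> h.
have e025 := plucker025 h.
have e079 := plucker079 h.
have e568 := plucker568 h.
have e456 := plucker456 h.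
have e378 := plucker378 h.
have e589 := plucker589 h.
have e035 : p 0 3 5 = 0.
  by have := sig8 h 5; rewrite (a321 h 0 3 5) (a231 h 4 5 6) (a121 h 5 1) e456 => e; apply:
    (eq_linN e); ring.
have e024 : p 0 2 4 = 0.
  by have := sig7 h 0; rewrite (a132 h 0 3 5) (a112 h 0 9) e035 => e; apply: (eq_lin e); ring.
have e369 : p 3 6 9 = 0.
  by have := sig1 h 9; rewrite (a312 h 3 6 9) (a112 h 9 4) (a312 h 5 8 9) e589 => e; apply:
    (eq_lin e); ring.
have e347 : p 3 4 7 = 0.
  by have := sig2 h 3; rewrite (a231 h 0 3 5) e035 e369 => e; apply: (eq_lin e); ring.
have e148 : p 1 4 8 = 0.
  by have := sig5 h 4; rewrite (a312 h 0 2 4) (a231 h 1 4 8) (a213 h 3 4 7) e024 e347 => e;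
    apply: (eq_lin e); ring.
have e129 : p 1 2 9 = 0.
  by have := sig6 h 1; rewrite (a112 h 1 3) (a132 h 1 2 9) e148 => e; apply: (eq_linN e); ring.
have e268 : p 2 6 8 = 0.
  by have := sig4 h 2; rewrite (a213 h 1 2 9) (a121 h 2 7) (a132 h 2 6 8) e129 => e; apply:
    (eq_linN e); ring.
have e078 : p 0 7 8 = 0.
  by have := sig9 h 8; rewrite (a321 h 1 4 8) (a321 h 0 7 8) (a312 h 2 6 8) e148 e268 => e;
    apply: (eq_linN e); ring.
have e167 : p 1 6 7 = 0.
  by have := sig3 h 7; rewrite (a213 h 0 7 8) (a321 h 1 6 7) (a112 h 7 5) e078 => e; apply:
    (eq_linN e); ring.
have e028 : p 0 2 8 = 0.
  by have := sig5 h 8; rewrite (a312 h 0 2 8) (a112 h 8 1) (a312 h 3 7 8) e378 => e; apply: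
    (eq_lin e); ring.
have e257 : p 2 5 7 = 0.
  by have := sig0 h 7; rewrite (a312 h 2 5 7) (a231 h 3 7 8) (a121 h 7 9) e378 => e; apply:
    (eq_lin e); ring.
have e126 : p 1 2 6 = 0.
  by have := sig3 h 2; rewrite (a213 h 0 2 8) (a231 h 1 2 6) (a132 h 2 5 7) e028 e257 => e;
    apply: (eq_lin e); ring.
have e017 : p 0 1 7 = 0.
  by have := sig9 h 1; rewrite (a121 h 1 4) (a231 h 0 1 7) e126 => e; apply: (eq_lin e); ring.
have e469 : p 4 6 9 = 0.
  by have := sig1 h 6; rewrite (a121 h 6 3) (a231 h 4 6 9) (a213 h 5 6 8) e568 => e; apply:
    (eq_lin e); ring.
have e159 : p 1 5 9 = 0.
  by have := sig4 h 5; rewrite (a213 h 1 5 9) (a231 h 2 5 7) (a132 h 5 6 8) e257 e568 => e;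
    apply: (eq_linN e); ring.
have e039 : p 0 3 9 = 0.
  by have := sig8 h 9; rewrite (a321 h 0 3 9) (a321 h 4 6 9) (a312 h 1 5 9) e469 e159 => e;
    apply: (eq_linN e); ring.
have e045 : p 0 4 5 = 0.
  by have := sig2 h 4; rewrite (a112 h 4 7) (a231 h 0 4 5) e469 => e; apply: (eq_lin e); ring.
have e234 : p 2 3 4 = 0.
  by have := sig7 h 3; rewrite (a213 h 2 3 4) (a121 h 3 5) (a213 h 0 3 9) e039 => e; apply:
    (eq_linN e); ring.
rewrite !inE; do ![case/orP=> [/eqP-> //|]]; by move/eqP->.
Qed.

Lemma plucker_sigma0_eq0 p i j k : plucker_sigma0 p ->
  (i < 10)%N -> (j < 10)%N -> (k < 10)%N -> p i j k = 0.
Proof.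
move=> h i10 j10 k10.
have [<-|ij] := eqVneq i j; first exact: a112.
have [<-|ik] := eqVneq i k; first exact: a121.
have [<-|jk] := eqVneq j k; first exact: a122.
pose orbit i j k (x : nat * (nat * nat * nat)) :=
  let: (n, (a, b, c)) := x in
  let: (a, b, c) := (iter n shift5 a, iter n shift5 b, iter n shift5 c) in
  (i, j, k) \in [:: (a, b, c); (b, a, c); (a, c, b); (c, b, a); (b, c, a); (c, a, b)].
have : all (fun i => all (fun j => all (fun k =>
    [|| i == j, i == k, j == k |
        has (orbit i j k) [seq (n, t) | n <- iota 0 5, t <- plucker_reps]])
    (iota 0 10)) (iota 0 10)) (iota 0 10) by vm_compute.
move=> /allP/(_ i); rewrite mem_iota i10 => /(_ isT)/allP/(_ j).
rewrite mem_iota j10 => /(_ isT)/allP/(_ k); rewrite mem_iota k10 => /(_ isT).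
rewrite (negPf ij) (negPf ik) (negPf jk) !orFb => /hasP[_ /allpairsP[[n [[a b] c]] [_ tr ->]]].
have := plucker_reps0 (plucker_sigma0_iter n h) tr => /= p0.
rewrite !inE; do ![case/orP => [/eqP[-> -> ->]|]]; last move=> /eqP[-> -> ->].
- exact: p0.
- by rewrite (a213 h) p0 oppr0.
- by rewrite (a132 h) p0 oppr0.
- by rewrite (a321 h) p0 oppr0.
- by rewrite (a231 h).
- by rewrite (a312 h).
Qed.

End PluckerRelations.

Section NoIsotropicPlane.
Variable K : numFieldType.
Implicit Types u v w : 'rV[K]_10.

Definition minor3 u v w (i j k : nat) : K :=
  u 0 (inord i) * (v 0 (inord j) * w 0 (inord k) - v 0 (inord k) * w 0 (inord j))
  - u 0 (inord j) * (v 0 (inord i) * w 0 (inord k) - v 0 (inord k) * w 0 (inord i))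
  + u 0 (inord k) * (v 0 (inord i) * w 0 (inord j) - v 0 (inord j) * w 0 (inord i)).

Lemma minor3_plucker u v w :
    (forall i, sigma0 u v 'e_i = 0) -> (forall i, sigma0 u w 'e_i = 0) ->
    (forall i, sigma0 v w 'e_i = 0) ->
  plucker_sigma0 (minor3 u v w).
Proof.
move=> uv uw vw.
have E k (hk : (k < 10)%N) := (etrans (esym (sigma0_delta u v hk)) (uv _),
  etrans (esym (sigma0_delta u w hk)) (uw _), etrans (esym (sigma0_delta v w hk)) (vw _)).
split; try by move=> *; rewrite /minor3; ring.
- move=> x; have [[e1 e2] e3] := E 0 isT; move: e1 e2 e3; rewrite /sigma0_coef /= => e1 e2 e3.
  apply: etrans (eq0D (eq0D (eq0M (w 0 (inord x)) e1) (eq0M (- v 0 (inord x)) e2))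
    (eq0M (u 0 (inord x)) e3)); rewrite /minor3; ring.
- move=> x; have [[e1 e2] e3] := E 1 isT; move: e1 e2 e3; rewrite /sigma0_coef /= => e1 e2 e3.
  apply: etrans (eq0D (eq0D (eq0M (w 0 (inord x)) e1) (eq0M (- v 0 (inord x)) e2))
    (eq0M (u 0 (inord x)) e3)); rewrite /minor3; ring.
- move=> x; have [[e1 e2] e3] := E 2 isT; move: e1 e2 e3; rewrite /sigma0_coef /= => e1 e2 e3.
  apply: etrans (eq0D (eq0D (eq0M (w 0 (inord x)) e1) (eq0M (- v 0 (inord x)) e2))
    (eq0M (u 0 (inord x)) e3)); rewrite /minor3; ring.
- move=> x; have [[e1 e2] e3] := E 3 isT; move: e1 e2 e3; rewrite /sigma0_coef /= => e1 e2 e3.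
  apply: etrans (eq0D (eq0D (eq0M (w 0 (inord x)) e1) (eq0M (- v 0 (inord x)) e2))
    (eq0M (u 0 (inord x)) e3)); rewrite /minor3; ring.
- move=> x; have [[e1 e2] e3] := E 4 isT; move: e1 e2 e3; rewrite /sigma0_coef /= => e1 e2 e3.
  apply: etrans (eq0D (eq0D (eq0M (w 0 (inord x)) e1) (eq0M (- v 0 (inord x)) e2))
    (eq0M (u 0 (inord x)) e3)); rewrite /minor3; ring.
- move=> x; have [[e1 e2] e3] := E 5 isT; move: e1 e2 e3; rewrite /sigma0_coef /= => e1 e2 e3.
  apply: etrans (eq0D (eq0D (eq0M (w 0 (inord x)) e1) (eq0M (- v 0 (inord x)) e2))
    (eq0M (u 0 (inord x)) e3)); rewrite /minor3; ring.
- move=> x; have [[e1 e2] e3] := E 6 isT; move: e1 e2 e3; rewrite /sigma0_coef /= => e1 e2 e3.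
  apply: etrans (eq0D (eq0D (eq0M (w 0 (inord x)) e1) (eq0M (- v 0 (inord x)) e2))
    (eq0M (u 0 (inord x)) e3)); rewrite /minor3; ring.
- move=> x; have [[e1 e2] e3] := E 7 isT; move: e1 e2 e3; rewrite /sigma0_coef /= => e1 e2 e3.
  apply: etrans (eq0D (eq0D (eq0M (w 0 (inord x)) e1) (eq0M (- v 0 (inord x)) e2))
    (eq0M (u 0 (inord x)) e3)); rewrite /minor3; ring.
- move=> x; have [[e1 e2] e3] := E 8 isT; move: e1 e2 e3; rewrite /sigma0_coef /= => e1 e2 e3.
  apply: etrans (eq0D (eq0D (eq0M (w 0 (inord x)) e1) (eq0M (- v 0 (inord x)) e2))
    (eq0M (u 0 (inord x)) e3)); rewrite /minor3; ring.
- move=> x; have [[e1 e2] e3] := E 9 isT; move: e1 e2 e3; rewrite /sigma0_coef /= => e1 e2 e3.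
  apply: etrans (eq0D (eq0D (eq0M (w 0 (inord x)) e1) (eq0M (- v 0 (inord x)) e2))
    (eq0M (u 0 (inord x)) e3)); rewrite /minor3; ring.
Qed.

Lemma isotropic_dependent u v w :
    (forall i, sigma0 u v 'e_i = 0) -> (forall i, sigma0 u w 'e_i = 0) ->
    (forall i, sigma0 v w 'e_i = 0) ->
  exists2 a : 'rV_3, a != 0 & a *m (\matrix_(i < 3) [:: u; v; w]`_i) = 0.
Proof.
move=> uv uw vw; have h := minor3_plucker uv uw vw.
set U := \matrix_i _.
have : ~~ row_free U.
  apply/negP => /eqP Uf.
  have Uf' : row_full U^T by rewrite /row_full mxrank_tr Uf.
  have := fullrowsub_unit Uf'; set f := fullrankfun _.
  rewrite unitmxE unitfE => /eqP; apply.
  transitivity (minor3 u v w (f 0) (f (lift 0 0)) (f (lift 0 (lift 0 0)))).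
    rewrite (expand_det_row _ 0) !big_ord_recl big_ord0 /cofactor.
    rewrite !(expand_det_row _ 0) !big_ord_recl !big_ord0 /cofactor !det_mx11 !mxE /=.
    by rewrite /minor3 !inord_val /bump /=; ring.
  by apply: plucker_sigma0_eq0.
rewrite -kermx_eq0 => /rowV0Pn[a /sub_kermxP aU a0]; by exists a.
Qed.
End NoIsotropicPlane.

(** * Singular points *)

Lemma sum3 (K : nmodType) (F : 'I_3 -> K) :
  \sum_i F i = F 0 + F 1 + F (lift 0 (lift 0 0)).
Proof.
rewrite !big_ord_recl big_ord0 addr0 !addrA.
by do !congr (_ + _); congr F; apply/val_inj.
Qed.

Lemma bivector3_decomposable (K : fieldType) (c01 c02 c12 : K) :
    ~~ [&& c01 == 0, c02 == 0 & c12 == 0] ->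
  exists x0 x1 x2 y0 y1 y2 k, [/\ x0 * y1 - x1 * y0 = k * c01,
    x0 * y2 - x2 * y0 = k * c02, x1 * y2 - x2 * y1 = k * c12 &
    forall s t, s * x0 + t * y0 = 0 -> s * x1 + t * y1 = 0 ->
      s * x2 + t * y2 = 0 -> s = 0 /\ t = 0].
Proof.
have [->|c01n0 _] := eqVneq c01 0; last first.
  exists 1, 0, (- (c12 / c01)), 0, 1, (c02 / c01), c01^-1.
  split; try by field.
  by move=> s t; rewrite !mulr1 !mulr0 addr0 add0r => -> ->.
have [->|c02n0 _] := eqVneq c02 0; last first.
  exists 1, (c12 / c02), 0, 0, 0, 1, c02^-1.
  split; try by field.
  by move=> s t; rewrite !mulr1 !mulr0 addr0 add0r => -> _ ->.
rewrite /= => c12n0; exists 0, 1, 0, 0, 0, 1, c12^-1.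
split; try by field.
by move=> s t; rewrite !mulr1 !mulr0 !addr0 add0r => _ -> ->.
Qed.

Section SingularLocus.
Variable K : numFieldType.
Implicit Types u v w : 'rV[K]_10.

Lemma sigma0_comb3 u v w (x0 x1 x2 y0 y1 y2 : K) t :
  sigma0 (x0 *: u + x1 *: v + x2 *: w) (y0 *: u + y1 *: v + y2 *: w) t =
  (x0 * y1 - x1 * y0) * sigma0 u v t + (x0 * y2 - x2 * y0) * sigma0 u w t
  + (x1 * y2 - x2 * y1) * sigma0 v w t.
Proof.
move: (@sigma0_rot K) (@sigma0C K) (@sigma0_alt K) (@sigma0_linear K).
move: (@sigma0 K) => s rot asym alt lin.
have s0 a b : s a b 0 = 0.
  by have := lin a b (-1) 0 0; rewrite scaler0 addr0 mulN1r addNr.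
have comb a b x y z : s a b (x *: u + y *: v + z *: w) =
    x * s a b u + y * s a b v + z * s a b w.
  by rewrite -addrA -[z *: w]addr0 !lin s0 addr0 addrA.
rewrite -rot comb !(rot t) (asym _ u) (asym _ v) (asym _ w) -!(rot t) !comb !(rot t).
by rewrite !alt (asym v u) (asym w u) (asym w v); ring.
Qed.

Lemma mul_rV3 (F : fieldType) n (a : 'rV[F]_3) (x y z : 'rV[F]_n) :
  a *m (\matrix_(i < 3) [:: x; y; z]`_i) =
  a 0 0 *: x + a 0 1 *: y + a 0 (lift 0 (lift 0 0)) *: z.
Proof. by apply/rowP => i; rewrite mxE sum3 !mxE. Qed.

Lemma contract_self v : v *m contract v = 0.
Proof. by apply/rowP => i; rewrite mulmx_contract mxE sigma0_alt. Qed.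

Lemma rank6_jacobian v :
  v != 0 -> \rank (contract v) = 6%N -> (2 < \rank (jacobian (peskine_eqs K) v))%N.
Proof.
move=> v0 rv; rewrite ltnNge; apply/negP => rJ.
set J := jacobian _ v in rJ.
pose Q := kermx (contract v).
have vQ : (v <= Q)%MS by apply/sub_kermxP/contract_self.
have rQ : \rank Q = 4%N by rewrite mxrank_ker rv.
pose W := (Q :\: v)%MS.
have rW : \rank W = 3%N.
  apply/eqP; rewrite -(eqn_add2l (\rank (Q :&: v)%MS)) mxrank_cap_compl rQ.
  by rewrite (capmx_idPr vQ) rank_rV v0.
have [B [Bf BW]] : exists B : 'M[K]_(3, 10), row_free B /\ (B :=: W)%MS.
  move: (row_base W) (row_base_free W) (eq_row_base W); rewrite rW => B Bf BW.
  by exists B.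
have kerR i : row i B *m contract v = 0.
  by apply/sub_kermxP; rewrite (submx_trans (row_sub i B)) // BW diffmxSl.
pose b0 := row 0 B; pose b1 := row 1 B; pose b2 := row (lift 0 (lift 0 0)) B.
pose Phi := \matrix_(i < 3)
  [:: b1 *m contract b0; b2 *m contract b0; b2 *m contract b1]`_i.
have PJ : (Phi <= J)%MS.
  apply/row_subP => i; rewrite rowK; case: i => [[|[|[|//]]]] hi;
    by apply: sub_jacobian_kernel => //; apply: kerR.
have : ~~ row_free Phi.
  rewrite /row_free; apply: contraTneq (mxrankS PJ) => ->; rewrite -ltnNge.
  exact: leq_ltn_trans rJ _.
rewrite -kermx_eq0 => /rowV0Pn[c /sub_kermxP cP c0].
have cE i : c 0 0 * sigma0 b0 b1 'e_i + c 0 1 * sigma0 b0 b2 'e_i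
     + c 0 (lift 0 (lift 0 0)) * sigma0 b1 b2 'e_i = 0.
  have PhiE k : Phi k i = [:: sigma0 b0 b1 'e_i; sigma0 b0 b2 'e_i; sigma0 b1 b2 'e_i]`_k.
    by rewrite mxE; case: k => [[|[|[|//]]]] hk; rewrite /= mulmx_contract.
  by have /rowP/(_ i) := cP; rewrite mxE [in RHS]mxE sum3 !PhiE.
have [|x0 [x1 [x2 [y0 [y1 [y2 [k [m01 m02 m12 ind]]]]]]]] :=
    @bivector3_decomposable K (c 0 0) (c 0 1) (c 0 (lift 0 (lift 0 0))).
  apply: contra c0 => /and3P[/eqP c1 /eqP c2 /eqP c3].
  apply/eqP/rowP => i; rewrite mxE; case: i => [[|[|[|//]]]] hi.
  - by rewrite -c1; congr (c _ _); apply/val_inj.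
  - by rewrite -c2; congr (c _ _); apply/val_inj.
  - by rewrite -c3; congr (c _ _); apply/val_inj.
pose p := x0 *: b0 + x1 *: b1 + x2 *: b2; pose q := y0 *: b0 + y1 *: b1 + y2 *: b2.
have kerv u : u *m contract v = 0 -> forall i, sigma0 v u 'e_i = 0.
  by move=> uv i; rewrite -mulmx_contract uv mxE.
have kerp : p *m contract v = 0.
  by rewrite !mulmxDl -!scalemxAl !kerR !scaler0 !addr0.
have kerq : q *m contract v = 0.
  by rewrite !mulmxDl -!scalemxAl !kerR !scaler0 !addr0.
have [a a0 aU] : exists2 a : 'rV_3, a != 0 & a *m (\matrix_(i < 3) [:: v; p; q]`_i) = 0.
  apply: isotropic_dependent => [||i]; [exact: kerv|exact: kerv|].
  by rewrite sigma0_comb3 m01 m02 m12 -!mulrA -!mulrDr cE mulr0.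
have {aU} aE : a 0 0 *: v + a 0 1 *: p + a 0 (lift 0 (lift 0 0)) *: q = 0.
  by rewrite -mul_rV3.
set s := a 0 1 in aE; set t := a 0 (lift 0 (lift 0 0)) in aE.
pose z : 'rV_3 := \row_i [:: s * x0 + t * y0; s * x1 + t * y1; s * x2 + t * y2]`_i.
have zB : z *m B = s *: p + t *: q.
  by apply/rowP => i; rewrite mxE sum3 !mxE /=; ring.
have av : a 0 0 *: v = - (z *m B).
  by apply/eqP; rewrite zB -addr_eq0 addrA aE.
have av0 : a 0 0 *: v = 0.
  apply/eqP; rewrite -submx0 -(capmx_diff Q v) sub_capmx [X in _ && X]scalemx_sub // andbT.
  by rewrite av eqmx_opp -BW submxMl.
have z0 : z = 0.
  by apply/eqP; rewrite -(mulmx_free_eq0 _ Bf) -oppr_eq0 -av av0.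
have [] := ind s t; first by have /rowP/(_ 0) := z0; rewrite !mxE.
- by have /rowP/(_ 1) := z0; rewrite !mxE.
- by have /rowP/(_ (lift 0 (lift 0 0))) := z0; rewrite !mxE.
move=> s0 t0; case/eqP: a0; apply/rowP => i; rewrite mxE.
have a00 : a 0 0 = 0.
  by move/eqP: av0; rewrite scaler_eq0 (negPf v0) orbF => /eqP.
case: i => [[|[|[|//]]]] hi.
- by rewrite -a00; congr (a _ _); apply/val_inj.
- by rewrite -s0; congr (a _ _); apply/val_inj.
- by rewrite -t0; congr (a _ _); apply/val_inj.
Qed.

Lemma rank4_jacobian v : (\rank (contract v) <= 4)%N -> jacobian (peskine_eqs K) v = 0.
Proof.
move=> rv; apply/matrixP => k i; rewrite !mxE.
have /allpairsP[[a b] [_ _ ->]] := mem_nth 0 (ltn_ord k).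
rewrite pfaffian8_pf8f /pf8f mderiv_pf8.
have p6 a' b' c d e f : pf6 (contract v) a' b' c d e f = 0.
  exact: pf6_rank (contract_skew v) (contract_diag v) _ _ _ _ _ _ rv.
by rewrite dpf8E !p6 !mulr0 !(subr0, addr0).
Qed.

Lemma rank_contract v :
  (\rank (contract v) <= 6)%N -> (\rank (contract v) <= 4)%N \/ \rank (contract v) = 6%N.
Proof.
move=> r6; have [r5|] := leqP (\rank (contract v)) 5; last first.
  by move=> r5; right; apply/eqP; rewrite eqn_leq r6 r5.
left; apply: rank_le4P; first exact: contract_skew.
move=> a b c d e f; apply/eqP; apply: contraLR r5 => p0; rewrite -ltnNge.
pose x (i : 'I_6) := nth a [:: a; b; c; d; e; f] i.
have /eqP rx : row_free (rowsub x (contract v)).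
  by apply: pf6_row_free; [exact: contract_skew|exact: contract_diag|].
by have := mxrankS (rowsub_sub x (contract v)); rewrite rx.
Qed.

Lemma peskine_singularE v :
  v != 0 -> peskine_singular v = (\rank (contract v) <= 4)%N.
Proof.
move=> v0; rewrite /peskine_singular /peskine v0 /= /singular_pt /tangent_dim.
rewrite /cone_tangent_space mxrank_ker mxrank_tr.
apply/andP/idP => [[r6]|r4]; last first.
  by split; [exact: leq_trans r4 _|rewrite rank4_jacobian // mxrank0].
have [//|r6' J] := rank_contract r6.
have := rank6_jacobian v0 r6'; move: J; move: (\rank _) => r.
case: r => [|[|[|r]]] // + _.
by rewrite ltn_predRL ltn_subRL addnC.
Qed.
End SingularLocus.

(** * Points of rank 4 *)

Section RankFour.
Variable K : numFieldType.
Implicit Types x y z : nat -> K.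

(* The matrix of the form sigma0 (v, -, -) in terms of the coordinates x of v. *)
Definition ctr x (i j : nat) : K := nth 0 (nth [::]
  [:: [:: 0; 0; x 5%N; - x 8%N; 0; - x 2%N; 0; - x 9%N; x 3%N; x 7%N];
     [:: 0; 0; 0; x 6%N; - x 9%N; x 8%N; - x 3%N; 0; - x 5%N; x 4%N];
     [:: - x 5%N; 0; 0; 0; x 7%N; x 0%N; x 9%N; - x 4%N; 0; - x 6%N];
     [:: x 8%N; - x 6%N; 0; 0; 0; - x 7%N; x 1%N; x 5%N; - x 0%N; 0];
     [:: 0; x 9%N; - x 7%N; 0; 0; 0; - x 8%N; x 2%N; x 6%N; - x 1%N];
     [:: x 2%N; - x 8%N; - x 0%N; x 7%N; 0; 0; 0; - x 3%N; x 1%N; 0];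
     [:: 0; x 3%N; - x 9%N; - x 1%N; x 8%N; 0; 0; 0; - x 4%N; x 2%N];
     [:: x 9%N; 0; x 4%N; - x 5%N; - x 2%N; x 3%N; 0; 0; 0; - x 0%N];
     [:: - x 3%N; x 5%N; 0; x 0%N; - x 6%N; - x 1%N; x 4%N; 0; 0; 0];
     [:: - x 7%N; - x 4%N; x 6%N; 0; x 1%N; 0; - x 2%N; x 0%N; 0; 0]] i) j.

Definition rank4_coords x := forall a b c d e f,
  all (fun i => i < 10)%N [:: a; b; c; d; e; f] -> pf6 (ctr x) a b c d e f = 0.

Lemma ctr_shift x i j : (i < 10)%N -> (j < 10)%N ->
  ctr (x \o shift5) i j = ctr x (shift5 i) (shift5 j).
Proof. by do 10?[case: i => [|i] //]; do 10?[case: j => [|j] //]. Qed.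

Lemma rank4_coords_shift x : rank4_coords x -> rank4_coords (x \o shift5).
Proof.
move=> h a b c d e f /and5P[a10 b10 c10 d10 /and3P[e10 f10 _]].
rewrite /pf6 /pf4 !ctr_shift //; apply: h.
have s10 i : (i < 10)%N -> (shift5 i < 10)%N by do 10?[case: i => [|i] //].
by rewrite /= !s10.
Qed.

Lemma rank4_coords_0_6 x : rank4_coords x -> x 0%N = 0 -> x 6%N = 0.
Proof.
move=> h x0; have := h 1 2 3 4 8 9 isT; rewrite /pf6 /pf4 /ctr /= x0 => e.
suff : x 6%N ^+ 3 = 0 by move/eqP; rewrite expf_eq0 => /eqP.
apply: etrans e; ring.
Qed.

Lemma rank4_coords_5_0 x : rank4_coords x -> x 5%N = 0 -> x 0%N = 0.
Proof.
move=> h x5; have := h 2 3 5 7 8 9 isT; have := h 0 1 2 3 5 8 isT.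
rewrite /pf6 /pf4 /ctr /= x5 => e1 e2.
suff : x 0%N ^+ 3 = 0 by move/eqP; rewrite expf_eq0 => /eqP.
apply: etrans (eq0D (eq0M 1 e2) (eq0M (-1) e1)); ring.
Qed.

Definition nvec x k : K := nth 0
  [:: x 4%N * x 5%N; x 0%N * x 6%N; x 1%N * x 7%N; x 2%N * x 8%N; x 3%N * x 9%N] k.

(* The cofactors come from solving a linear system for the coefficients of the
   monomials of the same degree and weight. *)
Lemma nvec_eigen0 x : rank4_coords x ->
  2%:R * (x 7%N * x 9%N) * nvec x 0 =
  x 2%N * x 5%N * (nvec x 0 - 3%:R * nvec x 1 + 3%:R * nvec x 2 - nvec x 3 - nvec x 4).
Proof.
move=> h; apply/eqP; rewrite -subr_eq0; apply/eqP.
apply: (@natr_mul_eq0 _ 2) => //.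
apply: etrans (eq0D (eq0D (eq0D (eq0D (eq0D (eq0D (eq0D (eq0D (eq0D (eq0D (eq0D (eq0D (eq0D
  (eq0D (eq0D (eq0D (eq0D (eq0D (eq0D (eq0D (eq0D (eq0D (eq0D (eq0D (eq0M (x 6%N) (h 1 2 4
    5 7 8 isT))
 (eq0M (3%:R * x 1%N) (h 0 1 2 4 5 8 isT)))
 (eq0M (2%:R * x 1%N) (h 0 1 3 6 7 8 isT)))
 (eq0M (- (x 5%N)) (h 0 1 4 6 8 9 isT)))
 (eq0M (- (3%:R * x 1%N)) (h 0 1 2 3 4 6 isT)))
 (eq0M (- (3%:R * x 1%N)) (h 0 1 2 5 6 7 isT)))
 (eq0M (x 4%N) (h 1 4 5 6 7 8 isT)))
 (eq0M (3%:R * x 9%N) (h 0 1 2 7 8 9 isT)))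
 (eq0M (- (x 5%N)) (h 1 2 3 4 5 7 isT)))
 (eq0M (x 8%N) (h 1 2 3 4 7 8 isT)))
 (eq0M (7%:R * x 0%N) (h 0 1 2 4 5 6 isT)))
 (eq0M (4%:R * x 5%N) (h 1 3 4 5 6 8 isT)))
 (eq0M (2%:R * x 2%N) (h 0 1 3 4 7 8 isT)))
 (eq0M (- (2%:R * x 6%N)) (h 0 1 3 6 7 9 isT)))
 (eq0M (x 2%N) (h 1 2 5 6 7 8 isT)))
 (eq0M (3%:R * x 9%N) (h 2 3 4 6 7 8 isT)))
 (eq0M (4%:R * x 9%N) (h 1 5 6 7 8 9 isT)))
 (eq0M (- (3%:R * x 3%N)) (h 1 4 5 7 8 9 isT)))
 (eq0M (- (6%:R * x 6%N)) (h 0 1 5 7 8 9 isT)))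
 (eq0M (3%:R * x 5%N) (h 0 2 3 4 5 6 isT)))
 (eq0M (2%:R * x 5%N) (h 0 1 2 5 7 8 isT)))
 (eq0M (2%:R * x 3%N) (h 0 1 2 3 7 8 isT)))
 (eq0M (- (5%:R * x 3%N)) (h 0 3 4 7 8 9 isT)))
 (eq0M (2%:R * x 2%N) (h 0 1 2 4 5 7 isT)))
 (eq0M (- (2%:R * x 2%N)) (h 0 1 2 5 6 9 isT)));
rewrite /nvec /pf6 /pf4 /ctr /=; ring.
Qed.

Lemma nvec_eigen1 x : rank4_coords x ->
  2%:R * (x 7%N * x 9%N) * nvec x 1 =
  x 2%N * x 5%N * (2%:R * nvec x 0 - 4%:R * nvec x 1 + 4%:R * nvec x 2 - 2%:R * nvec x 4).
Proof.
move=> h; apply/eqP; rewrite -subr_eq0; apply/eqP.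
apply: (@natr_mul_eq0 _ 2) => //.
apply: etrans (eq0D (eq0D (eq0D (eq0D (eq0D (eq0D (eq0D (eq0D (eq0D (eq0D (eq0D (eq0D (eq0D
  (eq0D (eq0D (eq0D (eq0D (eq0D (eq0D (eq0D (eq0M (4%:R * x 0%N) (h 0 1 2 3 4 7 isT))
 (eq0M (2%:R * x 5%N) (h 1 2 3 4 5 7 isT)))
 (eq0M (4%:R * x 1%N) (h 0 1 3 6 7 8 isT)))
 (eq0M (- (2%:R * x 5%N)) (h 0 1 4 6 8 9 isT)))
 (eq0M (6%:R * x 9%N) (h 0 1 2 7 8 9 isT)))
 (eq0M (8%:R * x 0%N) (h 0 1 2 4 5 6 isT)))
 (eq0M (2%:R * x 0%N) (h 0 1 4 6 7 9 isT)))
 (eq0M (4%:R * x 5%N) (h 1 3 4 5 6 8 isT)))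
 (eq0M (4%:R * x 5%N) (h 0 1 2 5 7 8 isT)))
 (eq0M (4%:R * x 3%N) (h 0 1 2 3 7 8 isT)))
 (eq0M (- (6%:R * x 3%N)) (h 0 3 4 7 8 9 isT)))
 (eq0M (6%:R * x 9%N) (h 2 3 4 6 7 8 isT)))
 (eq0M (- (10%:R * x 6%N)) (h 0 1 5 7 8 9 isT)))
 (eq0M (2%:R * x 2%N) (h 1 2 5 6 7 8 isT)))
 (eq0M (2%:R * x 4%N) (h 1 4 5 6 7 8 isT)))
 (eq0M (8%:R * x 9%N) (h 1 5 6 7 8 9 isT)))
 (eq0M (- (4%:R * x 3%N)) (h 1 4 5 7 8 9 isT)))
 (eq0M (4%:R * x 1%N) (h 0 1 2 4 5 8 isT)))
 (eq0M (- (4%:R * x 1%N)) (h 0 1 2 3 4 6 isT)))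
 (eq0M (- (4%:R * x 1%N)) (h 0 1 2 5 6 7 isT)))
 (eq0M (4%:R * x 5%N) (h 0 2 3 4 5 6 isT)));
rewrite /nvec /pf6 /pf4 /ctr /=; ring.
Qed.

Lemma nvec_eigen2 x : rank4_coords x ->
  2%:R * (x 7%N * x 9%N) * nvec x 2 =
  x 2%N * x 5%N * (3%:R * nvec x 0 - nvec x 1 + nvec x 2 + 3%:R * nvec x 3 - 5%:R * nvec x 4).
Proof.
move=> h; apply/eqP; rewrite -subr_eq0; apply/eqP.
apply: (@natr_mul_eq0 _ 2) => //.
apply: etrans (eq0D (eq0D (eq0D (eq0D (eq0D (eq0D (eq0D (eq0D (eq0D (eq0D (eq0D (eq0D (eq0D
  (eq0D (eq0D (eq0D (eq0D (eq0D (eq0D (eq0D (eq0D (eq0D (eq0D (eq0D (eq0D (eq0D (eq0D (eq0D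
    (eq0M (- (x 6%N)) (h 1 2 4 5 7 8 isT))
 (eq0M (x 1%N) (h 0 1 2 4 5 8 isT)))
 (eq0M (2%:R * x 1%N) (h 0 1 3 6 7 8 isT)))
 (eq0M (x 5%N) (h 0 1 4 6 8 9 isT)))
 (eq0M (- (x 1%N)) (h 0 1 2 3 4 6 isT)))
 (eq0M (- (x 1%N)) (h 0 1 2 5 6 7 isT)))
 (eq0M (- (x 4%N)) (h 1 4 5 6 7 8 isT)))
 (eq0M (9%:R * x 9%N) (h 0 1 2 7 8 9 isT)))
 (eq0M (5%:R * x 5%N) (h 1 2 3 4 5 7 isT)))
 (eq0M (- (x 8%N)) (h 1 2 3 4 7 8 isT)))
 (eq0M (6%:R * x 3%N) (h 0 1 2 3 7 8 isT)))
 (eq0M (5%:R * x 0%N) (h 0 1 2 4 5 6 isT)))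
 (eq0M (8%:R * x 0%N) (h 0 1 4 6 7 9 isT)))
 (eq0M (8%:R * x 9%N) (h 1 5 6 7 8 9 isT)))
 (eq0M (6%:R * x 5%N) (h 0 1 2 5 7 8 isT)))
 (eq0M (x 3%N) (h 0 3 4 7 8 9 isT)))
 (eq0M (- (x 2%N)) (h 1 2 5 6 7 8 isT)))
 (eq0M (- (x 3%N)) (h 1 4 5 7 8 9 isT)))
 (eq0M (- (6%:R * x 6%N)) (h 0 1 5 7 8 9 isT)))
 (eq0M (- (6%:R * x 2%N)) (h 0 1 3 4 7 8 isT)))
 (eq0M (6%:R * x 6%N) (h 0 1 3 6 7 9 isT)))
 (eq0M (8%:R * x 0%N) (h 0 1 2 3 4 7 isT)))
 (eq0M (- (4%:R * x 7%N)) (h 1 2 3 6 7 9 isT)))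
 (eq0M (5%:R * x 5%N) (h 0 2 3 4 5 6 isT)))
 (eq0M (9%:R * x 9%N) (h 2 3 4 6 7 8 isT)))
 (eq0M (- (4%:R * x 7%N)) (h 0 2 5 6 8 9 isT)))
 (eq0M (4%:R * x 7%N) (h 2 4 6 7 8 9 isT)))
 (eq0M (- (6%:R * x 2%N)) (h 0 1 2 4 5 7 isT)))
 (eq0M (6%:R * x 2%N) (h 0 1 2 5 6 9 isT)));
rewrite /nvec /pf6 /pf4 /ctr /=; ring.
Qed.

Lemma nvec_eigen3 x : rank4_coords x ->
  2%:R * (x 7%N * x 9%N) * nvec x 3 =
  x 2%N * x 5%N * (4%:R * nvec x 0 - 2%:R * nvec x 2 + 6%:R * nvec x 3 - 8%:R * nvec x 4).
Proof.
move=> h; apply/eqP; rewrite -subr_eq0; apply/eqP.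
apply: (@natr_mul_eq0 _ 2) => //.
apply: etrans (eq0D (eq0D (eq0D (eq0D (eq0D (eq0D (eq0D (eq0D (eq0D (eq0D (eq0D (eq0D (eq0D
  (eq0D (eq0D (eq0D (eq0D (eq0D (eq0D (eq0D (eq0D (eq0D (eq0M (- (2%:R * x 5%N)) (h 0 1 4 6
    8 9 isT))
 (eq0M (- (2%:R * x 4%N)) (h 1 4 5 6 7 8 isT)))
 (eq0M (10%:R * x 9%N) (h 0 1 2 7 8 9 isT)))
 (eq0M (- (2%:R * x 5%N)) (h 1 2 3 4 5 7 isT)))
 (eq0M (- (4%:R * x 0%N)) (h 0 1 2 4 5 6 isT)))
 (eq0M (6%:R * x 0%N) (h 0 1 4 6 7 9 isT)))
 (eq0M (- (8%:R * x 2%N)) (h 0 1 3 4 7 8 isT)))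
 (eq0M (8%:R * x 6%N) (h 0 1 3 6 7 9 isT)))
 (eq0M (2%:R * x 3%N) (h 0 3 4 7 8 9 isT)))
 (eq0M (- (2%:R * x 2%N)) (h 1 2 5 6 7 8 isT)))
 (eq0M (10%:R * x 9%N) (h 2 3 4 6 7 8 isT)))
 (eq0M (8%:R * x 9%N) (h 1 5 6 7 8 9 isT)))
 (eq0M (4%:R * x 3%N) (h 1 4 5 7 8 9 isT)))
 (eq0M (- (2%:R * x 6%N)) (h 0 1 5 7 8 9 isT)))
 (eq0M (- (4%:R * x 5%N)) (h 0 2 3 4 5 6 isT)))
 (eq0M (8%:R * x 2%N) (h 0 1 2 5 6 9 isT)))
 (eq0M (- (4%:R * x 9%N)) (h 0 2 5 6 7 9 isT)))
 (eq0M (8%:R * x 5%N) (h 0 1 2 5 7 8 isT)))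
 (eq0M (8%:R * x 3%N) (h 0 1 2 3 7 8 isT)))
 (eq0M (4%:R * x 3%N) (h 0 2 3 5 6 7 isT)))
 (eq0M (4%:R * x 3%N) (h 0 1 2 5 6 8 isT)))
 (eq0M (- (4%:R * x 0%N)) (h 0 1 5 6 7 8 isT)))
 (eq0M (- (12%:R * x 2%N)) (h 0 1 2 4 5 7 isT)));
rewrite /nvec /pf6 /pf4 /ctr /=; ring.
Qed.

Lemma nvec_eigen4 x : rank4_coords x ->
  2%:R * (x 7%N * x 9%N) * nvec x 4 =
  x 2%N * x 5%N * (4%:R * nvec x 0 - 2%:R * nvec x 1 + 2%:R * nvec x 3 - 6%:R * nvec x 4).
Proof.
move=> h; apply/eqP; rewrite -subr_eq0; apply/eqP.
apply: (@natr_mul_eq0 _ 2) => //.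
apply: etrans (eq0D (eq0D (eq0D (eq0D (eq0D (eq0D (eq0D (eq0D (eq0D (eq0D (eq0D (eq0D (eq0D
  (eq0D (eq0D (eq0D (eq0D (eq0D (eq0D (eq0D (eq0D (eq0D (eq0D (eq0D (eq0M (8%:R * x 9%N) (h
    0 1 2 7 8 9 isT))
 (eq0M (- (4%:R * x 2%N)) (h 0 1 3 4 7 8 isT)))
 (eq0M (2%:R * x 0%N) (h 0 1 2 4 5 6 isT)))
 (eq0M (2%:R * x 0%N) (h 0 1 4 6 7 9 isT)))
 (eq0M (4%:R * x 5%N) (h 1 3 4 5 6 8 isT)))
 (eq0M (- (4%:R * x 5%N)) (h 0 1 4 6 8 9 isT)))
 (eq0M (4%:R * x 6%N) (h 0 1 3 6 7 9 isT)))
 (eq0M (- (2%:R * x 6%N)) (h 1 2 4 5 7 8 isT)))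
 (eq0M (- (2%:R * x 8%N)) (h 1 2 3 4 7 8 isT)))
 (eq0M (- (4%:R * x 3%N)) (h 0 3 4 7 8 9 isT)))
 (eq0M (8%:R * x 9%N) (h 2 3 4 6 7 8 isT)))
 (eq0M (- (2%:R * x 1%N)) (h 0 1 2 3 4 6 isT)))
 (eq0M (8%:R * x 9%N) (h 1 5 6 7 8 9 isT)))
 (eq0M (2%:R * x 3%N) (h 1 4 5 7 8 9 isT)))
 (eq0M (- (6%:R * x 6%N)) (h 0 1 5 7 8 9 isT)))
 (eq0M (- (2%:R * x 1%N)) (h 0 1 2 5 6 7 isT)))
 (eq0M (2%:R * x 1%N) (h 0 1 2 4 5 8 isT)))
 (eq0M (- (2%:R * x 5%N)) (h 0 2 3 4 5 6 isT)))
 (eq0M (8%:R * x 5%N) (h 0 1 2 5 7 8 isT)))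
 (eq0M (8%:R * x 3%N) (h 0 1 2 3 7 8 isT)))
 (eq0M (4%:R * x 3%N) (h 0 2 3 5 6 7 isT)))
 (eq0M (4%:R * x 3%N) (h 0 1 2 5 6 8 isT)))
 (eq0M (- (4%:R * x 0%N)) (h 0 1 5 6 7 8 isT)))
 (eq0M (- (4%:R * x 2%N)) (h 0 1 2 4 5 7 isT)))
 (eq0M (4%:R * x 2%N) (h 0 1 2 5 6 9 isT)));
rewrite /nvec /pf6 /pf4 /ctr /=; ring.
Qed.

End RankFour.

Section RankFourPoints.
Variable K : numFieldType.
Implicit Types x y : nat -> K.

Lemma rank4_coords_iter m x :
  rank4_coords x -> rank4_coords (fun k => x (iter m shift5 k)).
Proof. by elim: m x => [//|m IHm] x /rank4_coords_shift/IHm. Qed.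

Lemma rank4_coords_neq0 x k : rank4_coords x -> (k < 10)%N -> x k != 0 ->
  forall l, (l < 10)%N -> x l != 0.
Proof.
move=> h k10 xk l l10; apply: contraNneq xk => xl; apply/eqP.
pose next i := nth 0%N [:: 6; 7; 8; 9; 5; 0; 1; 2; 3; 4]%N i.
have h0 m := rank4_coords_0_6 (rank4_coords_iter m h).
have h5 m := rank4_coords_5_0 (rank4_coords_iter m h).
have nextP i : (i < 10)%N -> x i = 0 -> x (next i) = 0.
  case: i => [|[|[|[|[|[|[|[|[|[|//]]]]]]]]]] _.
  - exact: h0 0%N.
  - exact: h0 1%N.
  - exact: h0 2%N.
  - exact: h0 3%N.
  - exact: h0 4%N.
  - exact: h5 0%N.
  - exact: h5 1%N.
  - exact: h5 2%N.
  - exact: h5 3%N.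
  - exact: h5 4%N.
have next10 i : (i < 10)%N -> (next i < 10)%N by do 10?[case: i => [|i] //].
have iterP n : (iter n next l < 10)%N /\ x (iter n next l) = 0.
  by elim: n => [|n [lt10 xn]] //=; split; [exact: next10|exact: nextP].
suff : has (fun n => iter n next l == k) (iota 0 10).
  by case/hasP => n _ /eqP <-; case: (iterP n).
have : all (fun l => all (fun k => has (fun n => iter n next l == k) (iota 0 10))
  (iota 0 10)) (iota 0 10) by vm_compute.
move=> /allP/(_ l); rewrite mem_iota l10 => /(_ isT)/allP/(_ k).
by rewrite mem_iota k10 => /(_ isT).
Qed.

Definition weight k := nth 0%N [:: 10; 2; 7; 8; 6; 5; 1; 9; 4; 3]%N k.

Lemma torsion_ratio (r : nat -> K) (c : K) :
    (forall k, (k < 10)%N -> r k != 0) ->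
    [/\ r 4%N * r 5%N = c, r 0%N * r 6%N = c, r 1%N * r 7%N = c,
        r 2%N * r 8%N = c & r 3%N * r 9%N = c] ->
    [/\ r 7%N * r 9%N = r 2%N * r 5%N, r 8%N * r 5%N = r 3%N * r 6%N,
        r 9%N * r 6%N = r 4%N * r 7%N, r 5%N * r 7%N = r 0%N * r 8%N
      & r 6%N * r 8%N = r 1%N * r 9%N] ->
  exists a b, [/\ a != 0, b ^+ 11 = 1 &
    forall k, (k < 10)%N -> r k = a * b ^+ weight k].
Proof.
move=> r0 [c0 c1 c2 c3 c4] [l0 l1 l2 l3 l4].
have n5 := r0 5%N isT; have n6 := r0 6%N isT; have n7 := r0 7%N isT.
have n8 := r0 8%N isT; have n9 := r0 9%N isT.
pose a := r 6%N / r 5%N.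
have E6 : r 6%N = r 5%N * a by rewrite /a mulrC divfK.
have a0 : a != 0 by rewrite mulf_neq0 ?invr_eq0.
clearbody a.
have m0 : r 7%N * r 8%N * r 9%N = c * r 5%N.
  by rewrite mulrAC l0 -c3; ring.
have m1 : r 8%N * r 9%N * r 5%N = c * r 6%N.
  by rewrite mulrAC l1 -c4; ring.
have m2 : r 9%N * r 5%N * r 6%N = c * r 7%N.
  by rewrite mulrAC l2 -c0; ring.
have m3 : r 5%N * r 6%N * r 7%N = c * r 8%N.
  by rewrite mulrAC l3 -c1; ring.
have m4 : r 6%N * r 7%N * r 8%N = c * r 9%N.
  by rewrite mulrAC l4 -c2; ring.
have nc : c != 0 by rewrite -c0 mulf_neq0 // r0.
have s0 : r 6%N * r 7%N = r 5%N ^+ 2.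
  apply: (mulfI (mulf_neq0 n8 n9)); apply: etrans (_ : _ = c * r 5%N * r 6%N) _.
    by rewrite -m0; ring.
  by rewrite mulrAC -m1; ring.
have s1 : r 7%N * r 8%N = r 6%N ^+ 2.
  apply: (mulfI (mulf_neq0 n9 n5)); apply: etrans (_ : _ = c * r 6%N * r 7%N) _.
    by rewrite -m1; ring.
  by rewrite mulrAC -m2; ring.
have s2 : r 8%N * r 9%N = r 7%N ^+ 2.
  apply: (mulfI (mulf_neq0 n5 n6)); apply: etrans (_ : _ = c * r 7%N * r 8%N) _.
    by rewrite -m2; ring.
  by rewrite mulrAC -m3; ring.
have s3 : r 9%N * r 5%N = r 8%N ^+ 2.
  apply: (mulfI (mulf_neq0 n6 n7)); apply: etrans (_ : _ = c * r 8%N * r 9%N) _.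
    by rewrite -m3; ring.
  by rewrite mulrAC -m4; ring.
have E7 : r 7%N = r 5%N / a.
  by apply: (mulfI n6); rewrite s0 E6; field.
have E8 : r 8%N = r 5%N * a ^+ 3.
  by apply: (mulfI n7); rewrite s1 E6 E7; field.
have E9 : r 9%N = r 5%N / a ^+ 5.
  by apply: (mulfI n8); rewrite s2 E7 E8; field; rewrite ?a0.
have a11 : a ^+ 11 = 1.
  have <- : r 8%N ^+ 2 * a ^+ 5 / r 5%N ^+ 2 = a ^+ 11.
    by rewrite E8; field; rewrite ?n5 ?a0.
  by rewrite -s3 E9; field; rewrite ?n5 ?a0.
have Ec : c = r 5%N ^+ 2 / a ^+ 3.
  by apply: (mulIf n5); rewrite -m0 E7 E8 E9; field; rewrite ?a0.
have am k : a ^+ k = a ^+ (k %% 11)%N.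
  by rewrite {1}(divn_eq k 11) exprD mulnC exprM a11 expr1n mul1r.
exists (r 5%N * a ^+ 4), (a ^+ 8); split.
- by rewrite mulf_neq0 // expf_neq0.
- by rewrite -exprM mulnC exprM a11 expr1n.
have aV k : (k <= 11)%N -> (a ^+ k)^-1 = a ^+ (11 - k).
  by move=> k11; apply: (mulfI (expf_neq0 k a0)); rewrite mulfV ?expf_neq0 // -exprD subnKC.
have Ec' : c = r 5%N ^+ 2 * a ^+ 19 by rewrite Ec aV // (am 19).
have F (k : nat) (x : K) (e : nat) : r k * x = c -> x = r 5%N * a ^+ e -> (e <= 19)%N ->
    r k = r 5%N * a ^+ (19 - e).
  move=> kx xe e9; have xn : x != 0 by apply: contraNneq nc => x0; rewrite -kx x0 mulr0.
  apply: (mulIf xn); rewrite kx Ec' xe [RHS]mulrACA -exprD subnK // expr2.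
have E5' : r 5%N = r 5%N * a ^+ 0 by rewrite expr0 mulr1.
have E6' : r 6%N = r 5%N * a ^+ 1 by rewrite expr1.
have E7' : r 7%N = r 5%N * a ^+ 10 by rewrite E7 -[a in LHS]expr1 aV.
have E9' : r 9%N = r 5%N * a ^+ 6 by rewrite E9 aV.
have F0 := F _ _ _ c1 E6' isT; have F1 := F _ _ _ c2 E7' isT.
have F2 := F _ _ _ c3 E8 isT; have F3 := F _ _ _ c4 E9' isT.
have F4 := F _ _ _ c0 E5' isT.
have K1 (k e : nat) : r k = r 5%N * a ^+ e ->
    (e == (4 + 8 * weight k) %[mod 11])%N -> r k = r 5%N * a ^+ 4 * (a ^+ 8) ^+ weight k.
  move=> -> /eqP eE; rewrite -mulrA -exprM -exprD [a ^+ e]am eE.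
  by congr (_ * _); rewrite -am.
case=> [|[|[|[|[|[|[|[|[|[|//]]]]]]]]]] _.
- exact: K1 F0 _.
- exact: K1 F1 _.
- exact: K1 F2 _.
- exact: K1 F3 _.
- exact: K1 F4 _.
- exact: K1 E5' _.
- exact: K1 E6' _.
- exact: K1 E7' _.
- exact: K1 E8 _.
- exact: K1 E9' _.
Qed.
Lemma shift5_iter_lt m i : (i < 10)%N -> (iter m shift5 i < 10)%N.
Proof.
elim: m => [//|m IHm] /IHm; rewrite iterS; move: (iter _ _ _) => n.
by do 10?[case: n => [|n] //].
Qed.

Lemma sum5 (F : 'I_5 -> K) : \sum_i F i = F (inord 0) + F (inord 1) + F (inord 2)
  + F (inord 3) + F (inord 4).
Proof.
rewrite !big_ord_recl big_ord0 addr0 !addrA.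
by do !congr (_ + _); congr F; apply/val_inj; rewrite /= inordK.
Qed.

Definition eigen_mx : 'M[K]_5 := \matrix_(k, j) nth 0 (nth [::]
  [:: [:: 1; - 3%:R; 3%:R; - 1; - 1]; [:: 2%:R; - 4%:R; 4%:R; 0; - 2%:R];
      [:: 3%:R; - 1; 1; 3%:R; - 5%:R]; [:: 4%:R; 0; - 2%:R; 6%:R; - 8%:R];
      [:: 4%:R; - 2%:R; 0; 2%:R; - 6%:R]] j) k.

Definition nrow x : 'rV[K]_5 := \row_k nvec x k.

Definition eigenval x : K := 2%:R * (x 7%N * x 9%N) / (x 2%N * x 5%N).

Lemma nrow_eigen x : rank4_coords x -> x 2%N != 0 -> x 5%N != 0 ->
  nrow x *m eigen_mx = eigenval x *: nrow x.
Proof.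
move=> h x2 x5; have x25 : x 2%N * x 5%N != 0 by exact: mulf_neq0.
apply/rowP => j; rewrite mxE sum5 !mxE !inordK //; apply: (mulfI x25).
rewrite [RHS](_ : _ = 2%:R * (x 7%N * x 9%N) * nvec x j); last first.
  by rewrite /eigenval; field; rewrite ?x2 ?x5.
case: j => [[|[|[|[|[|//]]]]] hj] /=.
- by rewrite (nvec_eigen0 h); ring.
- by rewrite (nvec_eigen1 h); ring.
- by rewrite (nvec_eigen2 h); ring.
- by rewrite (nvec_eigen3 h); ring.
- by rewrite (nvec_eigen4 h); ring.
Qed.

Lemma nvec_shift x m k : (k < 5)%N -> (m < 5)%N ->
  nvec (fun i => x (iter m shift5 i)) k = nvec x ((k + m) %% 5)%N.
Proof. by do 5?[case: k => [|k] //]; do 5?[case: m => [|m] //]. Qed.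

Lemma rank4_proportional x y c : c != 0 ->
    rank4_coords x -> rank4_coords y ->
    (forall k, (k < 10)%N -> x k != 0) -> (forall k, (k < 10)%N -> y k != 0) ->
    nrow x = c *: nrow y ->
  exists a b, [/\ a != 0, b ^+ 11 = 1 &
    forall k, (k < 10)%N -> x k = a * b ^+ weight k * y k].
Proof.
move=> c0 hx hy nx ny nE.
have nvE k : (k < 5)%N -> nvec x k = c * nvec y k.
  by move=> k5; have /rowP/(_ (Ordinal k5)) := nE; rewrite !mxE.
have lamE m : (m < 5)%N -> eigenval (fun i => x (iter m shift5 i)) =
    eigenval (fun i => y (iter m shift5 i)).
  move=> m5; set xm := fun i => x _; set ym := fun i => y _.
  have s10 i := @shift5_iter_lt m i.
  have hxm : rank4_coords xm by exact: rank4_coords_iter.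
  have hym : rank4_coords ym by exact: rank4_coords_iter.
  have nmE : nrow xm = c *: nrow ym.
    apply/rowP => k; rewrite !mxE !nvec_shift // nvE //; exact: ltn_pmod.
  have e1 := nrow_eigen hxm (nx _ (s10 2%N isT)) (nx _ (s10 5%N isT)).
  have e2 := nrow_eigen hym (ny _ (s10 2%N isT)) (ny _ (s10 5%N isT)).
  move: e1; rewrite nmE -scalemxAl e2 !scalerA mulrC => /rowP/(_ 0).
  rewrite !mxE => /mulIf e; symmetry; apply: (mulIf c0); apply: e.
  by rewrite /nvec /= mulf_neq0 // ny // s10.
pose r k := x k / y k.
have rn k : (k < 10)%N -> r k != 0.
  by move=> k10; rewrite mulf_neq0 ?invr_eq0 ?nx ?ny.
have rxy k : (k < 10)%N -> x k = r k * y k by move=> k10; rewrite divfK ?ny.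
have [||a [b [a0 b11 rE]]] := @torsion_ratio r c rn.
- have N k : (k < 5)%N -> nvec r k = c.
    move=> k5; have := nvE k k5; have : nvec y k != 0.
      by do 5?[case: k k5 => [|k] k5 //]; rewrite /nvec /= mulf_neq0 // ny.
    have -> : nvec x k = nvec r k * nvec y k.
      by do 5?[case: k k5 => [|k] k5 //]; rewrite /nvec /= !rxy //; ring.
    by move/mulIf; apply.
  by split; [exact: N 0%N isT|exact: N 1%N isT|exact: N 2%N isT|exact: N 3%N isT|
    exact: N 4%N isT].
- have L m : (m < 5)%N -> let s i := iter m shift5 i in
     r (s 7%N) * r (s 9%N) = r (s 2%N) * r (s 5%N).
    move=> m5 s; have := lamE m m5; rewrite /eigenval.
    have s10 i : (i < 10)%N -> (s i < 10)%N by exact: shift5_iter_lt.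
    rewrite -/(s 7%N) -/(s 9%N) -/(s 2%N) -/(s 5%N) !(rxy (s _)) ?s10 // => e.
    have y2 := ny _ (s10 2%N isT); have y5 := ny _ (s10 5%N isT).
    have y7 := ny _ (s10 7%N isT); have y9 := ny _ (s10 9%N isT).
    have r2 := rn _ (s10 2%N isT); have r5 := rn _ (s10 5%N isT).
    have n2 : 2%:R != 0 :> K by rewrite pnatr_eq0.
    have k0 : 2%:R * (y (s 7%N) * y (s 9%N)) / (y (s 2%N) * y (s 5%N)) != 0.
      by rewrite !mulf_neq0 ?invr_eq0 ?mulf_neq0.
    apply: (mulIf k0); apply: etrans (_ : _ = r (s 2%N) * r (s 5%N) *
      (2%:R * (r (s 7%N) * y (s 7%N) * (r (s 9%N) * y (s 9%N))) /
       (r (s 2%N) * y (s 2%N) * (r (s 5%N) * y (s 5%N))))) _.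
      by field; rewrite ?y2 ?y5 ?r2 ?r5.
    by rewrite e.
  by split; [exact: L 0%N isT|exact: L 1%N isT|exact: L 2%N isT|exact: L 3%N isT|
    exact: L 4%N isT].
by exists a, b; split=> // k k10; rewrite -rE // -rxy.
Qed.

Lemma rank4_coords_classify (z : 'I_5 -> nat -> K) x :
    (forall i, rank4_coords (z i)) ->
    (forall i k, (k < 10)%N -> z i k != 0) ->
    injective (fun i => eigenval (z i)) ->
    (\matrix_i nrow (z i)) \in unitmx ->
    rank4_coords x -> (forall k, (k < 10)%N -> x k != 0) ->
  exists i a b, [/\ a != 0, b ^+ 11 = 1 &
    forall k, (k < 10)%N -> x k = a * b ^+ weight k * z i k].
Proof.
move=> hz nz lamI; set M := \matrix_i _ => Mu hx nx.
pose c := nrow x *m invmx M; have cM : nrow x = c *m M by rewrite mulmxKV.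
clearbody c.
have nx0 : nrow x != 0.
  apply/eqP => /rowP/(_ 0); rewrite !mxE /nvec /= => /eqP.
  by rewrite mulf_eq0 !(negPf (nx _ _)).
have c0 : c != 0 by apply: contraNneq nx0; rewrite cM => ->; rewrite mul0mx.
have ME : M *m eigen_mx = diag_mx (\row_i eigenval (z i)) *m M.
  apply/row_matrixP => i; rewrite row_mul rowK nrow_eigen ?nz //.
  by apply/rowP => j; rewrite mul_diag_mx !mxE.
have cD : c *m diag_mx (\row_i eigenval (z i)) = eigenval x *: c.
  apply: (can_inj (mulmxK Mu)); rewrite -scalemxAl -cM -mulmxA -ME mulmxA -cM.
  by rewrite nrow_eigen ?nx.
have lamE k : c 0 k != 0 -> eigenval (z k) = eigenval x.
  by move=> ck; have /rowP/(_ k) := cD; rewrite mul_mx_diag !mxE mulrC => /(mulIf ck).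
have [i ci] : exists i, c 0 i != 0.
  apply/existsP; rewrite -negb_forall; apply: contra c0 => /forallP h.
  by apply/eqP/rowP => i; rewrite mxE; apply/eqP; rewrite -[_ == _]negbK h.
exists i; apply: (rank4_proportional ci) => //; first exact: nz.
rewrite cM mulmx_sum_row (bigD1 i) //= rowK big1 ?addr0 // => k ki.
have [->|ck] := eqVneq (c 0 k) 0; first by rewrite scale0r.
by case/eqP: ki; apply: lamI; rewrite (lamE k) // (lamE i).
Qed.
End RankFourPoints.

(** * Computing in the cyclotomic ring *)

Definition zadd : seq Z -> seq Z -> seq Z :=
  fix add l m := match l, m with
    | [::], _ => m | _, [::] => l | a :: l', b :: m' => Z.add a b :: add l' m' end.

Definition zscale a : seq Z -> seq Z := map (Z.mul a).

Fixpoint zmul (l m : seq Z) : seq Z :=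
  if l is a :: l' then zadd (zscale a m) (Z0 :: zmul l' m) else [::].

Definition fold11 (l : seq Z) : seq Z := zadd (take 11 l) (drop 11 l).
Definition cmul l m := fold11 (zmul l m).
Definition cpow l n := iter n (cmul l) [:: Zpos 1].

Definition pad11 (l : seq Z) : seq Z := zadd (fold11 l) (nseq 11 Z0).

Definition czero (l : seq Z) : bool :=
  let r := pad11 l in r == nseq 11 (head Z0 r).

Definition cconj (l : seq Z) (a : nat) : seq Z :=
  mkseq (fun m => nth Z0 (pad11 l) (m * a %% 11)) 11.

(* The product of l by its other conjugates is its norm, an integer. *)
Definition cnonzero (l : seq Z) : bool :=
  let r := pad11 (foldr (fun a => cmul (cconj l a)) l (iota 2 9)) in
  let c := nth Z0 r 1 in
  (r == head Z0 r :: nseq 10 c) && (head Z0 r != c).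

Section Cyclotomic.
Variable K : numFieldType.
Implicit Types (z : K) (l m : seq Z).

Definition zinj (a : Z) : K := (int_of_Z a)%:~R.

Fixpoint ev_rec z l : K := if l is a :: l' then zinj a + z * ev_rec z l' else 0.

(* Locked, lest unification tries to compare such sums by unfolding them. *)
Definition ev := locked ev_rec.

Lemma ev_nil z : ev z [::] = 0. Proof. by rewrite /ev -lock. Qed.

Lemma ev_cons z a l : ev z (a :: l) = zinj a + z * ev z l.
Proof. by rewrite /ev -lock. Qed.

Let evE := (ev_nil, ev_cons).

Lemma zinjD a b : zinj (Z.add a b) = zinj a + zinj b.
Proof. by rewrite /zinj (raddfD int_of_Z) rmorphD. Qed.

Lemma zinjM a b : zinj (Z.mul a b) = zinj a * zinj b.
Proof. by rewrite /zinj (rmorphM int_of_Z) rmorphM. Qed.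

Lemma zinj0 : zinj Z0 = 0. Proof. by []. Qed.
Lemma zinj1 : zinj (Zpos 1) = 1. Proof. by []. Qed.

Lemma zinj_inj : injective zinj.
Proof. by move=> a b /eqP; rewrite eqr_int => /eqP/(can_inj int_of_ZK). Qed.

Lemma ev_add z l m : ev z (zadd l m) = ev z l + ev z m.
Proof.
elim: l m => [|a l IHl] [|b m] /=; rewrite ?evE ?add0r ?addr0 //.
by rewrite zinjD IHl; ring.
Qed.

Lemma ev_scale z a l : ev z (zscale a l) = zinj a * ev z l.
Proof. by elim: l => [|b l IHl] /=; rewrite !evE ?mulr0 // zinjM IHl; ring. Qed.

Lemma ev_mul z l m : ev z (zmul l m) = ev z l * ev z m.
Proof.
elim: l => [|a l IHl] /=; rewrite !evE ?mul0r // ev_add ev_scale evE IHl zinj0; ring.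
Qed.

Lemma ev_cat z l m : ev z (l ++ m) = ev z l + z ^+ size l * ev z m.
Proof. elim: l => [|a l IHl] /=; rewrite !evE; first by ring.
by rewrite IHl exprS; ring. Qed.

Lemma ev_nseq z n a : ev z (nseq n a) = zinj a * \sum_(i < n) z ^+ i.
Proof.
elim: n => [|n IHn] /=; rewrite evE; first by rewrite big_ord0 mulr0.
rewrite IHn big_ord_recl expr0 mulrDr mulr1 mulrCA mulr_sumr.
by congr (_ + _ * _); apply: eq_bigr => i _; rewrite exprS.
Qed.

Variable z : K.
Hypothesis z_prim : 11.-primitive_root z.

Lemma ev_fold l : ev z (fold11 l) = ev z l.
Proof.
rewrite ev_add -[in RHS](cat_take_drop 11 l) ev_cat size_take_min.
have [l11|l11] := leqP 11 (size l).
  by rewrite /= (prim_expr_order z_prim) mul1r.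
by rewrite drop_oversize ?(ltnW l11) // evE mulr0.
Qed.

Lemma ev_cmul l m : ev z (cmul l m) = ev z l * ev z m.
Proof. by rewrite ev_fold ev_mul. Qed.

Lemma ev_cpow l n : ev z (cpow l n) = ev z l ^+ n.
Proof.
elim: n => [|n IHn]; first by rewrite !evE zinj1 mulr0 addr0 expr0.
by rewrite exprS -IHn -ev_cmul.
Qed.

Lemma ev_pad l : ev z (pad11 l) = ev z l.
Proof. by rewrite ev_add ev_fold ev_nseq zinj0 mul0r addr0. Qed.

Lemma sum_prim_root11 : \sum_(i < 11) z ^+ i = 0.
Proof.
have z1 : z != 1.
  have := eq_prim_root_expr z_prim 1 0.
  by rewrite expr0 expr1 => ->.
have := subrX1 z 11; rewrite /= (prim_expr_order z_prim) subrr => /esym/eqP.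
by rewrite mulf_eq0 subr_eq0 (negPf z1) => /eqP.
Qed.

Lemma ev_czero l : czero l -> ev z l = 0.
Proof.
by rewrite -ev_pad /czero => /eqP ->; rewrite ev_nseq sum_prim_root11 mulr0.
Qed.

Lemma ev_cnonzero l : cnonzero l -> ev z l != 0.
Proof.
rewrite /cnonzero; set p := foldr _ _ _; set r := pad11 _; set c := nth _ _ _.
case/andP => /eqP rE rc.
have [q qE] : exists q, ev z p = q * ev z l.
  rewrite /p; elim: (iota 2 9) => [|a s [q IHq]] /=; first by exists 1; rewrite mul1r.
  by exists (ev z (cconj l a) * q); rewrite ev_cmul IHq mulrA.
have : ev z p = zinj (head Z0 r) - zinj c.
  rewrite -ev_pad -/r rE; clearbody c; move: (head Z0 r) => r0.
  have := sum_prim_root11; rewrite big_ord_recl expr0 => /eqP; rewrite addr_eq0.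
  move=> /eqP zE; rewrite evE.
  have -> : z * ev z (nseq 10 c) = zinj c * \sum_(i < 10) z ^+ bump 0 i.
    rewrite ev_nseq mulrCA; congr (_ * _); rewrite mulr_sumr.
    by apply: eq_bigr => i _; rewrite exprS.
  rewrite (_ : \sum_(i < 10) _ = -1) ?mulrN1 //.
  by rewrite zE opprK; apply: eq_bigr.
rewrite qE => e; apply: contraNneq rc => l0; move: e; rewrite l0 mulr0.
by move/esym/eqP; rewrite subr_eq0 => /eqP/zinj_inj/eqP.
Qed.

End Cyclotomic.

(* Unification computes clist for expressions built from ev z by ring operations. *)
Structure cyc (K : numFieldType) (z : K) := Cyc {
  cval : K; clist : seq Z; cvalP : 11.-primitive_root z -> cval = ev z clist }.

Section Reflection.
Variables (K : numFieldType) (z : K).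
Implicit Types x y : cyc z.

Lemma cyc_eq0 x : 11.-primitive_root z -> czero (clist x) -> cval x = 0.
Proof. by move=> zP; rewrite (cvalP _ zP); apply: ev_czero. Qed.

Lemma cyc_neq0 x : 11.-primitive_root z -> cnonzero (clist x) -> cval x != 0.
Proof. by move=> zP; rewrite (cvalP _ zP); apply: ev_cnonzero. Qed.

Fact cyc_addP x y (zP : 11.-primitive_root z) :
  cval x + cval y = ev z (zadd (clist x) (clist y)).
Proof. by rewrite ev_add -!(cvalP _ zP). Qed.
Canonical cyc_add x y := Cyc (cyc_addP x y).

Fact cyc_mulP x y (zP : 11.-primitive_root z) :
  cval x * cval y = ev z (cmul (clist x) (clist y)).
Proof. by rewrite ev_cmul // -!(cvalP _ zP). Qed.
Canonical cyc_mul x y := Cyc (cyc_mulP x y).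

Fact cyc_oppP x (zP : 11.-primitive_root z) :
  - cval x = ev z (zscale (-1) (clist x)).
Proof. by rewrite ev_scale -(cvalP _ zP) /zinj mulN1r. Qed.
Canonical cyc_opp x := Cyc (cyc_oppP x).

Fact cyc_0P (zP : 11.-primitive_root z) : 0 = ev z [::].
Proof. by rewrite ev_nil. Qed.
Canonical cyc_0 := Cyc cyc_0P.

Fact cyc_1P (zP : 11.-primitive_root z) : 1 = ev z [:: Zpos 1].
Proof. by rewrite ev_cons ev_nil mulr0 addr0. Qed.
Canonical cyc_1 := Cyc cyc_1P.

Fact cyc_natmulP x n (zP : 11.-primitive_root z) :
  cval x *+ n = ev z (zscale (Z.of_nat n) (clist x)).
Proof.
rewrite ev_scale -(cvalP _ zP) -mulr_natl; congr (_ * _).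
elim: n => [|n IHn]; first by rewrite zinj0.
by rewrite Nat2Z.inj_succ -Z.add_1_r zinjD -IHn zinj1 -natr1.
Qed.
Canonical cyc_natmul x n := Cyc (cyc_natmulP x n).

Fact cyc_expP x n (zP : 11.-primitive_root z) :
  cval x ^+ n = ev z (cpow (clist x) n).
Proof. by rewrite ev_cpow // -(cvalP _ zP). Qed.
Canonical cyc_exp x n := Cyc (cyc_expP x n).

Canonical cyc_ev l := Cyc (fun _ : 11.-primitive_root z => erefl (ev z l)).
End Reflection.

Ltac cyc_compute :=
  lazymatch goal with |- is_true _ => apply: cyc_neq0 | |- _ => apply: cyc_eq0 end;
  [eassumption | vm_compute; reflexivity].

(** * The 55 points *)

Lemma forall_iota n (p : pred nat) : all p (iota 0 n) -> forall k, (k < n)%N -> p k.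
Proof. by move=> /allP h k kn; apply: h; rewrite mem_iota. Qed.

Section Points.
Variables (K : numFieldType) (z : K).
Hypothesis z_prim : 11.-primitive_root z.

(* The coefficients of the image of 3 (z - z^10) - 2 (z^2 - z^9) - (z^3 - z^8)
   - 2 (z^4 - z^7) - 2 (z^5 - z^6) under z |-> z^w. *)
Definition base_coefs (w : nat) : seq Z :=
  mkseq (fun m => nth Z0 [:: 0; 3; -2; -1; -2; -2; 2; 2; 1; 2; -3]%coqZ
    (m * nth 0 [:: 0; 1; 6; 4; 3; 9; 2; 8; 7; 5; 10]%N w %% 11)) 11.

Definition base_coord (i k : nat) : K := ev z (base_coefs (weight (iter i shift5 k))).

Definition ctr_mx (x : nat -> K) : 'M[K]_10 := \matrix_(i, j) ctr x i j.

Lemma ctr_skew (x : nat -> K) i j : (i < 10)%N -> (j < 10)%N -> ctr x j i = - ctr x i j.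
Proof.
by do 10?[case: i => [|i] //]; do 10?[case: j => [|j] //] => _ _;
  rewrite /ctr /= ?oppr0 ?opprK.
Qed.

Lemma ctr_mx_skew x : skew_fun (ctr_mx x).
Proof. by move=> i j; rewrite !mxE ctr_skew. Qed.

Lemma ctr_mx_diag x i : ctr_mx x i i = 0.
Proof. by rewrite mxE; case: i; do 10?[case=> [|] //]. Qed.

Lemma rank4_coordsP x : rank4_coords x <-> (\rank (ctr_mx x) <= 4)%N.
Proof.
have pfE a b c d e f : (all (fun i => i < 10)%N [:: a; b; c; d; e; f]) ->
    pf6 (ctr x) a b c d e f = pf6 (ctr_mx x) (inord a) (inord b) (inord c)
      (inord d) (inord e) (inord f).
  by case/and5P => a10 b10 c10 d10 /and3P[e10 f10 _]; rewrite /pf6 /pf4 !mxE !inordK.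
split=> [h|h a b c d e f h10]; last first.
  by rewrite pfE //; apply: pf6_rank h; [exact: ctr_mx_skew|exact: ctr_mx_diag].
apply: (rank_le4P (@ctr_mx_skew x)) => a b c d e f.
have := pfE a b c d e f; rewrite !inord_val => <-; first apply: h.
all: by rewrite /= !ltn_ord.
Qed.

Lemma rank4_coords_0123 (x : nat -> K) : pf4 (ctr x) 0 1 2 3 != 0 ->
    (forall i e, (i < 6)%N -> (e < 6)%N -> (i < e)%N ->
       pf6 (ctr x) i.+4 e.+4 0 1 2 3 = 0) ->
  rank4_coords x.
Proof.
move=> p4 p6; apply/rank4_coordsP.
apply: (rank_le4_at (@ctr_mx_skew _) (a := inord 0) (b := inord 1) (c := inord 2)
  (d := inord 3)).
  by move: p4; rewrite /pf4 !mxE !inordK.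
have sN := @ctr_mx_skew x; have aN := @ctr_mx_diag x.
pose q i e := pf6 (ctr_mx x) i e (inord 0) (inord 1) (inord 2) (inord 3).
have qE (i e : 'I_10) : q i e = pf6 (ctr x) i e 0 1 2 3.
  by rewrite /q /pf6 /pf4 !mxE !inordK.
have qC i e : q i e = - q e i.
  by rewrite /q /pf6 /pf4 (sN i e); ring.
have q0 i (e : 'I_10) : (e < 4)%N -> q i e = 0.
  rewrite -{2}[e]inord_val /q /pf6 /pf4.
  case: (nat_of_ord e) => [|[|[|[|//]]]] _; move: (ctr_mx x) sN aN => N sN aN.
  - by rewrite aN; ring.
  - by rewrite aN (sN (inord 0) (inord 1)); ring.
  - by rewrite aN (sN (inord 0) (inord 2)) (sN (inord 1) (inord 2)); ring.
  - by rewrite aN !(sN _ (inord 3)); ring.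
have qlt (i e : 'I_10) : (i < e)%N -> q i e = 0.
  move=> ie; have [i4|i4] := ltnP i 4; first by rewrite qC q0 // oppr0.
  have e4 := leq_trans i4 (ltnW ie).
  rewrite qE -(subnK i4) -(subnK e4) !addn4; apply: p6.
  - by rewrite ltn_subLR // (leq_trans (ltn_ord i)).
  - by rewrite ltn_subLR // (leq_trans (ltn_ord e)).
  - by rewrite ltn_sub2r // (leq_ltn_trans i4).
move=> e i; rewrite -/(q i e); have [/qlt //|/qlt h|/val_inj ->] := ltngtP i e.
  by rewrite qC h oppr0.
by rewrite /q /pf6 /pf4; move: (ctr_mx x) sN aN => N sN aN; rewrite !aN; ring.
Qed.

Lemma base_pf4_neq0 i : (i < 5)%N -> pf4 (ctr (base_coord i)) 0 1 2 3 != 0.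
Proof.
move=> i5; do 5?[case: i i5 => [|i] i5]; last by discriminate i5.
all: by rewrite /pf4 /ctr /=; cyc_compute.
Qed.

Lemma base_pf6 i e : (i < 6)%N -> (e < 6)%N -> (i < e)%N ->
  pf6 (ctr (base_coord 0)) i.+4 e.+4 0 1 2 3 = 0.
Proof.
move=> i6 e6 ie; do 6?[case: i i6 ie => [|i] i6 ie]; last by discriminate i6.
all: do 6?[case: e e6 ie => [|e] e6 ie]; first [discriminate e6 | discriminate ie | idtac].
all: rewrite /pf6 /pf4 /ctr /=; cyc_compute.
Qed.

Lemma base_rank4 i : rank4_coords (base_coord i).
Proof.
suff : rank4_coords (base_coord 0) by move=> /(rank4_coords_iter i).
exact: (rank4_coords_0123 (base_pf4_neq0 (isT : (0 < 5)%N)) base_pf6).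
Qed.

Lemma base_coord_neq0 i k : (i < 5)%N -> (k < 10)%N -> base_coord i k != 0.
Proof.
move=> i5 k10; apply: (cyc_neq0 z_prim).
suff /forall_iota/(_ i i5)/forall_iota/(_ k k10) : all (fun i => all (fun k =>
  cnonzero (base_coefs (weight (iter i shift5 k)))) (iota 0 10)) (iota 0 5) by exact.
by vm_compute.
Qed.

Lemma base_eigenval_inj : injective (fun i : 'I_5 => eigenval (base_coord i)).
Proof.
move=> i i' /eqP; rewrite /eigenval eqr_div; last first.
- by rewrite mulf_neq0 ?base_coord_neq0.
- by rewrite mulf_neq0 ?base_coord_neq0.
rewrite -subr_eq0 => e; apply/val_inj/eqP; apply: contraTT e => ii'.
case: i i' ii' => [i i5] [i' i'5] /= ii'.
do 5?[case: i i5 ii' => [|i] i5 ii']; last by discriminate i5.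
all: do 5?[case: i' i'5 ii' => [|i'] i'5 ii']; 
  first [discriminate ii' | discriminate i'5 | cyc_compute].
Qed.

(* 2662 = 2 * 11 ^ 3 times the first row of the inverse of the matrix below, whose
   entry (i, j) depends only on i + j. *)
Definition base_inv_coefs : seq (seq Z) :=
  [:: [:: -5; 0; -18; -4; -2; -12; -12; -2; -4; -18; 0];
      [:: 7; 0; 12; 10; -6; 8; 8; -6; 10; 12; 0];
      [:: -1; 0; -8; -14; 4; 2; 2; 4; -14; -8; 0];
      [:: -3; 0; -2; 2; -10; -16; -16; -10; 2; -2; 0];
      [:: 13; 0; 16; 6; 14; 18; 18; 14; 6; 16; 0]]%coqZ.

Lemma base_mx_inv :
  (\matrix_(i < 5) nrow (base_coord i)) *m
    (\matrix_(i, j) ev z (nth [::] base_inv_coefs ((i + j) %% 5))) = 2662%:R%:M.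
Proof.
move cE: 2662%:R => c.
apply/matrixP => -[i i5] [j j5]; rewrite mxE sum5 !mxE !inordK //.
apply/eqP; rewrite -subr_eq0; apply/eqP.
do 5?[case: i i5 => [|i] i5]; last by discriminate i5.
all: do 5?[case: j j5 => [|j] j5]; last by discriminate j5.
all: rewrite /nvec /= -cE; cyc_compute.
Qed.

Lemma base_unitmx : (\matrix_(i < 5) nrow (base_coord i)) \in unitmx.
Proof.
have n0 : 2662%:R != 0 :> K by rewrite pnatr_eq0.
have := base_mx_inv; move: (2662%:R) n0 => c c0 /(congr1 (fun A => c^-1 *: A)).
by rewrite scalemxAr scale_scalar_mx mulVf // => /mulmx1_unit[].
Qed.
End Points.

Section Twist.
Variables (K : numFieldType) (b : K).
Hypothesis b11 : b ^+ 11 = 1.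
Implicit Types x : nat -> K.

Definition twist (x : nat -> K) k := b ^+ weight k * x k.

Lemma ctr_twist x i j : (i < 10)%N -> (j < 10)%N ->
  ctr (twist x) i j = b ^+ (11 - weight i) * b ^+ (11 - weight j) * ctr x i j.
Proof.
have bE m n : m = n %[mod 11] -> b ^+ m = b ^+ n.
  by move=> mn; rewrite -(expr_mod m b11) mn expr_mod.
rewrite -exprD => i10 j10.
do 10?[case: i i10 => [|i] i10]; last by discriminate i10.
all: do 10?[case: j j10 => [|j] j10]; last by discriminate j10.
all: rewrite /ctr /twist /= ?mulr0 ?mulrN //.
all: try congr (- _); congr (_ * _); exact: bE.
Qed.

Lemma rank4_coords_twist x : rank4_coords x -> rank4_coords (twist x).
Proof.
move=> h i j k l m n h10; have /and5P[i10 j10 k10 l10 /and3P[m10 n10 _]] := h10.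
rewrite /pf6 /pf4 !ctr_twist //; move: (h _ _ _ _ _ _ h10); rewrite /pf6 /pf4.
set e := fun i => b ^+ (11 - weight i); rewrite -!/(e _) => pf0.
apply: etrans (eq0M (e i * e j * e k * e l * e m * e n) pf0).
by ring.
Qed.

Lemma eigenval_twist x : b != 0 -> eigenval (twist x) = eigenval x.
Proof.
move=> b0; rewrite /eigenval /twist /=.
have -> : 2%:R * (b ^+ 9 * x 7%N * (b ^+ 3 * x 9%N)) =
  b ^+ 12 * (2%:R * (x 7%N * x 9%N)) by ring.
have -> : b ^+ 7 * x 2%N * (b ^+ 5 * x 5%N) = b ^+ 12 * (x 2%N * x 5%N) by ring.
by rewrite -mulf_div divff ?mul1r // expf_neq0.
Qed.
End Twist.

Section PointCoords.
Variables (K : numFieldType) (z : K).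
Hypothesis z_prim : 11.-primitive_root z.

Definition pt_coord (i j : nat) : nat -> K := twist (z ^+ j) (base_coord z i).

Lemma z_neq0 : z != 0.
Proof. by rewrite (prim_root_eq0 z_prim). Qed.

Lemma root11 j : (z ^+ j) ^+ 11 = 1.
Proof. by rewrite exprAC (prim_expr_order z_prim) expr1n. Qed.

Lemma pt_coord_neq0 i j k : (i < 5)%N -> (k < 10)%N -> pt_coord i j k != 0.
Proof.
by move=> i5 k10; rewrite mulf_neq0 ?base_coord_neq0 // !expf_neq0 ?z_neq0.
Qed.

Lemma pt_coord_rank4 i j : rank4_coords (pt_coord i j).
Proof. exact/rank4_coords_twist/base_rank4/z_prim/root11. Qed.

Lemma pt_coord_inj (i i' : 'I_5) (j j' : 'I_11) c :
  (forall k, (k < 10)%N -> pt_coord i j k = c * pt_coord i' j' k) ->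
  (i, j) = (i', j').
Proof.
move=> e; have c0 : c != 0.
  by apply: contraNneq (pt_coord_neq0 j (ltn_ord i) (isT : (0 < 10)%N)) => c0;
    rewrite e // c0 mul0r.
have ii' : i = i'.
  apply: (base_eigenval_inj z_prim).
  rewrite -(eigenval_twist (base_coord z i) (expf_neq0 j z_neq0)).
  rewrite -[RHS](eigenval_twist _ (expf_neq0 j' z_neq0)).
  rewrite -!/(pt_coord _ _) /eigenval !e //.
  have := pt_coord_neq0 j' (ltn_ord i') (isT : (2 < 10)%N).
  have := pt_coord_neq0 j' (ltn_ord i') (isT : (5 < 10)%N).
  by move: (pt_coord _ _) => p p5 p2; field; rewrite ?c0 ?p5 ?p2.
subst i'; congr (_, _); apply/val_inj/eqP.
have ek k : (k < 10)%N -> (z ^+ j) ^+ weight k = c * (z ^+ j') ^+ weight k.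
  move=> k10; apply: (mulIf (base_coord_neq0 z_prim (ltn_ord i) k10)).
  by rewrite -mulrA; apply: e.
have := ek 1%N isT; have := ek 6%N isT; rewrite /weight /= !expr1 => e6.
rewrite expr2 {1}e6 expr2 -!mulrA => /(mulfI c0)/(mulfI (expf_neq0 _ z_neq0)) => /eqP.
by rewrite (eq_prim_root_expr z_prim) /= !modn_small.
Qed.

Lemma rank4_coordsE x k : rank4_coords x -> (k < 10)%N -> x k != 0 ->
  exists (i : 'I_5) (j : 'I_11) (a : K), a != 0 /\
    forall k, (k < 10)%N -> x k = a * pt_coord i j k.
Proof.
move=> hx k10 xk; have nx := rank4_coords_neq0 hx k10 xk.
have [i|i l l10|i [a [b [a0 b11 xE]]]] := @rank4_coords_classify _ (base_coord z) x
  _ _ (base_eigenval_inj z_prim) (base_unitmx z_prim) hx nx.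
- exact: base_rank4.
- exact: base_coord_neq0.
have [j bE] := prim_rootP z_prim b11.
by exists i, j, a; split=> // l l10; rewrite xE // bE -mulrA.
Qed.
End PointCoords.

Section RowPoints.
Variables (K : numFieldType) (z : K).
Hypothesis z_prim : 11.-primitive_root z.
Implicit Types v w : 'rV[K]_10.

Definition xcoord v (k : nat) : K := v 0 (inord k).

Lemma contract_ctr v : contract v = ctr_mx (xcoord v).
Proof.
apply/matrixP => i j; rewrite !mxE -{1}(inord_val j) sigma0_delta //.
have [a [a10 ->]] : exists a, (a < 10)%N /\ i = inord a by exists i; rewrite inord_val.
rewrite inordK // /sigma0_coef {i}.
move: (nat_of_ord j) (ltn_ord j) => {}j j10; move: a a10 => i i10.
do 10?[case: j j10 => [|j] j10]; last by discriminate j10.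
all: rewrite /= !mxE !inord10_eq //=.
all: do 10?[case: i i10 => [|i] i10]; last by discriminate i10.
all: by rewrite /= /ctr /xcoord /= ?mulr0 ?mulr1 ?subr0 ?sub0r ?addr0 ?add0r.
Qed.

Definition row_pt (i j : nat) : 'rV[K]_10 := \row_k pt_coord z i j k.

Lemma coord_row_pt i j k : (k < 10)%N -> xcoord (row_pt i j) k = pt_coord z i j k.
Proof. by move=> k10; rewrite /xcoord mxE inordK. Qed.

Lemma rowv_coordP v w : (forall k, (k < 10)%N -> xcoord v k = xcoord w k) -> v = w.
Proof. by move=> e; apply/rowP => k; have := e k (ltn_ord k); rewrite /xcoord inord_val. Qed.

Lemma row_pt_neq0 (i : 'I_5) j : row_pt i j != 0.
Proof.
apply: contraNneq (pt_coord_neq0 z_prim j (ltn_ord i) (isT : (0 < 10)%N)) => p0.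
by rewrite -coord_row_pt // p0 /xcoord mxE.
Qed.

Lemma row_pt_inj (i i' : 'I_5) (j j' : 'I_11) : (row_pt i j == row_pt i' j')%MS -> (i, j) =
  (i', j').
Proof.
case/andP => /sub_rVP[c e] _; apply: (pt_coord_inj z_prim (c := c)) => k k10.
by rewrite -!coord_row_pt // e /xcoord mxE.
Qed.

Lemma ctr_mx_eq (x y : nat -> K) :
  (forall k, (k < 10)%N -> x k = y k) -> ctr_mx x = ctr_mx y.
Proof. by move=> e; apply/matrixP => i j; rewrite !mxE /ctr !e. Qed.

Lemma contract_row_pt i j : contract (row_pt i j) = ctr_mx (pt_coord z i j).
Proof. by rewrite contract_ctr; apply/ctr_mx_eq/coord_row_pt. Qed.

Lemma eqmx_scale_row v w c : c != 0 -> v = c *: w -> (v == w)%MS.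
Proof. by move=> c0 ->; apply/eqmxP/eqmx_scale. Qed.

Lemma rank_contract_le4P v : v != 0 ->
  (\rank (contract v) <= 4)%N <-> exists (i : 'I_5) (j : 'I_11), (v == row_pt i j)%MS.
Proof.
move=> v0; rewrite contract_ctr; split=> [/rank4_coordsP h|[i [j /andP[/sub_rVP[c ->] _]]]].
  have [k k0] : exists k, v 0 k != 0.
    apply/existsP; rewrite -negb_forall; apply: contra v0 => /forallP v0.
    by apply/eqP/rowP => k; rewrite mxE; apply/eqP; rewrite -[_ == _]negbK v0.
  have [|i [j [a [a0 vE]]]] := rank4_coordsE z_prim h (ltn_ord k).
    by rewrite /xcoord inord_val.
  exists i, j; apply: (eqmx_scale_row a0); apply: rowv_coordP => l l10.
  by rewrite vE // [RHS]mxE -coord_row_pt.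
rewrite -contract_ctr (_ : contract _ = c *: contract (row_pt i j)).
  apply: leq_trans (mxrankS (scalemx_sub _ (submx_refl _))) _.
  by rewrite contract_row_pt; apply/rank4_coordsP/pt_coord_rank4.
by apply/matrixP => a b; rewrite !mxE sigma0_rot linearZ /= -sigma0_rot.
Qed.

Lemma rank_contract_row_pt (i : 'I_5) (j : 'I_11) : \rank (contract (row_pt i j)) = 4%N.
Proof.
apply/eqP; rewrite eqn_leq; apply/andP; split.
  by apply/rank_contract_le4P; [exact: row_pt_neq0|exists i, j; apply/eqmxP].
rewrite contract_row_pt; have p4 := base_pf4_neq0 z_prim (ltn_ord i).
apply: (pf4_rank (@ctr_mx_skew _ _) (@ctr_mx_diag _ _) (a := inord 0) (b := inord 1)
  (c := inord 2) (d := inord 3)).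
rewrite /pf4 !mxE !inordK // !ctr_twist ?root11 //; move: p4; rewrite /pf4.
set b := fun k => (z ^+ j) ^+ (11 - weight k); rewrite -!/(b _).
move: (ctr _) => N p4; have bn k : b k != 0 by rewrite !expf_neq0 ?z_neq0.
clearbody b.
rewrite (_ : _ + _ = b 0%N * b 1%N * b 2%N * b 3%N *
  (N 0%N 1%N * N 2%N 3%N - N 0%N 2%N * N 1%N 3%N + N 0%N 3%N * N 1%N 2%N)); last by ring.
by rewrite !mulf_neq0.
Qed.

Lemma row_pt_modl i j : row_pt (i %% 5) j = row_pt i j.
Proof.
apply: rowv_coordP => k k10; rewrite !coord_row_pt // /pt_coord /twist; congr (_ * _).
rewrite /base_coord; congr (ev z (base_coefs (weight _))).
rewrite [in RHS](divn_eq i 5) addnC iterD; congr (iter _ _ _).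
have s5 : iter 5 shift5 k = k by do 10?[case: k k10 => [|k] k10 //].
by elim: (i %/ 5)%N => [//|n IHn]; rewrite mulSn iterD -IHn s5.
Qed.

Lemma row_pt_modr i j : row_pt i (j %% 11) = row_pt i j.
Proof.
apply: rowv_coordP => k k10; rewrite !coord_row_pt // /pt_coord /twist.
by rewrite expr_mod // (prim_expr_order z_prim).
Qed.

Lemma row_ptE i j : exists (i' : 'I_5) (j' : 'I_11), row_pt i j = row_pt i' j'.
Proof.
exists (inord (i %% 5)), (inord (j %% 11)).
by rewrite !inordK ?ltn_pmod // row_pt_modl row_pt_modr.
Qed.
End RowPoints.

Section Zeta.
Variable R : realType.

Lemma de_moivre (t : R) n : (trigo.cos t +i* trigo.sin t)%C ^+ n =
  (trigo.cos (n%:R * t) +i* trigo.sin (n%:R * t))%C.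
Proof.
elim: n => [|n IHn]; first by rewrite mul0r trigo.cos0 trigo.sin0 expr0.
rewrite exprS IHn -[n.+1]add1n natrD mulrDl mul1r trigo.cosD trigo.sinD.
by apply/eqP; rewrite eq_complex /= eqxx addrC mulrC eqxx.
Qed.

Lemma zeta_prim : 11.-primitive_root (zeta R).
Proof.
have z11 : zeta R ^+ 11 = 1.
  have -> : zeta R = (trigo.cos (2 * trigo.pi / 11) +i* trigo.sin (2 * trigo.pi / 11))%C by [].
  rewrite de_moivre (_ : 11%:R * _ = trigo.pi *+ 2); last first.
    by rewrite mulrC divfK ?pnatr_eq0 // mulr_natl.
  by rewrite trigo.cos2pi trigo.sin2pi.
have [m mP /(primeP (isT : prime 11)).2] := prim_order_exists (isT : (0 < 11)%N) z11.
case/orP => /eqP m1; last by rewrite -m1.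
have : 0 < trigo.sin (2 * trigo.pi / 11 : R).
  have pi0 := trigo.pi_gt0 R; apply: trigo.sin_gt0_pi.
  rewrite divr_gt0 ?mulr_gt0 //= ltr_pdivrMr // mulrC ltr_pM2l //.
  by rewrite ltr_nat.
have := prim_expr_order mP; rewrite m1 expr1 => /eqP.
by rewrite eq_complex /= => /andP[_ /eqP ->]; rewrite ltxx.
Qed.
End Zeta.

(** * The action of the group *)

Section ExteriorSquare.
Variable R : realType.
Local Notation K := R[i].
Implicit Types (A B : 'M[K]_5) (N : nat -> nat -> K).

Definition ypair k := nth (0, 0)%N [:: (0, 1); (1, 2); (2, 3); (3, 4); (4, 0);
                                       (0, 2); (1, 3); (2, 4); (3, 0); (4, 1)]%N k.

Definition minor2 N (k l : nat) : K :=
  N (ypair k).1 (ypair l).1 * N (ypair k).2 (ypair l).2 -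
  N (ypair k).1 (ypair l).2 * N (ypair k).2 (ypair l).1.

Lemma ypair_lt k : ((ypair k).1 < 5)%N && ((ypair k).2 < 5)%N.
Proof. by do 11?[case: k => [|k] //]. Qed.

Lemma ext2E A N : (forall a b : 'I_5, A a b = N a b) ->
  forall k l : 'I_10, ext2 A k l = minor2 N k l.
Proof.
move=> AN k l; have /andP[k1 k2] := ypair_lt k; have /andP[l1 l2] := ypair_lt l.
by rewrite mxE !AN /minor2 /xpair -!/(ypair _) /= !inordK.
Qed.

Lemma ext2M A B : ext2 (A *m B) = ext2 A *m ext2 B.
Proof.
pose N C a b : K := C (inord a : 'I_5) (inord b : 'I_5).
have NE C (a b : 'I_5) : C a b = N C a b by rewrite /N !inord_val.
apply/matrixP => k l; rewrite (ext2E (NE _)) mxE.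
under eq_bigr do rewrite (ext2E (NE _)) (ext2E (NE _)).
rewrite (sum10 (fun m => minor2 _ k m * minor2 _ m l)) /minor2.
move: (ypair k) (ypair l) => -[a b] [c d] /=.
have NM i j : N (A *m B) i j = N A i 0 * N B 0 j + N A i 1 * N B 1 j
  + N A i 2 * N B 2 j + N A i 3 * N B 3 j + N A i 4 * N B 4 j.
  by rewrite /N mxE sum5.
by rewrite !NM; ring.
Qed.

Lemma ext2_1 : ext2 (1%:M : 'M[K]_5) = 1%:M.
Proof.
apply/matrixP => k l; rewrite (@ext2E _ (fun a b => (a == b)%:R)) ?mxE; last first.
  by move=> a b; rewrite mxE.
rewrite -val_eqE /=; case: k l => [k k10] [l l10] /=.
do 10?[case: k k10 => [|k] k10]; last by discriminate k10.
all: do 10?[case: l l10 => [|l] l10]; last by discriminate l10.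
all: by rewrite /minor2 /= ?mulr0 ?mul0r ?mulr1 ?subr0 ?subrr.
Qed.

Variable z : K.
Hypothesis z_prim : 11.-primitive_root z.

Definition yweight a := nth 0%N [:: 1; 9; 4; 3; 5]%N a.

Lemma row_pt_P (i j : nat) :
  row_pt z i j *m ext2 (diag_mx (\row_a z ^+ yweight a)) = row_pt z i j.+1.
Proof.
rewrite (_ : ext2 _ = diag_mx (\row_k z ^+ weight k)).
  apply/rowP => k; rewrite mul_mx_diag !mxE /pt_coord /twist.
  by rewrite mulrAC -exprMn -exprSr.
apply/matrixP => k l; rewrite (@ext2E _ (fun a b => z ^+ yweight a *+ (a == b))); last first.
  by move=> a b; rewrite !mxE val_eqE.
rewrite !mxE -val_eqE /=; case: k l => [k k10] [l l10] /=.
do 10?[case: k k10 => [|k] k10]; last by discriminate k10.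
all: do 10?[case: l l10 => [|l] l10]; last by discriminate l10.
all: rewrite /minor2 /= ?mulr0 ?mul0r ?mulr0n ?mulr1n ?subr0 ?subrr //.
all: by rewrite -exprD; apply: etrans (esym (expr_mod _ (prim_expr_order z_prim))) _.
Qed.

Lemma ext2_shift A :
  (forall a b : 'I_5, A a b = (a == (b.+1 %% 5)%N :> nat)%:R) ->
  forall k l : 'I_10, ext2 A k l = (k == shift5 l :> nat)%:R.
Proof.
move=> AE k l; rewrite (ext2E (N := fun a b => (a == b.+1 %% 5)%N%:R) AE).
case: k l => [k k10] [l l10] /=.
do 10?[case: k k10 => [|k] k10]; last by discriminate k10.
all: do 10?[case: l l10 => [|l] l10]; last by discriminate l10.
all: by rewrite /minor2 /= ?mulr0 ?mul0r ?mulr1 ?subr0 ?subrr.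
Qed.

Lemma row_pt_R A (i j : nat) :
  (forall a b : 'I_5, A a b = (a == (b.+1 %% 5)%N :> nat)%:R) ->
  row_pt z i j *m ext2 A = row_pt z i.+1 (9 * j)%N.
Proof.
move=> AE; apply: rowv_coordP => k k10; rewrite [RHS]coord_row_pt //.
rewrite /xcoord [LHS]mxE.
under eq_bigr do rewrite (ext2_shift AE) inordK //.
have s10 : (shift5 k < 10)%N := shift5_iter_lt 1 k10.
rewrite (bigD1 (Ordinal s10)) //= eqxx mulr1 big1 ?addr0; last first.
  by move=> l; rewrite -val_eqE /= => /negPf ->; rewrite mulr0.
rewrite mxE /= /pt_coord /twist /base_coord iterSr; congr (_ * _).
rewrite -[LHS]exprM -[RHS]exprM -(expr_mod _ (prim_expr_order z_prim)).
rewrite -[in RHS](expr_mod _ (prim_expr_order z_prim)); congr (z ^+ _).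
rewrite (mulnC 9%N) -mulnA -modnMmr -[in RHS]modnMmr; congr ((j * _) %% _)%N.
by move: k k10 {s10}; do 10?[case=> [|] //].
Qed.
End ExteriorSquare.

Lemma ev_exp (K : numFieldType) (z : K) n : ev z (rcons (nseq n Z0) (Zpos 1)) = z ^+ n.
Proof.
elim: n => [|n IHn]; first by rewrite ev_cons ev_nil mulr0 addr0.
by rewrite ev_cons IHn exprS add0r.
Qed.

Lemma ev_foldr (K : numFieldType) (z : K) (I : Type) (f : I -> seq Z) s :
  ev z (foldr (fun i => zadd (f i)) [::] s) = \sum_(i <- s) ev z (f i).
Proof.
by elim: s => [|i s IHs]; rewrite ?big_nil ?ev_nil // big_cons ev_add IHs.
Qed.

(* With S = (0, -1; 1, 0), one has S P^n S = P^m S diag(n, 1/n) P^m for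
   m = -1/n, and diag(n, 1/n) = R^k up to sign. *)
Definition neg_inv11 n := nth 0%N [:: 0; 10; 5; 7; 8; 2; 9; 3; 4; 6; 1]%N n.
Definition dlog11 n := nth 0%N [:: 0; 0; 3; 4; 1; 2; 2; 1; 4; 3; 0]%N n.

Definition weil_exp e a b n :=
  ((11 - e) * n + neg_inv11 n * (yweight a + yweight b))%N.

Definition weil_coefs e a b k : seq Z :=
  foldr (fun n => zadd (rcons (nseq (weil_exp e a b n %% 11) Z0) (Zpos 1))) [::]
    [seq n <- iota 1 10 | (a + b + dlog11 n) %% 5 == k]%N.

Definition weil_inv_coefs : seq (seq (seq Z)) :=
  [::
      [:: [:: -3; 1; 3; 3; 2; -2; -2; 2; 3; 3; 1];
          [:: -3; 1; 2; 2; 0; 2; 2; 0; 2; 2; 1];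
          [:: 2; -1; 2; -2; 0; 0; 0; 0; -2; 2; -1];
          [:: 3; -2; 0; 0; 3; 3; 3; 3; 0; 0; -2];
          [:: -2; 2; 1; 0; 0; -2; -2; 0; 0; 1; 2]];
      [:: [:: 2; 0; -2; -1; 0; 2; 2; 0; -1; -2; 0];
          [:: -2; 0; 2; -2; -2; 3; 3; -2; -2; 2; 0];
          [:: -4; -1; 3; 0; 0; 0; 0; 0; 0; 3; -1];
          [:: 2; 0; 1; 0; 1; -3; -3; 1; 0; 1; 0];
          [:: -2; 0; 0; 2; -2; 1; 1; -2; 2; 0; 0]];
      [:: [:: 0; -1; 0; -1; 2; 0; 0; 2; -1; 0; -1];
          [:: -2; 1; 1; 0; -1; 0; 0; -1; 0; 1; 1];
          [:: -4; 0; 0; 3; -1; 0; 0; -1; 3; 0; 0];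
          [:: 0; 2; -2; 1; 0; -1; -1; 0; 1; -2; 2];
          [:: -2; -2; 2; 0; 1; 0; 0; 1; 0; 2; -2]];
      [:: [:: 0; 1; 1; -2; 1; -1; -1; 1; -2; 1; 1];
          [:: -2; 1; 2; -2; -1; 1; 1; -1; -2; 2; 1];
          [:: 0; 1; 1; -1; -2; 1; 1; -2; -1; 1; 1];
          [:: 0; 0; -1; 2; 0; -1; -1; 0; 2; -1; 0];
          [:: -2; 1; 0; -2; 0; 2; 2; 0; -2; 0; 1]];
      [:: [:: -2; 0; 0; 1; 1; -1; -1; 1; 1; 0; 0];
          [:: 0; 0; -1; 2; 0; -1; -1; 0; 2; -1; 0];
          [:: 0; -2; 0; -1; 1; 2; 2; 1; -1; 0; -2];
          [:: 3; 0; 0; -1; -3; -3; -3; -3; -1; 0; 0];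
          [:: -2; 0; -2; 1; 2; 0; 0; 2; 1; -2; 0]]]%coqZ.

Definition hankel_coefs k := zscale (-1) (nth [::] (nth [::] weil_inv_coefs k) 4).

Section WeilMatrix.
Variables (K : numFieldType) (z : K).
Hypothesis z_prim : 11.-primitive_root z.
Variables (P R S : 'M[K]_5).
Hypothesis PE : P = diag_mx (\row_a z ^+ yweight a).
Hypothesis RE : forall a b : 'I_5, R a b = (a == (b.+1 %% 5)%N :> nat)%:R.
Hypothesis RSR : R *m S *m R = S.
Hypothesis SS : S *m S = 1%:M.
Hypothesis SPS : forall n, (0 < n < 11)%N ->
  S *m P ^+ n *m S = P ^+ neg_inv11 n *m S *m R ^+ dlog11 n *m P ^+ neg_inv11 n.

Definition hankel k := S (inord (k %% 5)) 0.

Lemma P_expE n : P ^+ n = diag_mx (\row_a z ^+ (n * yweight a)).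
Proof.
elim: n => [|n IHn].
  rewrite expr0; apply/matrixP => a b.
  by rewrite !mxE mul0n.
rewrite exprS IHn PE; apply/matrixP => a b.
by rewrite -[_ * _]/(_ *m _) mul_diag_mx !mxE mulrnAr -exprD mulSn.
Qed.

Lemma mulmx_R (A : 'M[K]_5) a b : (A *m R) a b = A a (inord (b.+1 %% 5)).
Proof.
have b5 : (b.+1 %% 5 < 5)%N by rewrite ltn_pmod.
rewrite mxE (bigD1 (inord (b.+1 %% 5))) //= RE inordK // eqxx mulr1 big1 ?addr0 //.
by move=> c; rewrite -val_eqE /= inordK // RE => /negPf ->; rewrite mulr0.
Qed.

Lemma R_mulmx (A : 'M[K]_5) (a b : 'I_5) : (R *m A) (inord (a.+1 %% 5)) b = A a b.
Proof.
have a5 : (a.+1 %% 5 < 5)%N by rewrite ltn_pmod.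
rewrite mxE (bigD1 a) //= RE inordK // eqxx mul1r big1 ?addr0 //.
move=> c ca; rewrite RE inordK // (_ : _ == _ = false) ?mul0r //.
apply: contraNF ca; rewrite -val_eqE /=; case: a c {a5} => [a a5] [c c5] /=.
by do 5?[case: a a5 => [|a] a5 //]; do 5?[case: c c5 => [|c] c5 //].
Qed.

Lemma S_hankel (a b : nat) : S (inord (a %% 5)) (inord (b %% 5)) = hankel (a + b).
Proof.
elim: b a => [|b IHb] a.
  rewrite /hankel addn0 mod0n; congr (S _ _); by apply/val_inj; rewrite /= inordK.
have sE c : inord (c.+1 %% 5) = inord ((inord (c %% 5) : 'I_5).+1 %% 5) :> 'I_5.
  by rewrite inordK ?ltn_pmod // -[(c %% 5).+1]addn1 -[c.+1]addn1 modnDml.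
rewrite -addSnnS -IHb -[in RHS]RSR -mulmxA (sE a) R_mulmx mulmx_R.
by rewrite [in LHS]sE.
Qed.

Lemma S_entry (a b : 'I_5) : S a b = hankel (a + b).
Proof. by rewrite -S_hankel !modn_small // !inord_val. Qed.

Lemma hankel_mod k : hankel (k %% 5) = hankel k.
Proof. by rewrite /hankel modn_mod. Qed.

Lemma SR_entry k (a b : 'I_5) : (S *m R ^+ k) a b = hankel (a + b + k).
Proof.
elim: k b => [|k IHk] b; first by rewrite expr0 mulmx1 S_entry addn0.
rewrite exprSr mulmxA mulmx_R IHk inordK ?ltn_pmod //.
by rewrite /hankel -modnDml modnDmr modnDml addnS addSnnS.
Qed.

Lemma SPS_entry n (a b : 'I_5) : (0 < n < 11)%N ->
  \sum_(c < 5) hankel (a + c) * hankel (c + b) * z ^+ (n * yweight c) =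
  z ^+ (neg_inv11 n * (yweight a + yweight b)) * hankel (a + b + dlog11 n).
Proof.
move=> n11; have := SPS n11; rewrite !P_expE -(mulmxA _ S) => /matrixP/(_ a b).
rewrite [in RHS]mul_mx_diag [in RHS]mul_diag_mx [LHS]mxE [RHS]mxE [X in X * _]mxE SR_entry.
rewrite ![in RHS]mxE mulrAC -exprD -mulnDr => <-; apply: eq_bigr => c _.
by rewrite mul_mx_diag !mxE !S_entry mulrAC.
Qed.

Lemma sum_exp_prim m : ~~ (11 %| m)%N -> \sum_(n < 11) z ^+ (m * n) = 0.
Proof.
move=> m11; have z1 : z ^+ m != 1.
  by rewrite -(expr0 z) (eq_prim_root_expr z_prim) mod0n.
have := subrX1 (z ^+ m) 11; rewrite exprAC (prim_expr_order z_prim) expr1n subrr.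
move/esym/eqP; rewrite mulf_eq0 subr_eq0 (negPf z1) => /eqP e.
by apply: etrans e; apply: eq_bigr => n _; rewrite exprM.
Qed.

(* The projector \sum_n z^(- n e) P^n vanishes if e is not a weight of P. *)
Lemma weil_relation e (a b : 'I_5) : (e < 11)%N ->
    e \notin [:: 1; 9; 4; 3; 5]%N ->
  \sum_(n <- iota 1 10) z ^+ weil_exp e a b n * hankel (a + b + dlog11 n) =
  - (a == b)%:R.
Proof.
move=> e11 eW; apply/eqP; rewrite -addr_eq0 addrC; apply/eqP.
pose F n := z ^+ ((11 - e) * n) *
  \sum_(c < 5) hankel (a + c) * hankel (c + b) * z ^+ (n * yweight c).
transitivity (\sum_(n < 11) F n).
  rewrite (big_ord_recl 10 (fun n : 'I_11 => F n)); congr (_ + _).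
    rewrite /F muln0 mul1r; have /matrixP/(_ a b) := SS; rewrite !mxE => <-.
    by apply: eq_bigr => c _; rewrite mulr1 !S_entry.
  rewrite -[iota 1 10]/(index_iota 1 11) big_add1 big_mkord.
  apply: eq_bigr => n _; rewrite /F SPS_entry; last by rewrite /= ltnS ltn_ord.
  by rewrite mulrA -exprD.
rewrite /F; under eq_bigr do rewrite mulr_sumr.
rewrite exchange_big big1 //= => c _.
transitivity (hankel (a + c) * hankel (c + b) *
    \sum_(n < 11) z ^+ ((11 - e + yweight c) * n)).
  rewrite mulr_sumr; apply: eq_bigr => n _.
  by rewrite mulrCA -exprD mulnDl (mulnC n).
rewrite sum_exp_prim ?mulr0 //.
case: c => c c5 /=; move: e e11 eW {F} c c5.
by do 11?[case=> [|] //]; move=> _ _; do 5?[case=> [|] //].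
Qed.

Lemma weil_linear e (a b : 'I_5) : (e < 11)%N -> e \notin [:: 1; 9; 4; 3; 5]%N ->
  \sum_(k < 5) ev z (weil_coefs e a b k) * hankel k = - (a == b)%:R.
Proof.
move=> e11 eW; rewrite -(weil_relation a b e11 eW).
rewrite (partition_big (fun n => inord ((a + b + dlog11 n) %% 5) : 'I_5) xpredT) //=.
apply: eq_bigr => k _; rewrite ev_foldr big_filter mulr_suml.
apply: eq_big => [n|n /eqP <-].
  by rewrite -val_eqE /= inordK ?ltn_pmod.
by rewrite hankel_mod ev_exp (expr_mod _ (prim_expr_order z_prim)).
Qed.

(* Five relations whose matrix has an inverse with denominator 11. *)
Definition weil_eqn (i : nat) : nat * nat * nat :=
  nth (0, 0, 0)%N [:: (6, 0, 4); (7, 0, 1); (0, 0, 4); (2, 0, 4); (2, 0, 0)]%N i.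

Definition weil_mx : 'M[K]_5 := \matrix_(i, k)
  let: (e, a, b) := weil_eqn i in ev z (weil_coefs e a b k).

Definition weil_inv_mx : 'M[K]_5 :=
  \matrix_(i, k) ev z (nth [::] (nth [::] weil_inv_coefs i) k).

Lemma weil_inv_mul : weil_inv_mx *m weil_mx = 11%:R%:M.
Proof.
apply/matrixP => -[i i5] [j j5]; rewrite mxE sum5 !mxE !inordK //.
apply/eqP; rewrite -subr_eq0; apply/eqP.
do 5?[case: i i5 => [|i] i5]; last by discriminate i5.
all: do 5?[case: j j5 => [|j] j5]; last by discriminate j5.
all: rewrite /=; cyc_compute.
Qed.

Lemma hankelE (k : 'I_5) : 11%:R * hankel k = ev z (hankel_coefs k).
Proof.
pose h : 'cV[K]_5 := \col_k hankel k.
have Ah : weil_mx *m h = - delta_mx (inord 4) 0.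
  apply/matrixP => i j; rewrite !mxE ord1 eqxx andbT.
  under eq_bigr do rewrite !mxE.
  case: i => [i i5]; rewrite -[in RHS]val_eqE /= inordK //.
  have W := fun e a b => @weil_linear e (inord a) (inord b).
  do 5?[case: i i5 => [|i] i5]; last by discriminate i5.
  - by have := W 6%N 0%N 4%N isT isT; rewrite !inordK // -val_eqE /= !inordK.
  - by have := W 7%N 0%N 1%N isT isT; rewrite !inordK // -val_eqE /= !inordK.
  - by have := W 0%N 0%N 4%N isT isT; rewrite !inordK // -val_eqE /= !inordK.
  - by have := W 2%N 0%N 4%N isT isT; rewrite !inordK // -val_eqE /= !inordK.
  - by have := W 2%N 0%N 0%N isT isT; rewrite !inordK // -val_eqE /= !inordK.
have : 11%:R *: h = - col (inord 4) weil_inv_mx.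
  by rewrite -mul_scalar_mx -weil_inv_mul -mulmxA Ah mulmxN -colE.
move=> /matrixP/(_ k 0); rewrite !mxE => ->.
by rewrite /hankel_coefs ev_scale /zinj mulN1r inordK.
Qed.
End WeilMatrix.

Definition pt_coefs i j k : seq Z :=
  cmul (cpow (cpow [:: Z0; Zpos 1] j) (weight k)) (base_coefs (weight (iter i shift5 k))).

Definition minor_coefs l k : seq Z :=
  let h a b := hankel_coefs ((a + b) %% 5)%N in
  let l1 := (ypair l).1 in let l2 := (ypair l).2 in
  let k1 := (ypair k).1 in let k2 := (ypair k).2 in
  zadd (cmul (h l1 k1) (h l2 k2)) (zscale (-1) (cmul (h l1 k2) (h l2 k1))).

Definition image_coefs j k : seq Z :=
  foldr (fun l => zadd (cmul (pt_coefs 0 j l) (minor_coefs l k))) [::] (iota 0 10).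

(* S maps the point p_{0,j} to p_{i',j'} for (i', j') the j-th pair. *)
Definition image_pt j := nth (0, 0)%N
  [:: (0, 0); (4, 5); (1, 4); (0, 3); (1, 3); (3, 7); (3, 4); (1, 8); (0, 8); (1, 7); (4,
    6)]%N j.

Lemma image_coefsP j k : (j < 11)%N -> (k < 10)%N ->
  let q := pt_coefs (image_pt j).1 (image_pt j).2 in
  czero (zadd (cmul (image_coefs j k) (q 0%N)) (zscale (-1) (cmul (image_coefs j 0) (q k)))).
Proof.
move=> j11 k10.
suff /forall_iota/(_ j j11)/forall_iota/(_ k k10) : all (fun j => all (fun k =>
  let q := pt_coefs (image_pt j).1 (image_pt j).2 in
  czero (zadd (cmul (image_coefs j k) (q 0%N)) (zscale (-1) (cmul (image_coefs j 0) (q k)))))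
  (iota 0 10)) (iota 0 11) by exact.
by vm_compute.
Qed.

Section WeilAction.
Variable R : realType.
Local Notation K := R[i].
Variables (z : K) (S : 'M[K]_5).
Hypothesis z_prim : 11.-primitive_root z.
Hypothesis SS : S *m S = 1%:M.
Hypothesis SE : forall a b : 'I_5, 11%:R * S a b = ev z (hankel_coefs ((a + b) %% 5)).

Lemma ev_pt_coefs i j k : ev z (pt_coefs i j k) = pt_coord z i j k.
Proof.
have e : ev z [:: Z0; Zpos 1] = z by rewrite -[RHS]expr1 -ev_exp.
rewrite (ev_cmul z_prim) !(ev_cpow z_prim) e; reflexivity.
Qed.

Lemma ev_image_coefs j k : (k < 10)%N ->
  ev z (image_coefs j k) = 121%:R * xcoord (row_pt z 0 j *m ext2 S) k.
Proof.
move=> k10; rewrite ev_foldr /xcoord mxE mulr_sumr -[iota 0 10]/(index_iota 0 10) big_mkord.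
apply: eq_bigr => l _; rewrite ev_cmul // ev_pt_coefs mxE mulrCA; congr (_ * _).
pose N a b := S (inord a) (inord b).
rewrite (@ext2E _ _ N) => [|a b]; last by rewrite /N !inord_val.
rewrite inordK // ev_add ev_scale !ev_cmul // /minor2 /N.
have /andP[l1 l2] := ypair_lt l; have /andP[k1 k2] := ypair_lt k.
have SN a b : (a < 5)%N -> (b < 5)%N ->
    ev z (hankel_coefs ((a + b) %% 5)) = 11%:R * S (inord a) (inord b).
  by move=> a5 b5; rewrite SE !inordK.
rewrite !SN // /zinj mulN1r (_ : 121%:R = 11%:R * 11%:R :> K); last by rewrite -natrM.
by ring.
Qed.

Lemma row_pt_S j : exists i' j', (row_pt z 0 j *m ext2 S == row_pt z i' j')%MS.
Proof.
rewrite -(row_pt_modr z_prim); set m := (j %% 11)%N.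
have m11 : (m < 11)%N by rewrite ltn_pmod.
clearbody m.
have im5 : ((image_pt m).1 < 5)%N.
  by move: m m11; do 11?[case=> [|] //].
set w := _ *m _.
exists (image_pt m).1, (image_pt m).2.
set q := pt_coord z (image_pt m).1 (image_pt m).2.
have n0 : 121%:R != 0 :> K by rewrite pnatr_eq0.
have wq k : (k < 10)%N -> xcoord w k * q 0%N = xcoord w 0 * q k.
  move=> k10; have /(ev_czero z_prim) := image_coefsP m11 k10.
  rewrite ev_add ev_scale (ev_cmul z_prim (image_coefs m k)).
  rewrite (ev_cmul z_prim (image_coefs m 0)) !ev_pt_coefs !ev_image_coefs // -/w -/(q _).
  rewrite /zinj mulN1r => /eqP; rewrite subr_eq0 -!mulrA => /eqP.
  exact: mulfI.
have q0 : q 0%N != 0 by apply: pt_coord_neq0.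
have wE : w = (xcoord w 0 / q 0%N) *: row_pt z (image_pt m).1 (image_pt m).2.
  apply: rowv_coordP => k k10; rewrite [RHS]mxE -/(xcoord _ _) coord_row_pt // -/q.
  by rewrite mulrAC -wq // mulfK.
apply: (eqmx_scale_row _ wE).
have : row_pt z 0 m != 0 by apply: (row_pt_neq0 z_prim (@ord0 4)).
apply: contraNneq => c0; move: wE; rewrite c0 scale0r /w => w0.
by rewrite -[row_pt _ _ _]mulmx1 -ext2_1 -SS ext2M mulmxA w0 mul0mx.
Qed.
End WeilAction.

Section Permutes.
Variable R : realType.
Local Notation K := R[i].
Variable z : K.
Hypothesis z_prim : 11.-primitive_root z.
Implicit Types A B : 'M[K]_5.

Definition permutes_pts A := forall i j, exists i' j',
  (row_pt z i j *m ext2 A == row_pt z i' j')%MS.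

Lemma permutes_ptsM A B :
  permutes_pts A -> permutes_pts B -> permutes_pts (A *m B).
Proof.
move=> hA hB i j; have [i1 [j1 /eqmxP e1]] := hA i j; have [i2 [j2 /eqmxP e2]] := hB i1 j1.
exists i2, j2; apply/eqmxP; rewrite ext2M mulmxA.
by apply: eqmx_trans e2; apply: eqmxMr.
Qed.

Lemma permutes_ptsX A n : permutes_pts A -> permutes_pts (A ^+ n).
Proof.
move=> hA; elim: n => [|n IHn].
  by rewrite expr0 => i j; exists i, j; rewrite ext2_1 mulmx1; apply/eqmxP.
by rewrite exprS; apply: permutes_ptsM.
Qed.

Variables P Q S : 'M[K]_5.
Hypothesis PE : P = diag_mx (\row_a z ^+ yweight a).
Hypothesis QE : forall a b : 'I_5, Q a b = (a == (b.+1 %% 5)%N :> nat)%:R.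
Hypothesis QSQ : Q *m S *m Q = S.
Hypothesis Q5 : Q ^+ 5 = 1.
Hypothesis SS : S *m S = 1%:M.
Hypothesis SPS : forall n, (0 < n < 11)%N ->
  S *m P ^+ n *m S = P ^+ neg_inv11 n *m S *m Q ^+ dlog11 n *m P ^+ neg_inv11 n.

Lemma row_pt_Pn i j n : row_pt z i j *m ext2 (P ^+ n) = row_pt z i (j + n).
Proof.
elim: n => [|n IHn]; first by rewrite expr0 ext2_1 mulmx1 addn0.
by rewrite exprSr ext2M mulmxA IHn PE row_pt_P // addnS.
Qed.

Lemma row_pt_Qn i j n : row_pt z i j *m ext2 (Q ^+ n) = row_pt z (i + n) (9 ^ n * j).
Proof.
elim: n => [|n IHn]; first by rewrite expr0 ext2_1 mulmx1 addn0 mul1n.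
by rewrite exprSr ext2M mulmxA IHn (row_pt_R z_prim) // addnS mulnA -expnS.
Qed.

Lemma permutes_P : permutes_pts P.
Proof.
move=> i j; exists i, (j + 1)%N; rewrite -(row_pt_Pn i j 1) expr1.
exact/eqmxP.
Qed.

Lemma permutes_Q : permutes_pts Q.
Proof.
move=> i j; exists (i + 1)%N, (9 ^ 1 * j)%N; rewrite -(row_pt_Qn i j 1) expr1.
exact/eqmxP.
Qed.

Lemma QnS n : Q ^+ n *m S = S *m Q ^+ (4 * n).
Proof.
elim: n => [|n IHn]; first by rewrite muln0 mul1mx mulmx1.
have QS : Q *m S = S *m Q ^+ 4.
  by rewrite -[in RHS]QSQ -mulmxA -[Q *m Q ^+ 4]/(Q * Q ^+ 4) -exprS Q5 mulmx1.
rewrite exprSr -(mulmxA (Q ^+ n)) QS mulmxA IHn -mulmxA mulnSr exprD; reflexivity.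
Qed.

Lemma permutes_S : permutes_pts S.
Proof.
have S0 j := row_pt_S z_prim SS (S := S) _ j.
have {}S0 j : exists i' j', (row_pt z 0 j *m ext2 S == row_pt z i' j')%MS.
  apply: S0 => a b; rewrite (S_entry QE QSQ) -hankel_mod.
  by rewrite (hankelE z_prim PE QE QSQ SS SPS (Ordinal (ltn_pmod (a + b) (isT : (0 < 5)%N)))).
move=> i j; have [i1 [j1 /eqmxP e]] := S0 (5 ^ i * j)%N.
exists (i1 + 4 * i)%N, (9 ^ (4 * i) * j1)%N; apply/eqmxP.
have -> : row_pt z i j = row_pt z 0 (5 ^ i * j) *m ext2 (Q ^+ i).
  rewrite row_pt_Qn add0n mulnA -expnMn -(row_pt_modr z_prim) -[in RHS](row_pt_modr z_prim).
  by rewrite -[in RHS]modnMml -modnXm exp1n mul1n.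
rewrite -mulmxA -ext2M QnS ext2M mulmxA -row_pt_Qn.
exact: eqmxMr.
Qed.
End Permutes.

Implicit Types a b c d : 'F_11.

Lemma mx22M a b c d a' b' c' d' : mx22 a b c d *m mx22 a' b' c' d' =
  mx22 (a * a' + b * c') (a * b' + b * d') (c * a' + d * c') (c * b' + d * d').
Proof.
apply/matrixP => -[[|[|//]] i2] -[[|[|//]] j2]; rewrite mxE !big_ord_recl big_ord0.
all: by rewrite !mxE /= addr0.
Qed.

Lemma mx22E (M : 'M['F_11]_2) : M = mx22 (M 0 0) (M 0 1) (M 1 0) (M 1 1).
Proof.
apply/matrixP => -[[|[|//]] i2] -[[|[|//]] j2]; rewrite mxE /=.
all: by congr (M _ _); apply/val_inj.
Qed.

Lemma mx22_1 : mx22 1 0 0 1 = 1%:M.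
Proof. by apply/matrixP => -[[|[|//]] i2] -[[|[|//]] j2]; rewrite !mxE. Qed.

Lemma mx22N a b c d : - mx22 a b c d = mx22 (- a) (- b) (- c) (- d).
Proof. by apply/matrixP => -[[|[|//]] i2] -[[|[|//]] j2]; rewrite !mxE. Qed.

Lemma mx22_upperM a b : mx22 1 a 0 1 *m mx22 1 b 0 1 = mx22 1 (a + b) 0 1.
Proof. by rewrite mx22M !mul1r !mulr1 !mul0r mulr0 !addr0 add0r addrC. Qed.

Lemma mx22_diagM a b a' b' :
  mx22 a 0 0 b *m mx22 a' 0 0 b' = mx22 (a * a') 0 0 (b * b').
Proof. by rewrite mx22M !mulr0 !mul0r !addr0 add0r. Qed.

Lemma mx22_eq a b c d a' b' c' d' :
  [&& a == a', b == b', c == c' & d == d'] -> mx22 a b c d = mx22 a' b' c' d'.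
Proof. by case/and4P => /eqP -> /eqP -> /eqP -> /eqP ->. Qed.

Lemma mx22_SPS n : (0 < n < 11)%N ->
  let s := mx22 0 (- 1) 1 0 in let p := mx22 1 (neg_inv11 n)%:R 0 1 in
  let A := s *m mx22 1 n%:R 0 1 *m s in
  let B := p *m s *m mx22 (4%:R ^+ dlog11 n) 0 0 (3%:R ^+ dlog11 n) *m p in
  A = B \/ A = - B.
Proof.
move=> n11 /=; rewrite !mx22M mx22N.
do 11?[case: n n11 => [|n] n11]; try discriminate n11.
all: by [left; apply: mx22_eq; vm_compute | right; apply: mx22_eq; vm_compute].
Qed.

Lemma mx22_QSQ : mx22 (4%:R ^+ 1) 0 0 (3%:R ^+ 1) *m mx22 0 (- 1) 1 0 *m
  mx22 (4%:R ^+ 1) 0 0 (3%:R ^+ 1) = mx22 0 (- 1) 1 0.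
Proof. by rewrite !mx22M; apply: mx22_eq; vm_compute. Qed.

Lemma mx22_Q5 : mx22 (4%:R ^+ 5) 0 0 (3%:R ^+ 5) = mx22 1 0 0 1.
Proof. by apply: mx22_eq; vm_compute. Qed.

Lemma mx22_dlog11 (x : 'F_11) : x != 0 ->
  let D := mx22 (4%:R ^+ dlog11 x) 0 0 (3%:R ^+ dlog11 x) in
  mx22 x 0 0 x^-1 = D \/ mx22 x 0 0 x^-1 = - D.
Proof.
move=> x0 /=; rewrite mx22N.
case: x x0 => n n11 x0; do 11?[case: n n11 x0 => [|n] n11 x0].
all: try discriminate n11; try discriminate x0.
all: by [left; apply: mx22_eq; vm_compute | right; apply: mx22_eq; vm_compute].
Qed.

Lemma mx22_bruhat0 a b d : a != 0 -> \det (mx22 a b 0 d) = 1 ->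
  mx22 a b 0 d = mx22 1 (a * b) 0 1 *m mx22 a 0 0 a^-1.
Proof.
rewrite mx22_det mulr0 subr0 => a0 ad.
have -> : d = a^-1 by apply: (mulfI a0); rewrite ad mulfV.
rewrite mx22M !mul1r !mulr0 !mul0r !addr0 !add0r mulrAC mulfV // mul1r; reflexivity.
Qed.

Lemma mx22_bruhat a b c d : c != 0 -> \det (mx22 a b c d) = 1 ->
  mx22 a b c d = mx22 1 (a / c) 0 1 *m mx22 0 (- 1) 1 0 *m mx22 c 0 0 c^-1
    *m mx22 1 (d / c) 0 1.
Proof.
rewrite mx22_det => c0 /eqP; rewrite subr_eq => /eqP e.
have eb : b = (a * d - 1) / c by rewrite e addrAC subrr add0r mulfK.
rewrite eb !mx22M; apply: mx22_eq; apply/and4P; split; apply/eqP.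
all: by field.
Qed.

Definition mxGL (M : 'M['F_11]_2) : {'GL_2['F_11]} := insubd (1%g : {'GL_2['F_11]}) M.

Lemma mxGLK M : \det M = 1 -> GLval (mxGL M) = M.
Proof.
move=> dM; have -> : GLval (mxGL M) = val (mxGL M) by case: (mxGL M).
by rewrite insubdK // -[_ \in _]/(M \in unitmx) unitmxE dM unitr1.
Qed.

Lemma mxGL_SL M : \det M = 1 -> mxGL M \in SL2_11.
Proof. by move=> dM; rewrite inE mxGLK ?dM. Qed.

Lemma mxGLM M N : \det M = 1 -> \det N = 1 -> mxGL (M *m N) = (mxGL M * mxGL N)%g.
Proof.
move=> dM dN; apply/val_inj; change (GLval (mxGL (M *m N)) = GLval (mxGL M * mxGL N)%g).
by rewrite GL_MxE !mxGLK // det_mulmx dM dN mulr1.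
Qed.

Lemma mxGL1 : mxGL 1%:M = 1%g.
Proof. by apply/val_inj; change (GLval (mxGL 1%:M) = 1%:M); rewrite mxGLK ?det1. Qed.

Lemma mxGL_N1_center : mxGL (- 1%:M) \in 'Z(SL2_11)%g.
Proof.
have dN1 : \det (- 1%:M : 'M['F_11]_2) = 1.
  by rewrite -mx22_1 mx22N mx22_det; apply/val_inj.
apply/centerP; split=> [|g gS]; first exact: mxGL_SL.
apply/val_inj; change (GLval (mxGL (- 1%:M) * g)%g = GLval (g * mxGL (- 1%:M))%g).
by rewrite !GL_MxE mxGLK // mulmxN mulNmx mulmx1 mul1mx.
Qed.

Section Representation.
Variable R : realType.
Local Notation K := R[i].
Variable rho : mx_representation K PSL2_11 5.
Hypothesis rhoP : is_V5dual rho.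

Definition rhomx (M : 'M['F_11]_2) : 'M[K]_5 := rho (coset 'Z(SL2_11)%g (mxGL M)).

Let mem_PSL M : \det M = 1 -> coset 'Z(SL2_11)%g (mxGL M) \in PSL2_11.
Proof. by move=> dM; apply: mem_quotient; apply: mxGL_SL. Qed.

Lemma rhomxM M N : \det M = 1 -> \det N = 1 -> rhomx (M *m N) = rhomx M *m rhomx N.
Proof.
move=> dM dN; have nZ := subsetP (normal_norm (center_normal SL2_11_group)).
rewrite /rhomx mxGLM // morphM ?nZ ?mxGL_SL //.
by rewrite repr_mxM ?mem_PSL.
Qed.

Lemma detM1 M N : \det M = 1 -> \det N = 1 -> \det (M *m N : 'M['F_11]_2) = 1.
Proof. by move=> dM dN; rewrite det_mulmx dM dN mulr1. Qed.

Lemma rhomxM3 M N A : \det M = 1 -> \det N = 1 -> \det A = 1 ->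
  rhomx M *m rhomx N *m rhomx A = rhomx (M *m N *m A).
Proof. by move=> dM dN dA; rewrite (rhomxM (detM1 dM dN)) // rhomxM. Qed.

Lemma rhomxM4 M N A B : \det M = 1 -> \det N = 1 -> \det A = 1 -> \det B = 1 ->
  rhomx M *m rhomx N *m rhomx A *m rhomx B = rhomx (M *m N *m A *m B).
Proof.
move=> dM dN dA dB; rewrite (rhomxM (detM1 (detM1 dM dN) dA)) //.
by rewrite rhomxM3.
Qed.

Lemma rhomx1 : rhomx 1%:M = 1%:M.
Proof. rewrite /rhomx mxGL1 coset_id ?group1 //; exact: repr_mx1. Qed.

Lemma det_mx22_N M : \det M = 1 -> \det (- M : 'M['F_11]_2) = 1.
Proof. by move=> dM; rewrite -scaleN1r detZ dM mulr1; apply/val_inj. Qed.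

Lemma rhomxN M : \det M = 1 -> rhomx (- M) = rhomx M.
Proof.
move=> dM; rewrite -[in LHS](mul1mx M) -mulNmx rhomxM ?det_mx22_N ?det1 //.
by rewrite {1}/rhomx coset_id ?mxGL_N1_center // repr_mx1 mul1mx.
Qed.

Lemma PSL_elt g : g \in PSL2_11 -> exists2 M, \det M = 1 & rho g = rhomx M.
Proof.
case/morphimP => x _ xS ->; exists (GLval x); first by move: xS; rewrite inE => /eqP.
rewrite /rhomx; congr (rho (coset _ _)); apply/val_inj; symmetry.
by apply: mxGLK; move: xS; rewrite inE => /eqP.
Qed.

Lemma rhomx_PSL_inv M : \det M = 1 ->
  exists2 g, g \in PSL2_11 & rho g^-1%g = rhomx M.
Proof.
move=> dM; exists (coset 'Z(SL2_11)%g (mxGL M))^-1%g; last by rewrite invgK.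
by rewrite groupV mem_PSL.
Qed.

Let P := rhomx (mx22 1 1 0 1).
Let Q := rhomx (mx22 4%:R 0 0 3%:R).
Let S := rhomx (mx22 0 (- 1) 1 0).

Lemma rhomx_PE : P = diag_mx (\row_a zeta R ^+ yweight a).
Proof.
have [_ <- _] := rhoP; congr (rho (coset _ _)); apply/val_inj.
by change (GLval (mxGL (mx22 1 1 0 1)) = mx22 1 1 0 1); rewrite mxGLK ?mx22_det //;
  apply/val_inj.
Qed.

Lemma rhomx_QE (a b : 'I_5) : Q a b = (a == (b.+1 %% 5)%N :> nat)%:R.
Proof.
have [_ _ /(_ b)] := rhoP; have -> : rho PSL_R = Q.
  congr (rho (coset _ _)); apply/val_inj.
  change (mx22 4%:R 0 0 3%:R = GLval (mxGL (mx22 4%:R 0 0 3%:R))).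
  by rewrite mxGLK ?mx22_det //; apply/val_inj.
move/matrixP/(_ a 0); rewrite !mxE eqxx andbT => ->; congr (_%:R).
by rewrite -val_eqE /=; case: b => -[|[|[|[|[|//]]]]].
Qed.

Lemma det_Pn (x : 'F_11) : \det (mx22 1 x 0 1) = 1.
Proof. by rewrite mx22_det mulr0 mulr1 subr0. Qed.

Lemma det_Qn n : \det (mx22 (4%:R ^+ n) 0 0 (3%:R ^+ n)) = 1.
Proof.
rewrite mx22_det mulr0 subr0 -exprMn (_ : 4%:R * 3%:R = 1) ?expr1n //.
exact/val_inj.
Qed.

Lemma rhomx_Pn (n : nat) : P ^+ n = rhomx (mx22 1 n%:R 0 1).
Proof.
elim: n => [|n IHn]; first by rewrite mx22_1 rhomx1.
rewrite exprS IHn; apply: etrans (esym (rhomxM (det_Pn _) (det_Pn _))) _.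
rewrite mx22_upperM (mulrS (1 : 'F_11) n); reflexivity.
Qed.

Lemma rhomx_Qn (n : nat) : Q ^+ n = rhomx (mx22 (4%:R ^+ n) 0 0 (3%:R ^+ n)).
Proof.
elim: n => [|n IHn]; first by rewrite !expr0 mx22_1 rhomx1.
rewrite exprS IHn; apply: etrans (esym (rhomxM (det_Qn 1) (det_Qn _))) _.
rewrite mx22_diagM -[4%:R * _]exprS -[3%:R * _]exprS; reflexivity.
Qed.

Lemma det_S : \det (mx22 0 (- 1) 1 0) = 1.
Proof. by rewrite mx22_det mul0r mulN1r opprK add0r. Qed.

Lemma rhomx_SS : S *m S = 1%:M.
Proof.
apply: etrans (esym (rhomxM det_S det_S)) _.
rewrite mx22M !(mul0r, mulr0, mulr1, mul1r, addr0, add0r) -{1 2}[0]oppr0 -mx22N mx22_1.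
rewrite rhomxN ?det1; first exact: rhomx1.
reflexivity.
Qed.

Lemma rhomx_QSQ : Q *m S *m Q = S.
Proof.
apply: etrans (rhomxM3 (det_Qn 1) det_S (det_Qn 1)) _.
rewrite mx22_QSQ; reflexivity.
Qed.

Lemma rhomx_Q5 : Q ^+ 5 = 1.
Proof. rewrite rhomx_Qn mx22_Q5 mx22_1; exact: rhomx1. Qed.

Lemma rhomx_SPS n : (0 < n < 11)%N ->
  S *m P ^+ n *m S = P ^+ neg_inv11 n *m S *m Q ^+ dlog11 n *m P ^+ neg_inv11 n.
Proof.
move=> n11; have e1 := rhomx_Pn n; have e2 := rhomx_Pn (neg_inv11 n).
have e3 := rhomx_Qn (dlog11 n); have e4 : S = rhomx (mx22 0 (- 1) 1 0) := erefl S.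
clearbody P Q S; rewrite {}e1 {}e2 {}e3 {}e4.
have dS := det_S; have dP := det_Pn (neg_inv11 n)%:R; have dQ := det_Qn (dlog11 n).
apply: etrans (rhomxM3 dS (det_Pn n%:R) dS) _.
apply: etrans _ (esym (rhomxM4 dP dS dQ dP)).
have [->|->] := mx22_SPS n11; first reflexivity.
exact: (rhomxN (detM1 (detM1 (detM1 dP dS) dQ) dP)).
Qed.

Let permutes := permutes_pts (zeta R).

Let permutes_rhoM M N : \det M = 1 -> \det N = 1 ->
  permutes (rhomx M) -> permutes (rhomx N) -> permutes (rhomx (M *m N)).
Proof. by move=> dM dN hM hN; rewrite (rhomxM dM dN); exact: (permutes_ptsM hM hN). Qed.

Lemma permutes_upper (x : 'F_11) : permutes (rhomx (mx22 1 x 0 1)).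
Proof.
have -> : x = (nat_of_ord x)%:R by rewrite (natr_Zp (x : 'Z_11)).
rewrite -rhomx_Pn; apply: permutes_ptsX; exact: (permutes_P (zeta_prim R) rhomx_PE).
Qed.

Lemma permutes_diag (x : 'F_11) : x != 0 -> permutes (rhomx (mx22 x 0 0 x^-1)).
Proof.
move=> x0; have h k : permutes (rhomx (mx22 (4%:R ^+ k) 0 0 (3%:R ^+ k))).
  rewrite -rhomx_Qn; apply: permutes_ptsX; exact: (permutes_Q (zeta_prim R) rhomx_QE).
by have [->|->] := mx22_dlog11 x0; rewrite ?rhomxN //; apply: det_Qn.
Qed.

Lemma permutes_rhoS : permutes S.
Proof.
exact: (permutes_S (zeta_prim R) rhomx_PE rhomx_QE rhomx_QSQ rhomx_Q5 rhomx_SS rhomx_SPS).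
Qed.

Lemma permutes_rhomx M : \det M = 1 -> permutes (rhomx M).
Proof.
rewrite (mx22E M); move: (M 0 0) (M 0 1) (M 1 0) (M 1 1) => a b c d.
have dD x : x != 0 -> \det (mx22 x 0 0 x^-1) = 1.
  by move=> x0; rewrite mx22_det mulr0 subr0 mulfV.
move=> dM; have [c0|c0] := eqVneq c 0.
  rewrite c0 in dM *; have a0 : a != 0.
    by apply: contra_eq_neq dM => ->; rewrite mx22_det mulr0 mul0r subr0.
  rewrite (mx22_bruhat0 a0 dM).
  exact: (permutes_rhoM (det_Pn _) (dD _ a0) (permutes_upper _) (permutes_diag a0)).
rewrite (mx22_bruhat c0 dM).
have dPS := detM1 (det_Pn (a / c)) det_S; have dPSD := detM1 dPS (dD _ c0).
apply: (permutes_rhoM dPSD (det_Pn _)); last exact: permutes_upper.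
apply: (permutes_rhoM dPS (dD _ c0)); last exact: permutes_diag.
exact: (permutes_rhoM (det_Pn _) det_S (permutes_upper _) permutes_rhoS).
Qed.

Lemma actV10_row_pt g : g \in PSL2_11 -> forall i j : nat,
  exists (i' : 'I_5) (j' : 'I_11),
    (actV10 rho g (row_pt (zeta R) i j) == row_pt (zeta R) i' j')%MS.
Proof.
rewrite -groupV => /PSL_elt[M dM rE] i j; rewrite /actV10 rE.
have [i1 [j1 e]] := permutes_rhomx dM i j.
have [i' [j' e']] := row_ptE (zeta_prim R) i1 j1.
by exists i', j'; rewrite -e'.
Qed.

Lemma actV10_transitive (i j i' j' : nat) : (i <= 5)%N -> (j <= 11)%N ->
  exists2 g, g \in PSL2_11 &
    actV10 rho g (row_pt (zeta R) i j) = row_pt (zeta R) i' j'.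
Proof.
move=> i5 j11; have zP := zeta_prim R.
have dP m := det_Pn m%:R; have dQ := det_Qn (5 - i + i').
have [g gG rE] := rhomx_PSL_inv (detM1 (detM1 (dP (11 - j)%N) dQ) (dP j')).
exists g => //; rewrite /actV10 rE -(rhomxM3 (dP _) dQ (dP _)).
rewrite -(rhomx_Pn (11 - j)) -(rhomx_Pn j') -rhomx_Qn !ext2M !mulmxA.
rewrite (row_pt_Pn zP rhomx_PE) (row_pt_Qn zP rhomx_QE) (row_pt_Pn zP rhomx_PE).
rewrite subnKC // addnA subnKC // -row_pt_modl -(row_pt_modr zP) modnMDl modnDl.
by rewrite row_pt_modl (row_pt_modr zP).
Qed.
End Representation.

Theorem proposition4p2 (R : realType) :
  exists p : 'I_5 -> 'I_11 -> 'rV[R[i]]_10,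
    [/\ forall i j, p i j != 0,
        forall i j i' j', (p i j == p i' j')%MS -> (i, j) = (i', j'),
        forall v : 'rV[R[i]]_10, v != 0 ->
          (peskine_singular v <-> exists i j, (v == p i j)%MS),
        (forall i j, \rank (contract (p i j)) = 4%N) /\
        (forall v : 'rV[R[i]]_10, peskine v -> ~~ peskine_singular v ->
           \rank (contract v) = 6%N)
      & forall rho : mx_representation R[i] PSL2_11 5, is_V5dual rho ->
          (forall g, g \in PSL2_11 -> forall i j,
             exists i' j', (actV10 rho g (p i j) == p i' j')%MS) /\
          (forall i j i' j',
             exists2 g, g \in PSL2_11 & (actV10 rho g (p i j) == p i' j')%MS)].
Proof.
have zP := zeta_prim R.
exists (fun i j => row_pt (zeta R) i j); split.
- by move=> i j; apply: row_pt_neq0.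
- by move=> i j i' j'; apply: row_pt_inj.
- move=> v v0; rewrite peskine_singularE //; exact: rank_contract_le4P.
- split=> [i j|v /andP[v0 r6]]; first exact: rank_contract_row_pt.
  by rewrite peskine_singularE // => r4; have [r|//] := rank_contract r6; rewrite r in r4.
move=> rho rhoP; split=> [g gG i j|i j i' j']; first exact: actV10_row_pt.
have [g gG e] := actV10_transitive rhoP i' j' (ltnW (ltn_ord i)) (ltnW (ltn_ord j)).
by exists g => //; rewrite e; apply/eqmxP.
Qed.
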